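(* Let $k$ be a positive integer and $\epsilon>0$, and let $p_1<p_2<\cdots$ be the sequence of prime numbers. Then for all sufficiently large integers $h$ (depending on $k$ and $\epsilon$) there exist an integer $n$ and a set $\mathscr{J}\subseteq\{n+1,\dots,\lfloor(1+\epsilon)n\rfloor\}$ such that \[ h=\sum_{i=1}^{n}\lfloor\sqrt[k]{p_i}\rfloor+\sum_{j\in\mathscr{J}}\lfloor\sqrt[k]{p_j}\rfloor. \] *)

(* Defs.v *)
From mathcomp Require Import all_boot all_order all_algebra.
Set Implicit Arguments. Unset Strict Implicit. Unset Printing Implicit Defensive.
Import Order.TTheory GRing.Theory Num.Theory.

Lemma exists_prime_above (m : nat) : exists p, (m < p) && prime p.
Proof. by case: (prime_above m) => p H1 H2; exists p; rewrite H1 H2. Qed.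

Definition next_prime (m : nat) : nat := ex_minn (exists_prime_above m).

(* nth_prime i = p_i, the i-th prime, 1-indexed: p_1 = 2, p_2 = 3, ...
   (nth_prime 0 is a dummy value, never used). *)
Fixpoint nth_prime (i : nat) : nat :=
  match i with
  | 0 => 0
  | 1 => 2
  | i'.+1 => next_prime (nth_prime i')
  end.

Definition floor_root (k x : nat) : nat :=
  \max_(m < x.+1 | m ^ k <= x) m.

(* Main.v *)
(** Write [a_j] for the integer part of the k-th root of [p_j]. Choose [n]
    maximal with (1 + 1/(2e)) (a_1 + ... + a_n) <= h, where 1/e <= eps; it then
    suffices to reach the remainder h - (a_1 + ... + a_n) by a subset sum of
    the [a_j] with [j] in the window (n, n + n/e], and this remainder lies well
    inside the range of those sums.

    By Chebyshev's bound the window contains values [a_j] that are dense up to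
    a small power of [n]. The pigeonhole principle gives many disjoint pairs of
    indices whose values differ by a common small [D], hence a progression of
    difference [D]; pairs whose values are congruent modulo [D] lengthen it
    considerably. If every prime [q] dividing [D] fails to divide enough of the
    [a_j], then at most [D] further indices hit all residues modulo [D], and the
    subset sums fill an interval longer than any [a_j]. The unused indices are
    added one at a time and extend this interval over the whole range.

    For k = 1 no small [q] divides any [a_j]. For k >= 2, if [q] divided nearly
    all [a_j] of the window, the fractional part of [p_j^(1/k) / q] would be
    below 1/2, where sin(2 pi x) + cos(4 pi x) / 2 is at least 1/2; this
    contradicts cancellation in sums of cos(c p^(1/k) + phi) over primes, proved
    by Vaughan's identity and the Kusmin-Landau inequality. *)
Require Import Defs.
From mathcomp Require Import all_boot all_order all_algebra.
From mathcomp Require Import boolp classical_sets reals trigo exp topology.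
From mathcomp Require Import normedtype derive realfun.
From mathcomp Require Import zify ring lra.
Set Implicit Arguments. Unset Strict Implicit. Unset Printing Implicit Defensive.
Import Order.TTheory GRing.Theory Num.Theory.
Import numFieldNormedType.Exports.

(** * Subset sums *)

(** All sizes are powers of one parameter [T] with [T ^ (k * N) <= n < T ^ (k * N + 1)]. It is a
    small power of [n] and yet exceeds a multiple of log n, so logarithms and constants cost bounded
    powers of [T] and the argument becomes a comparison of exponents. About the primes of the window
    only the upper bound [n * T] is known; their gaps and the length of the interval they occupy are
    not controlled. Hence the density of values comes from counting how often one value can repeat,
    and divisibility is handled by trigonometric sums that save a fixed power of [T]. The difference
    [D] is handed out by the pigeonhole principle and cannot be prescribed. Non-divisibility is
    therefore needed for every prime [q] up to the bound on [D], itself a power of [T], and the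
    trigonometric estimates must be uniform down to frequencies of order [1 / q]. Equidistribution
    is more than required: a one-sided test function of mean zero suffices. *)

Definition subsum (a : nat -> nat) (s : seq nat) (t : nat) : Prop :=
  exists J, [/\ uniq J, {subset J <= s} & t = \sum_(j <- J) a j].

Lemma subsum0 a s : subsum a s 0.
Proof. by exists [::]; rewrite big_nil. Qed.

Lemma subsum_sub a s1 s2 t :
  {subset s1 <= s2} -> subsum a s1 t -> subsum a s2 t.
Proof. by move=> s12 [J [uJ Js ->]]; exists J; split=> // j /Js /s12. Qed.

Lemma subsum_cat a s1 s2 t1 t2 : uniq (s1 ++ s2) ->
  subsum a s1 t1 -> subsum a s2 t2 -> subsum a (s1 ++ s2) (t1 + t2).
Proof.
rewrite cat_uniq => /and3P[_ /hasPn s12 _] [J1 [u1 sub1 ->]] [J2 [u2 sub2 ->]].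
exists (J1 ++ J2); split; last by rewrite big_cat.
  rewrite cat_uniq u1 u2 andbT /=; apply/hasPn => j /sub2 /s12.
  by apply: contra => /sub1.
by move=> j; rewrite !mem_cat => /orP[/sub1->|/sub2->]; rewrite ?orbT.
Qed.

Lemma subsum_cons a j s t : j \notin s ->
  subsum a s t -> subsum a (j :: s) (a j + t).
Proof.
move=> js [J [uJ Js ->]]; exists (j :: J); split; last by rewrite big_cons.
  by rewrite /= uJ andbT; apply: contra js => /Js.
by move=> i; rewrite !inE => /orP[->//|/Js->]; rewrite orbT.
Qed.

Lemma subsum_consr a j s t : subsum a s t -> subsum a (j :: s) t.
Proof. by apply: subsum_sub => i; rewrite inE orbC => ->. Qed.

(** Each sum takes exactly one of [u] and [w]. With [u] the old progression is translated by [a u],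
    with [w] it is moved [e] steps further, and [e <= I.+1] leaves no gap between the two runs. *)
Lemma ladder_step a s b D I e u w :
  (forall i, i <= I -> subsum a s (b + D * i)) ->
  uniq [:: u, w & s] -> a w = a u + D * e -> e <= I.+1 ->
  forall i, i <= I + e -> subsum a [:: u, w & s] (b + a u + D * i).
Proof.
move=> H /= /and3P[+ ws _] aw eI i iI; rewrite inE negb_or => /andP[_ us].
case: (leqP i I) => iI'.
  rewrite addnAC addnC; apply: subsum_sub (subsum_cons us (H i iI')).
  by move=> j; rewrite !inE => /orP[->//|->]; rewrite !orbT.
have ie : e <= i by lia.
have -> : b + a u + D * i = a w + (b + D * (i - e)).
  have : D * e <= D * i by rewrite leq_mul2l ie orbT.
  by rewrite aw mulnBr; lia.
by apply: subsum_consr; apply: subsum_cons ws (H _ _); lia.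
Qed.

Definition unpair (ps : seq (nat * nat)) : seq nat :=
  flatten [seq [:: p.1; p.2] | p <- ps].

Lemma unpair_cons p ps : unpair (p :: ps) = [:: p.1, p.2 & unpair ps].
Proof. by []. Qed.

Lemma mem_unpair ps p : p \in ps -> (p.1 \in unpair ps) && (p.2 \in unpair ps).
Proof.
elim: ps => // q ps IH; rewrite inE unpair_cons !inE => /orP[/eqP->|/IH/andP[-> ->]].
  by rewrite !eqxx orbT.
by rewrite !orbT.
Qed.

Lemma size_unpair ps : size (unpair ps) = (size ps).*2.
Proof. by elim: ps => // p ps IH; rewrite unpair_cons /= IH doubleS. Qed.

Lemma unpair_sub ps (s : seq nat) :
  (forall p, p \in ps -> (p.1 \in s) && (p.2 \in s)) -> {subset unpair ps <= s}.
Proof.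
elim: ps => // p ps IH H j; rewrite unpair_cons !inE.
have /andP[h1 h2] := H p (mem_head _ _).
case/or3P => [/eqP->|/eqP->|] //; apply: IH => q qps; apply: H.
by rewrite inE qps orbT.
Qed.

(** The progression only grows, so comparing each [e] with the initial length [I] is enough. A pair
    with [e > E] is credited with [E] steps only; the start moves up by the smaller value of each
    pair. *)
Lemma ladder_pairs a s b D I E M ps :
  (forall i, i <= I -> subsum a s (b + D * i)) ->
  uniq (unpair ps ++ s) ->
  (forall p, p \in ps -> a p.1 <= M) ->
  (forall p, p \in ps ->
    exists e, [/\ a p.2 = a p.1 + D * e, E <= e & e <= I.+1]) ->
  exists b', b' <= b + size ps * M /\
    forall i, i <= I + size ps * E -> subsum a (unpair ps ++ s) (b' + D * i).
Proof.
move=> H; elim: ps => [|p ps IH] u aM He.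
  by exists b; rewrite /= !mul0n !addn0.
case: IH.
- by move: u; rewrite unpair_cons /= => /and3P[].
- by move=> q qps; apply: aM; rewrite inE qps orbT.
- by move=> q qps; apply: He; rewrite inE qps orbT.
move=> b' [b'le Hb']; exists (b' + a p.1); split.
  by have := aM p (mem_head _ _); rewrite /= mulSn; lia.
have [e [ape Ee eI]] := He p (mem_head _ _).
move=> i iI; apply: (ladder_step Hb' u ape); first lia.
by move: iI; rewrite /= mulSn; lia.
Qed.

(** An interval of length at least [M] overlaps its translate by [a j <= M], so each new index
    raises the upper end by [a j] and keeps the lower end. *)
Lemma interval_fill a M B lo hi F :
  (forall t, lo <= t <= hi -> subsum a B t) -> lo + M <= hi ->
  uniq (F ++ B) -> (forall j, j \in F -> a j <= M) ->
  forall t, lo <= t <= hi + \sum_(j <- F) a j -> subsum a (F ++ B) t.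
Proof.
move=> HB loM; elim: F => [|j F IH] u aM t.
  by rewrite big_nil addn0; apply: HB.
have aj := aM j (mem_head _ _).
have {}IH : forall t, lo <= t <= hi + \sum_(j <- F) a j -> subsum a (F ++ B) t.
  apply: IH; first by move: u => /= /andP[].
  by move=> i iF; apply: aM; rewrite inE iF orbT.
rewrite big_cons => tb.
case: (leqP t (hi + \sum_(j <- F) a j)) => tle.
  by apply: subsum_consr; apply: IH; lia.
have -> : t = a j + (t - a j) by lia.
apply: subsum_cons; first by move: u => /= /andP[].
by apply: IH; lia.
Qed.

Lemma pigeonhole (f : nat -> nat) (vs : seq nat) C K :
  (forall v, v \in vs -> f v < C) -> C * K < size vs ->
  exists2 c, c < C & K < count (fun v => f v == c) vs.
Proof.
move=> fC lt.
have sz : size vs = \sum_(c < C) count (fun v => f v == c) vs.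
  elim: vs fC {lt} => [|v vs IH] fC; first by rewrite big1.
  rewrite /= big_split /= -IH; last by move=> w wv; apply: fC; rewrite inE wv orbT.
  have fv := fC v (mem_head _ _).
  rewrite (bigD1 (Ordinal fv)) //= eqxx big1 //.
  by move=> c; rewrite -val_eqE /= eq_sym => /negbTE->.
case: (boolP [exists c : 'I_C, K < count (fun v => f v == c) vs]).
  by case/existsP => c h; exists c.
rewrite negb_exists => /forallP h; exfalso.
move: lt; rewrite sz ltnNge => /negP; apply.
rewrite (leq_trans (n := \sum_(c < C) K)) //; last by rewrite sum_nat_const card_ord.
by apply: leq_sum => c _; rewrite leqNgt.
Qed.

Lemma uniq_unpair_nth (f g : nat -> nat) (t : seq nat) :
  (forall i j, i \in t -> j \in t -> f i = f j -> i = j) ->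
  (forall i j, i \in t -> j \in t -> g i = g j -> i = j) ->
  (forall i j, i \in t -> j \in t -> f i <> g j) -> uniq t ->
  uniq (unpair [seq (f i, g i) | i <- t]).
Proof.
move=> fi gi fg; elim: t fi gi fg => // x t IH fi gi fg /= /andP[xt ut].
have sub i : i \in t -> i \in x :: t by rewrite inE => ->; rewrite orbT.
rewrite IH //; [|by move=> i j /sub hi /sub hj; auto..].
have mu y : y \in unpair [seq (f i, g i) | i <- t] ->
    exists2 i, i \in t & y = f i \/ y = g i.
  elim: t {IH xt ut sub fi gi fg} => // z t IH; rewrite /= unpair_cons !inE.
  case/or3P => [/eqP->|/eqP->|/IH[i it h]].
  - by exists z; [rewrite mem_head|left].
  - by exists z; [rewrite mem_head|right].
  - by exists i; rewrite // inE it orbT.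
rewrite andbT inE negb_or -andbA; apply/and3P; split.
- by apply/eqP; apply: fg; rewrite mem_head.
- apply/negP => /mu[i it [h|h]].
    by move: xt; rewrite (fi x i) ?mem_head ?sub ?it.
  by apply: (fg x i); rewrite ?mem_head ?sub.
- apply/negP => /mu[i it [h|h]].
    by apply: (fg i x); rewrite ?mem_head ?sub.
  by move: xt; rewrite (gi x i) ?mem_head ?sub ?it.
Qed.

Lemma sorted_nth_gap (vs : seq nat) i j : sorted ltn vs ->
  i + j < size vs -> nth 0 vs i + j <= nth 0 vs (i + j).
Proof.
move=> so; elim: j => [|j IH] h; first by rewrite !addn0.
rewrite addnS; apply: leq_ltn_trans (IH _) _; first lia.
rewrite addnS in h *; rewrite (sorted_ltn_nth ltn_trans) ?inE //; lia.
Qed.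

(** The sorted values are paired at positions [2i] and [2i + 1], which makes the pairs disjoint.
    Their gaps add up to at most [M], so at most [M %/ l] of them reach [l]; among the others one
    gap [D] occurs more than [R] times. *)
Lemma close_pairs (vs : seq nat) M l R :
  sorted ltn vs -> (forall v, v \in vs -> v <= M) -> 0 < l ->
  M %/ l + l * R < (size vs)./2 ->
  exists D ps, [/\ 0 < D, D < l, size ps = R, uniq (unpair ps) &
    forall p, p \in ps -> [/\ p.1 \in vs, p.2 \in vs & p.2 = p.1 + D]].
Proof.
move=> so vM l0 big.
set m := (size vs)./2 in big *.
have m2 : m.*2 <= size vs by rewrite /m; lia.
pose d i := nth 0 vs i.*2.+1 - nth 0 vs i.*2.
have dpos i : i < m -> nth 0 vs i.*2 + 1 <= nth 0 vs i.*2.+1.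
  move=> im; have := @sorted_nth_gap vs i.*2 1 so.
  by rewrite !addn1; apply; lia.
have dsum j : j < m -> \sum_(i < j.+1) d i <= nth 0 vs j.*2.+1.
  elim: j => [|j IH] jm.
    by rewrite big_ord_recr big_ord0 /= /d; lia.
  have h1 := IH (ltnW jm).
  have h2 : nth 0 vs j.*2.+1 <= nth 0 vs j.+1.*2.
    have := @sorted_nth_gap vs j.*2.+1 1 so; rewrite !addn1 -doubleS => h; lia.
  rewrite big_ord_recr; apply: leq_trans (leq_add h1 (leqnn _)) _.
  by rewrite -[nat_of_ord ord_max]/j.+1; have := dpos _ jm; rewrite /d; move: h2; lia.
pose far := count (fun i => l <= d i) (iota 0 m).
have farl : far * l <= M.
  have : far * l <= \sum_(i < m) d i.
    rewrite /far -(big_mkord xpredT d) /index_iota subn0.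
    elim: (iota 0 m) => [|i t IH]; first by rewrite big_nil.
    by rewrite big_cons /=; case: leqP; lia.
  move: (far * l) => fl; case: m m2 dpos dsum {big far} => [|j] m2 dpos dsum.
    by rewrite big_ord0; lia.
  move=> h; apply: leq_trans h (leq_trans (dsum j (ltnSn _)) _).
  by apply: vM; apply: mem_nth.
have farle : far <= M %/ l by rewrite leq_divRL.
pose t0 := [seq i <- iota 0 m | d i < l].
have szt0 : far + size t0 = m.
  rewrite /t0 size_filter -[RHS](size_iota 0 m) -(count_predC (fun i => l <= d i) (iota 0 m)).
  by congr addn; apply: eq_count => i /=; rewrite ltnNge.
have [D Dl cD] : exists2 c, c < l & R < count (fun v => d v == c) t0.
  apply: pigeonhole; first by move=> v; rewrite mem_filter => /andP[].
  lia.
pose t := take R [seq i <- t0 | d i == D].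
have tm i : i \in t -> i < m /\ d i = D.
  move=> /mem_take; rewrite mem_filter => /andP[/eqP dD].
  by rewrite mem_filter mem_iota => /and3P[_ _ im].
have st : size t = R by rewrite size_takel // size_filter ltnW.
exists D, [seq (nth 0 vs i.*2, nth 0 vs i.*2.+1) | i <- t].
have unv : uniq vs by apply: sorted_uniq so; [exact: ltn_trans|exact: ltnn].
have D0 : 0 < D.
  have /hasP[i] : has (fun i => d i == D) t0 by rewrite has_count; apply: leq_ltn_trans cD.
  rewrite mem_filter mem_iota => /and3P[_ _ im] /eqP<-.
  by have := dpos _ im; rewrite addn1 /d subn_gt0.
have ninj i j : i < size vs -> j < size vs -> nth 0 vs i = nth 0 vs j -> i = j.
  by move=> ilt jlt /eqP; rewrite nth_uniq // => /eqP.
split=> //; first by rewrite size_map.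
  apply: uniq_unpair_nth.
  - move=> i j /tm[im _] /tm[jm _] h; apply: double_inj; apply: ninj h; lia.
  - move=> i j /tm[im _] /tm[jm _] h.
    by apply: double_inj; apply/eq_add_S; apply: ninj h; lia.
  - move=> i j /tm[im _] /tm[jm _] h.
    suff : i.*2 = j.*2.+1 by lia.
    by apply: ninj h; lia.
  - by apply: take_uniq; rewrite !filter_uniq // iota_uniq.
move=> p /mapP[i /tm[im dD] ->] /=.
have iv : (i : nat).*2.+1 < size vs by move: i im {dD} => /= i; lia.
split; [exact/mem_nth/ltnW|exact: mem_nth|].
- by have := dpos _ im; rewrite -dD /d; lia.
Qed.

(** The class [f v] encodes both the residue modulo [D] and the block of length [L] containing [v].
    In a class with more than [2 * P] values, the [i]-th is paired with the [(i + P)]-th: [P] steps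
    of at least [D] separate them, and the common block keeps the difference below [L]. *)
Lemma far_pairs (vs : seq nat) M D L P :
  sorted ltn vs -> (forall v, v \in vs -> v <= M) -> 0 < D -> 0 < L ->
  (M %/ L).+1 * D * P.*2 < size vs ->
  exists ps, [/\ size ps = P, uniq (unpair ps) &
    forall p, p \in ps -> [/\ p.1 \in vs, p.2 \in vs &
      exists e, [/\ p.2 = p.1 + D * e, P <= e & D * e <= L]]].
Proof.
move=> so vM D0 L0 big.
pose f v := (v %/ L) * D + v %% D.
have [c cl cc] : exists2 c, c < (M %/ L).+1 * D & P.*2 < count (fun v => f v == c) vs.
  apply: pigeonhole => // v /vM vle.
  have h1 : v %/ L <= M %/ L by apply: leq_div2r.
  have h2 : v %% D < D by rewrite ltn_mod.
  rewrite mulSn /f; have : v %/ L * D <= M %/ L * D by rewrite leq_mul2r h1 orbT.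
  lia.
pose us := [seq v <- vs | f v == c].
have sous : sorted ltn us by apply: sorted_filter => //; exact: ltn_trans.
have unus : uniq us by apply: sorted_uniq sous; [exact: ltn_trans|exact: ltnn].
have szus : P.*2 < size us by rewrite size_filter.
have inus i : i < size us -> [/\ nth 0 us i \in vs,
     nth 0 us i %/ L = c %/ D & nth 0 us i %% D = c %% D].
  move=> /(mem_nth 0); rewrite mem_filter => /andP[/eqP fc ->]; rewrite -fc /f.
  split=> //; last by rewrite modnMDl modn_mod.
  by rewrite divnMDl // [_ %% D %/ D]divn_small ?addn0 ?ltn_mod.
have stepD i : i.+1 < size us -> nth 0 us i + D <= nth 0 us i.+1.
  move=> im; have [_ _ m1] := inus _ (ltnW im); have [_ _ m2] := inus _ im.
  have := @sorted_nth_gap us i 1 sous; rewrite addn1 => /(_ im) lt.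
  have /dvdnP[e he] : D %| nth 0 us i.+1 - nth 0 us i.
    by rewrite -eqn_mod_dvd; [apply/eqP; rewrite m1 m2|lia].
  case: e he => [|e]; [lia|rewrite mulSn; lia].
have gapD i j : i + j < size us -> nth 0 us i + D * j <= nth 0 us (i + j).
  elim: j => [|j IH] h; first by rewrite muln0 !addn0.
  have := stepD (i + j); have := IH; rewrite addnS mulnS; lia.
have ninj i j : i < size us -> j < size us -> nth 0 us i = nth 0 us j -> i = j.
  by move=> ilt jlt /eqP; rewrite nth_uniq // => /eqP.
exists [seq (nth 0 us i, nth 0 us (i + P)) | i <- iota 0 P].
split; first by rewrite size_map size_iota.
  apply: uniq_unpair_nth; last exact: iota_uniq.
  - by move=> i j; rewrite !mem_iota /= => ? ?; apply: ninj; lia.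
  - by move=> i j; rewrite !mem_iota /= => ? ? /ninj H; have := H; lia.
  - by move=> i j; rewrite !mem_iota /= => ? ? /ninj H; have := H; lia.
move=> p /mapP[i]; rewrite mem_iota /= add0n => iP -> /=.
have [h1 h2 h3] : [/\ nth 0 us i \in vs, nth 0 us i %/ L = c %/ D & nth 0 us i %% D = c %% D] by apply: inus; lia.
have [k1 k2 k3] : [/\ nth 0 us (i + P) \in vs, nth 0 us (i + P) %/ L = c %/ D & nth 0 us (i + P) %% D = c %% D] by apply: inus; lia.
have gap : nth 0 us i + D * P <= nth 0 us (i + P) by apply: gapD; lia.
split=> //.
have /dvdnP[e he] : D %| nth 0 us (i + P) - nth 0 us i.
  by rewrite -eqn_mod_dvd; [apply/eqP; rewrite h3 k3|lia].
exists e; split; first by rewrite mulnC -he; lia.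
  by rewrite -(leq_pmul2l D0) mulnC [D * e]mulnC -he; lia.
rewrite mulnC -he.
have := divn_eq (nth 0 us (i + P)) L; have := divn_eq (nth 0 us i) L.
rewrite h2 k2; have := ltn_mod (nth 0 us (i + P)) L; rewrite L0.
lia.
Qed.

(* Modulo [D], subtracting [d] is adding [(D - 1) * d], so the stabiliser is closed
   under Euclidean division by its least positive element. *)
Lemma stabiliser_divisor (Rl : seq nat) D (P := fun x => all (fun r => (r + x) %% D \in Rl) Rl) :
  0 < D -> (forall r, r \in Rl -> r < D) ->
  exists d, [/\ 0 < d, P d, d %| D & forall x, P x -> d %| x].
Proof.
move=> D0 RD.
have PM x y : x = y %[mod D] -> P x -> P y.
  by move=> xy /allP Px; apply/allP => r /Px; rewrite -modnDmr xy modnDmr.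
have PD x y : P x -> P y -> P (x + y).
  move=> /allP Px /allP Py; apply/allP => r rR; rewrite addnA -modnDml.
  exact/Py/Px.
have P0 : P 0 by apply/allP => r rR; rewrite addn0 modn_small // RD.
have PMul x m : P x -> P (m * x).
  by move=> Px; elim: m => // m IH; rewrite mulSn; apply: PD.
have PDD : P D by apply: PM P0; rewrite modnn mod0n.
have exP : exists d, (0 < d) && P d by exists D; rewrite D0.
case: (ex_minnP exP) => d /andP[d0 Pd] dmin.
have dvd x : P x -> d %| x.
  move=> Px; rewrite /dvdn; case: posnP => // pos.
  suff : d <= x %% d by rewrite leqNgt ltn_mod d0.
  apply: dmin; rewrite pos /=.
  apply: PM (PD _ _ Px (PMul _ (D.-1 * (x %/ d)) Pd)).
  rewrite {1}(divn_eq x d) addnAC -mulnA -mulSn prednK // mulnC modnMDl //.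
exists d; split=> //; exact: dvd.
Qed.

Lemma residue_cover a (s : seq nat) D : 0 < D -> uniq s ->
  (forall q, prime q -> q %| D -> D <= count (fun j => ~~ (q %| a j)) s) ->
  exists B, [/\ uniq B, {subset B <= s}, size B <= D &
    forall r, exists2 t, subsum a B t & t = r %[mod D]].
Proof.
move=> D0 us H.
have claim i : i < D -> exists B Rl, [/\ uniq B, {subset B <= s}, size B <= i,
    uniq Rl /\ size Rl = i.+1 &
    forall r, r \in Rl -> r < D /\ exists2 t, subsum a B t & t %% D = r].
  elim: i => [_|i IH iD].
    exists [::], [:: 0]; split=> // r; rewrite inE => /eqP->; split=> //.
    by exists 0; [exact: subsum0|rewrite mod0n].
  have [B [Rl [uB sB szB [uR szR] HR]]] := IH (ltnW iD).
  pose P x := all (fun r => (r + x) %% D \in Rl) Rl.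
  case: (boolP (has (fun j => (j \notin B) && ~~ P (a j)) s)).
    case/hasP => j js /andP[jB /allPn[r rR nr]].
    exists (j :: B), ((r + a j) %% D :: Rl); split.
    - by rewrite /= jB.
    - by move=> x; rewrite inE => /orP[/eqP->|/sB].
    - by [].
    - by rewrite /= nr uR szR.
    move=> x; rewrite inE => /orP[/eqP->|/HR[xD [t st tx]]].
      split; first by rewrite ltn_mod.
      have [_ [t st tr]] := HR r rR.
      exists (a j + t); first exact: subsum_cons.
      by rewrite -tr modnDml addnC.
    by split=> //; exists t => //; apply: subsum_consr.
  move=> /hasPn stab; exfalso.
  have [d [d0 Pd dD dP]] := @stabiliser_divisor Rl D D0 (fun r rR => (HR r rR).1).
  have dB j : j \in s -> j \notin B -> d %| a j.
    by move=> /stab; rewrite negb_and negbK => /orP[->//|/negPn Pj] _; apply: dP.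
  case: (ltngtP d 1) => d1; first by move: d0 d1; lia.
    have pq := pdiv_prime d1.
    have := H _ pq (dvdn_trans (pdiv_dvd d) dD).
    rewrite leqNgt => /negP; apply.
    apply: leq_ltn_trans (ltnW iD); apply: leq_trans szB.
    rewrite -size_filter; apply: uniq_leq_size; first exact: filter_uniq.
    move=> j; rewrite mem_filter => /andP[nq js].
    by apply/negPn/negP => /(dB _ js) h; move: nq; rewrite (dvdn_trans (pdiv_dvd d) h).
  have [r0 r0R] : exists r, r \in Rl by case: (Rl) szR => // r l _; exists r; apply: mem_head.
  have Rall m : (r0 + m) %% D \in Rl.
    elim: m => [|m IHm]; first by rewrite addn0 modn_small // (HR _ r0R).1.
    by rewrite addnS -addn1 -modnDml -d1; move/allP: Pd; apply.
  have : size (iota 0 D) <= size Rl.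
    apply: uniq_leq_size; first exact: iota_uniq.
    move=> x; rewrite mem_iota add0n => /= xD.
    have := Rall (x + (D - r0)); have r0D := (HR _ r0R).1.
    have -> : r0 + (x + (D - r0)) = x + D by lia.
    by rewrite modnDr modn_small.
  by rewrite size_iota szR leqNgt iD.
have [|B [Rl [uB sB szB [uR szR] HR]]] := claim D.-1; first by rewrite prednK.
exists B; split=> //; first by rewrite (leq_trans szB) ?leq_pred.
move=> r.
have /HR[_ [t st tr]] : r %% D \in Rl.
  have subR : {subset Rl <= iota 0 D}.
    by move=> x /HR[xD _]; rewrite mem_iota.
  have szle : size (iota 0 D) <= size Rl by rewrite size_iota szR prednK.
  have [_ ->] := uniq_min_size uR subR szle.
  by rewrite mem_iota add0n ltn_mod.
by exists t.
Qed.

(** Pairs are found among values, while disjointness is needed for indices; distinct values have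
    distinct representatives. *)
Definition rep (a : nat -> nat) (s : seq nat) (v : nat) : nat :=
  nth 0 s (index v (map a s)).

Lemma repP a s v : v \in map a s -> rep a s v \in s /\ a (rep a s v) = v.
Proof.
move=> vs; have lt : index v (map a s) < size s by rewrite -(size_map a) index_mem.
by rewrite /rep; split; [apply: mem_nth|rewrite -(nth_map 0 0) // nth_index].
Qed.

Lemma unpair_rep a s ps :
  (forall p, p \in ps -> (p.1 \in map a s) && (p.2 \in map a s)) ->
  uniq (unpair ps) ->
  uniq (unpair [seq (rep a s p.1, rep a s p.2) | p <- ps]).
Proof.
move=> Hps u.
have -> : unpair [seq (rep a s p.1, rep a s p.2) | p <- ps] = map (rep a s) (unpair ps).
  elim: ps {Hps u} => // p ps IH; by rewrite /= !unpair_cons /= IH.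
rewrite map_inj_in_uniq // => x y xp yp exy.
have [_ <-] := repP (unpair_sub Hps xp).
by have [_ <-] := repP (unpair_sub Hps yp); rewrite exy.
Qed.

Lemma rep_pairs a s ps R :
  size ps = R -> uniq (unpair ps) ->
  (forall p, p \in ps -> (p.1 \in map a s) && (p.2 \in map a s)) ->
  exists ps', [/\ size ps' = R, uniq (unpair ps'), {subset unpair ps' <= s} &
    forall p', p' \in ps' -> exists2 p, p \in ps & a p'.1 = p.1 /\ a p'.2 = p.2].
Proof.
move=> sz u sub; exists [seq (rep a s p.1, rep a s p.2) | p <- ps]; split.
- by rewrite size_map.
- exact: unpair_rep.
- apply: unpair_sub => p' /mapP[p /sub /andP[p1 p2] ->] /=.
  by rewrite (repP p1).1 (repP p2).1.
- move=> p' /mapP[p pp ->]; exists p => //=.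
  by have /andP[p1 p2] := sub p pp; rewrite (repP p1).2 (repP p2).2.
Qed.

(** Each block has one task. Close pairs from [s2] give a progression of [R] steps; far pairs from
    [s3], taken with [D * e <= R] so that they fit this progression, add [P] steps each; indices of
    [s1] supply the residues modulo [D]. The [P * P] steps exceed [l.+1 * M]: one [M] for the
    interval itself and [l * M] for the fluctuation of the residue sums. *)
Lemma interval_core a M s1 s2 s3 l R P :
  uniq (s1 ++ s2 ++ s3) -> (forall j, j \in s1 ++ s2 ++ s3 -> a j <= M) ->
  0 < l -> 0 < R -> l.+1 * M <= P * P ->
  M %/ l + l * R < (size (undup (map a s2)))./2 ->
  (M %/ R).+1 * l * P.*2 < size (undup (map a s3)) ->
  (forall q, prime q -> q <= l -> l <= count (fun j => ~~ (q %| a j)) s1) ->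
  exists B lo, [/\ uniq B, {subset B <= s1 ++ s2 ++ s3},
    size B <= R.*2 + P.*2 + l, lo <= (R + P + l) * M &
    forall t, lo <= t <= lo + M -> subsum a B t].
Proof.
move=> u aM l0 R0 PM big2 big3 Hq.
have srt s : sorted ltn (sort leq (undup (map a s))).
  by rewrite ltn_sorted_uniq_leq sort_uniq undup_uniq sort_sorted //; exact: leq_total.
have srtm s v : v \in sort leq (undup (map a s)) -> v \in map a s.
  by rewrite mem_sort mem_undup.
have in1 j : j \in s1 -> j \in s1 ++ s2 ++ s3 by rewrite !mem_cat => ->.
have in2 j : j \in s2 -> j \in s1 ++ s2 ++ s3 by rewrite !mem_cat => ->; rewrite orbT.
have in3 j : j \in s3 -> j \in s1 ++ s2 ++ s3 by rewrite !mem_cat => ->; rewrite !orbT.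
have [D [ps2v [D0 Dl sz2v u2v H2v]]] : exists D ps, [/\ 0 < D, D < l, size ps = R, uniq (unpair ps) &
    forall p, p \in ps -> [/\ p.1 \in sort leq (undup (map a s2)), p.2 \in sort leq (undup (map a s2)) & p.2 = p.1 + D]].
  apply: (@close_pairs _ M) => //; last by rewrite size_sort.
  by move=> v /srtm /mapP[j /in2 js ->]; apply: aM.
have [ps3v [sz3v u3v H3v]] : exists ps, [/\ size ps = P, uniq (unpair ps) &
    forall p, p \in ps -> [/\ p.1 \in sort leq (undup (map a s3)), p.2 \in sort leq (undup (map a s3)) &
      exists e, [/\ p.2 = p.1 + D * e, P <= e & D * e <= R]]].
  apply: (@far_pairs _ M) => //.
    by move=> v /srtm /mapP[j /in3 js ->]; apply: aM.
  rewrite size_sort; apply: leq_ltn_trans big3.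
  by rewrite leq_mul2r leq_mul2l (ltnW Dl) !orbT.
have [|ps2 [sz2 u2 sub2 H2]] := rep_pairs (s := s2) (a := a) sz2v u2v.
  by move=> p /H2v[/srtm -> /srtm ->].
have [|ps3 [sz3 u3 sub3 H3]] := rep_pairs (s := s3) (a := a) sz3v u3v.
  by move=> p /H3v[/srtm -> /srtm ->].
move: (u); rewrite cat_uniq => /and3P[us1 d123 u23].
move: (u23); rewrite cat_uniq => /and3P[us2 d23 us3].
have [Br [uBr sBr szBr HBr]] : exists B, [/\ uniq B, {subset B <= s1}, size B <= D &
    forall r, exists2 t, subsum a B t & t = r %[mod D]].
  apply: residue_cover => // q pq qD.
  apply: leq_trans (ltnW Dl) (Hq q pq _).
  exact: leq_trans (dvdn_leq D0 qD) (ltnW Dl).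
have dis23 j : j \in unpair ps3 -> j \notin unpair ps2.
  by move=> /sub3 j3; apply: contra (hasPn d23 j j3) => /sub2.
have lad0 i : i <= 0 -> subsum a [::] (0 + D * i).
  by rewrite leqn0 => /eqP->; rewrite muln0; exact: subsum0.
have [b2 [b2le Hb2]] : exists b', b' <= 0 + size ps2 * M /\
    forall i, i <= 0 + size ps2 * 1 -> subsum a (unpair ps2 ++ [::]) (b' + D * i).
  apply: (ladder_pairs lad0); first by rewrite cats0.
    by move=> p /mem_unpair/andP[/sub2/in2/aM].
  move=> p /H2[v /H2v[_ _ e] [-> ->]]; exists 1; split=> //; by rewrite muln1.
have u32 : uniq (unpair ps3 ++ unpair ps2).
  rewrite uniq_catC cat_uniq u3 u2 andbT /=; apply/hasPn; exact: dis23.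
rewrite cats0 add0n muln1 sz2 in b2le Hb2.
have [b3 [b3le Hb3]] : exists b', b' <= b2 + size ps3 * M /\
    forall i, i <= R + size ps3 * P -> subsum a (unpair ps3 ++ unpair ps2) (b' + D * i).
  apply: (ladder_pairs Hb2) => //.
    by move=> p /mem_unpair/andP[/sub3/in3/aM].
  move=> p /H3[v /H3v[_ _ [e [he1 he2 he3]]] [-> ->]]; exists e; split=> //.
  by apply: leqW; apply: leq_trans he3; rewrite leq_pmull.
rewrite sz3 in b3le Hb3.
(* The offset [l * M] dominates every subset sum of [Br], so [t - b3 - r] below is a true
   difference. *)
exists (Br ++ (unpair ps3 ++ unpair ps2)), (b3 + l * M).
have uB : uniq (Br ++ (unpair ps3 ++ unpair ps2)).
  rewrite cat_uniq uBr u32 andbT /=; apply/hasPn => j jp.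
  have js : j \in s2 ++ s3 by move: jp; rewrite !mem_cat => /orP[/sub3->|/sub2->]; rewrite ?orbT.
  by apply: contra (hasPn d123 j js) => /sBr.
split=> //.
- move=> j; rewrite !mem_cat => /or3P[/sBr->|/sub3->|/sub2->]; rewrite ?orbT //.
- by rewrite !size_cat !size_unpair sz2 sz3; move: szBr Dl; clear; lia.
- by rewrite !mulnDl; move: b2le b3le; clear; lia.
move=> t /andP[t1 t2].
have [r [J [uJ JB er]] rt] := HBr (t - b3).
have rle : r <= l * M.
  have : r <= size J * M.
    rewrite er big_seq -sum1_size big_distrl /= [X in _ <= X]big_seq.
    by apply: leq_sum => j /JB /sBr /in1 /aM; rewrite mul1n.
  have szJ : size J <= l by rewrite (leq_trans (uniq_leq_size uJ JB)) // (leq_trans szBr) // ltnW.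
  move=> h; apply: leq_trans h _; by rewrite leq_mul2r szJ orbT.
have /dvdnP[i hi] : D %| t - b3 - r.
  by rewrite -eqn_mod_dvd; [apply/eqP; rewrite rt|move: rle t1; clear; lia].
have -> : t = r + (b3 + D * i) by rewrite mulnC -hi; move: rle t1 t2; clear; lia.
apply: subsum_cat => //; first by exists J.
apply: Hb3; rewrite -(leq_pmul2l D0) mulnDr mulnC -hi.
have DP : P * P <= D * (P * P) by rewrite leq_pmull.
by move: DP PM t2; rewrite mulSn; clear; lia.
Qed.

(** * The sequence of primes *)

Lemma next_primeP m :
  [/\ m < next_prime m, prime (next_prime m) &
    forall p, m < p -> prime p -> next_prime m <= p].
Proof.
rewrite /next_prime; case: ex_minnP => p /andP[mp pp] H; split=> // q mq pq.
by apply: H; rewrite mq.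
Qed.

Lemma nth_primeS i : 0 < i -> nth_prime i.+1 = next_prime (nth_prime i).
Proof. by case: i. Qed.

Lemma prime_nth_prime i : 0 < i -> prime (nth_prime i).
Proof. by case: i => [|[|i]] // _; rewrite nth_primeS //; have [] := next_primeP (nth_prime i.+1). Qed.

Lemma nth_prime_ltS i : nth_prime i < nth_prime i.+1.
Proof. by case: i => // i; rewrite (@nth_primeS i.+1) //; have [] := next_primeP (nth_prime i.+1). Qed.

Lemma nth_prime_lt i j : i < j -> nth_prime i < nth_prime j.
Proof.
elim: j => // j IH; rewrite ltnS leq_eqVlt => /orP[/eqP->|/IH h]; first exact: nth_prime_ltS.
exact: ltn_trans h (nth_prime_ltS j).
Qed.

Lemma leq_nth_prime i j : i <= j -> nth_prime i <= nth_prime j.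
Proof. by rewrite leq_eqVlt => /orP[/eqP->//|/nth_prime_lt/ltnW]. Qed.

Lemma nth_prime_ltE i j : (nth_prime i < nth_prime j) = (i < j).
Proof.
by case: (leqP j i) => [/leq_nth_prime|/nth_prime_lt //]; rewrite ltnNge => ->.
Qed.

Lemma nth_prime_inj : injective nth_prime.
Proof.
move=> i j e; case: (ltngtP i j) => // /nth_prime_lt; rewrite e ltnn //.
Qed.

Lemma nth_prime_ge i : i <= nth_prime i.
Proof. by elim: i => // i IH; apply: leq_ltn_trans IH (nth_prime_ltS i). Qed.

Lemma prime_is_nth p : prime p -> exists2 j, 0 < j & p = nth_prime j.
Proof.
move=> pp.
have ex : exists j, p <= nth_prime j by exists p; exact: nth_prime_ge.
case: (ex_minnP ex) => [[|[|j]]] pj jmin.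
- by move: pj; rewrite leqNgt prime_gt0.
- by exists 1 => //; apply/eqP; rewrite eqn_leq pj /= prime_gt1.
exists j.+2 => //; apply/eqP; rewrite eqn_leq pj (@nth_primeS j.+1) //. have [_ _] := next_primeP (nth_prime j.+1); apply=> //.
by rewrite ltnNge; apply/negP => /jmin; rewrite ltnn.
Qed.

(** Turns a sum over the primes of an interval, where the analytic estimates live, into a sum over
    consecutive indices. *)
Lemma primes_between n d :
  perm_eq [seq p <- iota (nth_prime n).+1 (nth_prime (n + d) - nth_prime n) | prime p]
          [seq nth_prime j | j <- iota n.+1 d].
Proof.
apply: uniq_perm; first by rewrite filter_uniq // iota_uniq.
  by rewrite map_inj_uniq ?iota_uniq //; exact: nth_prime_inj.
have le := @leq_nth_prime n (n + d) (leq_addr _ _).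
move=> p; rewrite mem_filter mem_iota addSn subnKC //; apply/idP/idP.
  case/and3P => /prime_is_nth[j j0 ->] /=.
  rewrite nth_prime_ltE ltnS => nj pj; apply: map_f; rewrite mem_iota nj /= addSn ltnS.
  by rewrite leqNgt -nth_prime_ltE -leqNgt.
case/mapP => j; rewrite mem_iota => /andP[nj jd] ->.
rewrite prime_nth_prime //=; last exact: leq_ltn_trans (leq0n n) nj.
by rewrite nth_prime_lt //= ltnS leq_nth_prime // -ltnS -addSn.
Qed.

Lemma floor_rootP k x : 0 < k ->
  floor_root k x ^ k <= x /\ x < (floor_root k x).+1 ^ k.
Proof.
move=> k0; have [m] : {m : 'I_x.+1 | m ^ k <= x & floor_root k x = m}.
  have [|m mA e] := @eq_bigmax_cond _ [pred m : 'I_x.+1 | m ^ k <= x] (fun m => m : nat).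
    by apply/card_gt0P; exists ord0; rewrite inE /= exp0n.
  by exists m => //; rewrite -e; apply: eq_bigl => i; rewrite inE.
move=> mk e; split; first by rewrite e.
rewrite ltnNge; apply/negP => le.
have lt : (floor_root k x).+1 < x.+1.
  by rewrite ltnS (leq_trans _ le) // -{1}(expn1 (_.+1)) leq_pexp2l.
have := @leq_bigmax_cond _ (fun m : 'I_x.+1 => m ^ k <= x) (fun m : 'I_x.+1 => m : nat) (Ordinal lt) le.
by rewrite /= ltnn.
Qed.

Lemma leq_floor_root k x m : 0 < k -> (m <= floor_root k x) = (m ^ k <= x).
Proof.
move=> k0; have [h1 h2] := floor_rootP x k0; apply/idP/idP => h.
  by apply: leq_trans h1; rewrite leq_exp2r.
by rewrite -ltnS -(ltn_exp2r _ _ k0); apply: leq_ltn_trans h2.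
Qed.

Lemma floor_root1 x : floor_root 1 x = x.
Proof.
by apply/eqP; rewrite eqn_leq leq_floor_root // expn1 leqnn andbT; case: (floor_rootP x (ltn0Sn 0)).
Qed.

(** * Chebyshev's upper bound for the N-th prime *)

Lemma expn_le_bin2 m : 2 ^ m <= 'C(m.*2, m).
Proof.
elim: m => // m IH.
have h : 'C(m.*2.+1, m) = 'C(m.*2.+1, m.+1).
  by rewrite -bin_sub; [congr 'C(_, _); lia|lia].
rewrite doubleS binS -h addnn -mul2n expnS leq_mul2l /=.
by apply: leq_trans IH _; case: m {h} => // m; rewrite binS leq_addr.
Qed.

(** By Legendre's formula the exponent of [p] is a sum of terms [m.*2 %/ p ^ k - 2 * (m %/ p ^ k)],
    each at most 1 and zero once [p ^ k > m.*2]. *)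
Lemma central_bin_pfactor p m : prime p -> 0 < m ->
  p ^ logn p 'C(m.*2, m) <= m.*2.
Proof.
move=> pp m0.
have m20 : 0 < m.*2 by rewrite double_gt0.
have [/= tl th] := andP (trunc_log_bounds (prime_gt1 pp) m20).
apply: leq_trans tl; rewrite leq_exp2l ?prime_gt1 //.
have e := @bin_fact m.*2 m; rewrite -addnn leq_addr addnK in e.
have {e} /(congr1 (logn p)) := e isT.
rewrite !lognM ?muln_gt0 ?fact_gt0 ?bin_gt0 ?leq_addr // addnn !logn_fact //.
set L := trunc_log _ _ in th *.
have ext : \sum_(1 <= k < m.+1) m %/ p ^ k = \sum_(1 <= k < m.*2.+1) m %/ p ^ k.
  rewrite [RHS](@big_cat_nat _ _ _ m.+1) //=; last by lia.
  rewrite [X in _ = _ + X]big_nat_cond [X in _ = _ + X]big1 ?addn0 // => i /andP[/andP[mi _] _].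
  apply: divn_small; apply: leq_trans (ltn_expl i (prime_gt1 pp)) ; lia.
rewrite ext => e.
have key : \sum_(1 <= k < m.*2.+1) m.*2 %/ p ^ k <=
   \sum_(1 <= k < m.*2.+1) (m %/ p ^ k + m %/ p ^ k) + \sum_(1 <= k < m.*2.+1) (k <= L).
  rewrite -big_split /= [X in X <= _]big_nat_cond [X in _ <= X]big_nat_cond.
  apply: leq_sum => i /andP[/andP[i0 _] _].
  have pi0 : 0 < p ^ i by rewrite expn_gt0 prime_gt0.
  case: (leqP i L) => iL.
    rewrite -addnn; have := divn_eq m (p ^ i); have := ltn_mod m (p ^ i); rewrite pi0.
    move=> h1 h2; rewrite -ltnS ltn_divLR // addn1 !mulSn mulnDl; lia.
  rewrite addn0 divn_small // (leq_trans th) // leq_exp2l ?prime_gt1 //.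
have cnt : \sum_(1 <= k < m.*2.+1) (k <= L) <= L.
  move: (m.*2.+1) => W {ext e key}.
  have h : forall W, \sum_(1 <= k < W) (k <= L) <= minn W.-1 L.
    elim=> [|[|V] IH]; [by rewrite big_geq|by rewrite big_geq|].
    by rewrite big_nat_recr //=; case: leqP; lia.
  by apply: leq_trans (h W) _; rewrite geq_minr.
by move: e key cnt; rewrite big_split /=; lia.
Qed.

(** The central binomial coefficient is a product of prime powers, each at most [m.*2], over
    distinct primes up to [m.*2]. *)
Lemma chebyshev_bin m : 0 < m -> 2 ^ m <= m.*2 ^ size [seq p <- iota 0 m.*2.+1 | prime p].
Proof.
move=> m0; apply: leq_trans (expn_le_bin2 m) _.
have b0 : 0 < 'C(m.*2, m) by rewrite bin_gt0; lia.
rewrite {1}(prod_prime_decomp b0) prime_decompE big_map /=.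
apply: (@leq_trans (\prod_(p <- primes 'C(m.*2, m)) m.*2)).
  rewrite big_seq [X in _ <= X]big_seq; apply: leq_prod => p.
  by rewrite mem_primes => /and3P[pp _ _]; apply: central_bin_pfactor.
have -> : \prod_(p <- primes 'C(m.*2, m)) m.*2 = m.*2 ^ size (primes 'C(m.*2, m)).
  by rewrite big_const_seq count_predT iter_muln_1.
rewrite leq_pexp2l ?double_gt0 //; apply: uniq_leq_size; first exact: primes_uniq.
move=> p pC; move: (pC); rewrite mem_primes => /and3P[pp _ _].
rewrite mem_filter pp mem_iota add1n ltnS prime_gt0 // !andTb.
apply: leq_trans (central_bin_pfactor pp m0).
by rewrite -[X in X <= _]expn1 leq_exp2l ?prime_gt1 // logn_gt0.
Qed.

(** [L] stands for a logarithm. Were the prime larger, at most [N] primes would lie up to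
    [(N * L).*2], and [chebyshev_bin] would give [2 ^ (N * L) <= (N * L).*2 ^ N < 2 ^ (L * N)]. *)
Lemma nth_prime_le N L : 0 < N -> 0 < L -> (N * L).*2 < 2 ^ L ->
  nth_prime N <= (N * L).*2.
Proof.
move=> N0 L0 lt; rewrite leqNgt; apply/negP => big.
have NL0 : 0 < N * L by rewrite muln_gt0 N0.
have := chebyshev_bin NL0; rewrite leqNgt => /negP; apply.
have szN : size [seq p <- iota 0 (N * L).*2.+1 | prime p] <= N.
  rewrite -[X in _ <= X](size_iota 1 N) -(size_map nth_prime (iota 1 N)).
  apply: uniq_leq_size; first by rewrite filter_uniq // iota_uniq.
  move=> p; rewrite mem_filter mem_iota add0n => /andP[/prime_is_nth[j j0 ->] /= jb].
  apply: map_f; rewrite mem_iota j0 /= add1n ltnS.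
  by rewrite leqNgt -nth_prime_ltE -leqNgt; lia.
apply: (@leq_ltn_trans ((N * L).*2 ^ N)).
  by rewrite leq_pexp2l // double_gt0.
by rewrite [N * L in X in _ < X]mulnC expnM ltn_exp2r.
Qed.

Local Open Scope ring_scope.

(** * Trigonometric sums along roots *)

Lemma tan_ge (R : realType) (x : R) : 0 < x < pi / 2 -> x <= tan x.
Proof.
move=> /andP[x0 xp].
have pi0 := pi_gt0 R.
have cosn0 y : 0 <= y -> y <= x -> 0 < cos y.
  by move=> y0 yx; apply: cos_gt0_pihalf; lra.
have [||c /[!in_itv]/= /andP[c0 cx]] := @MVT R tan (fun y => (cos y) ^- 2) 0 x x0.
- move=> y /[!in_itv]/= /andP[y0 yx]; apply: is_derive_tan.
  by rewrite gt_eqF // cosn0 // ltW.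
- apply: continuous_in_subspaceT => y /[!inE]/= /[!in_itv]/= /andP[y0 yx].
  by apply: continuous_tan; rewrite gt_eqF // cosn0.
rewrite tan0 !subr0 => ->; rewrite ler_peMl ?(ltW x0) //.
have cc := cosn0 c (ltW c0) (ltW cx).
rewrite invf_ge1 ?exprn_gt0 // expr_le1 //; [exact: cos_le1|exact: ltW].
Qed.

Lemma cot_le (R : realType) (x y : R) : 0 < x -> x <= y -> y < pi / 2 ->
  cos y / sin y <= cos x / sin x.
Proof.
move=> x0 xy yp; have pi0 := pi_gt0 R.
have sx : 0 < sin x by apply: sin_gt0_pihalf; lra.
have sy : 0 < sin y by apply: sin_gt0_pihalf; lra.
rewrite ler_pdivrMr // mulrAC ler_pdivlMr // -subr_ge0.
rewrite (_ : _ - _ = sin (y - x)); last by rewrite sinB; ring.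
by apply: sin_ge0_pi; lra.
Qed.

Lemma cot_le_inv (R : realType) (x : R) : 0 < x < pi / 2 -> 0 <= cos x / sin x <= x^-1.
Proof.
move=> /andP[x0 xp]; have pi0 := pi_gt0 R.
have sx : 0 < sin x by apply: sin_gt0_pihalf; lra.
have cx : 0 < cos x by apply: cos_gt0_pihalf; lra.
have -> /= : 0 <= cos x / sin x by apply: divr_ge0; exact: ltW.
have := @tan_ge R x; rewrite x0 xp /tan => /(_ isT) h.
have -> : cos x / sin x = (sin x / cos x)^-1 by rewrite invf_div.
by rewrite lef_pV2 ?posrE ?divr_gt0.
Qed.

(** Summation by parts. As [c] increases, its variation telescopes: without its boundary term the
    partial sum stays below [c (m + d) * S], and the boundary term costs the second [C * S]. *)
Lemma abel_bound (R : realType) (c s : nat -> R) (m n : nat) (C S : R) :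
  (forall i, (m <= i < n)%N -> 0 <= c i <= C) ->
  (forall i, (m <= i)%N -> (i.+1 < n)%N -> c i <= c i.+1) ->
  (forall i, (m <= i <= n)%N -> `|s i| <= S) -> 0 <= C -> 0 <= S ->
  `|\sum_(m <= i < n) c i * (s i.+1 - s i)| <= 2 * C * S.
Proof.
move=> c0 cm sS C0 S0; case: (leqP n m) => [nm|mn].
  by rewrite big_geq // normr0 !mulr_ge0.
have key : forall d, (m + d < n)%N ->
    `|\sum_(m <= i < (m + d).+1) c i * (s i.+1 - s i) - c (m + d)%N * s (m + d).+1| <= c (m + d)%N * S.
  elim=> [|d IH] md.
    rewrite addn0 big_nat1 (_ : _ - _ = - (c m * s m)); last by ring.
    rewrite addn0 in md; have /andP[h _] : 0 <= c m <= C by apply: c0; rewrite leqnn.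
    rewrite normrN normrM (ger0_norm h).
    by apply: ler_wpM2l => //; apply: sS; rewrite leqnn ltnW.
  rewrite addnS in md *.
  have {}IH := IH (ltnW md).
  rewrite big_nat_recr /=; last by rewrite ltnW // ltnS leq_addr.
  set A := \sum_(_ <= i < _) _ in IH *; set k := (m + d)%N in IH md *.
  rewrite (_ : _ - _ = (A - c k * s k.+1) + (c k - c k.+1) * s k.+1); last by ring.
  apply: le_trans (ler_normD _ _) _.
  have ck : c k <= c k.+1 by apply: cm => //; rewrite leq_addr.
  have : `|(c k - c k.+1) * s k.+1| <= (c k.+1 - c k) * S.
    have ck0 : 0 <= c k.+1 - c k by rewrite subr_ge0.
    rewrite normrM distrC (ger0_norm ck0); apply: ler_wpM2l => //.
    by apply: sS; rewrite (ltnW md) andbT leqW // leq_addr.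
  by lra.
have [d nd] : exists d, n = (m + d).+1 by exists (n - m).-1; rewrite -addnS prednK ?subn_gt0 // subnKC // ltnW.
have := key d; rewrite -nd nd ltnSn => /(_ isT).
have mdn : (m <= m + d < n)%N by rewrite leq_addr nd /=.
have /andP[h1 h2] := c0 _ mdn.
have hs : `|s (m + d).+1| <= S by apply: sS; rewrite nd leqnn leqW // leq_addr.
have : `|c (m + d)%N * s (m + d).+1| <= C * S.
  by rewrite normrM; apply: ler_pM => //; rewrite ger0_norm.
have : c (m + d)%N * S <= C * S by apply: ler_wpM2r.
set A := \sum_(_ <= i < _) _; set B := c _ * s _.
move=> h3 h4 h5; rewrite -(subrK B A); apply: le_trans (ler_normD _ _) _; lra.
Qed.

Lemma cos_add_cos (R : realType) (u v : R) : 0 < v - u < pi ->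
  cos u + cos v = cos ((v - u) / 2) / sin ((v - u) / 2) * (sin v - sin u).
Proof.
move=> /andP[h1 h2]; set g := (v - u) / 2; set w := (u + v) / 2.
have sg : 0 < sin g by apply: sin_gt0_pihalf; rewrite /g; lra.
have -> : v = w + g by rewrite /w /g; lra.
have -> : u = w - g by rewrite /w /g; lra.
rewrite cosB cosD sinB sinD; field; exact: lt0r_neq0.
Qed.

(* Adding [cos (u i)] and [cos (u i.+1)] gives a cotangent, monotone in [i], times a
   difference of consecutive sines, so partial summation applies. *)
Lemma kusmin_landau (R : realType) (u : nat -> R) (m n : nat) (th : R) :
  0 < th ->
  (forall i, (m <= i)%N -> (i.+1 < n)%N -> th <= u i.+1 - u i < pi) ->
  (forall i, (m <= i)%N -> (i.+2 < n)%N -> u i.+2 - u i.+1 <= u i.+1 - u i) ->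
  `|\sum_(m <= i < n) cos (u i)| <= 2 + 2 / th.
Proof.
move=> th0 g1 g2; have pi0 := pi_gt0 R.
case: (leqP n m) => [nm|mn].
  by rewrite big_geq // normr0; apply: addr_ge0 => //; apply: divr_ge0 => //; exact: ltW.
case: n mn g1 g2 => // n mn g1 g2; rewrite ltnS in mn.
pose c i := cos ((u i.+1 - u i) / 2) / sin ((u i.+1 - u i) / 2).
have bnd := @abel_bound R c (fun i => sin (u i)) m n (2 / th) 1.
have h : `|\sum_(m <= i < n) c i * (sin (u i.+1) - sin (u i))| <= 2 * (2 / th) * 1.
  apply: bnd.
  - move=> i /andP[mi ni]; have /andP[a1 a2] := g1 i mi ni.
    have b : 0 < (u i.+1 - u i) / 2 < pi / 2 by lra.
    have /andP[c1 c2] := cot_le_inv b.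
    rewrite /c c1 /= (le_trans c2) // -[2 / th]invf_div.
    by rewrite lef_pV2 ?posrE; lra.
  - move=> i mi ni; have := g2 i mi ni; have /andP[a1 a2] := g1 i mi (ltnW ni).
    have /andP[a3 a4] := g1 i.+1 (leqW mi) ni.
    by move=> a5; apply: cot_le; lra.
  - by move=> i _; exact: sin_max.
  - by apply: divr_ge0 => //; exact: ltW.
  - by [].
have e : \sum_(m <= i < n) c i * (sin (u i.+1) - sin (u i)) =
    \sum_(m <= i < n) (cos (u i) + cos (u i.+1)).
  rewrite big_nat_cond [RHS]big_nat_cond; apply: eq_bigr => i /andP[/andP[mi ni] _].
  rewrite -cos_add_cos //; have /andP[a1 a2] := g1 i mi ni; lra.
rewrite e big_split /= in h.
have e2 : \sum_(m <= i < n.+1) cos (u i) = \sum_(m <= i < n) cos (u i) + cos (u n).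
  by rewrite big_nat_recr.
have e3 : \sum_(m <= i < n.+1) cos (u i) = cos (u m) + \sum_(m <= i < n) cos (u i.+1).
  by rewrite big_nat_recl.
move: h; set A := \sum_(_ <= i < n) _ in e2 *; set B := \sum_(_ <= i < n) _ in e3 *.
set T := \sum_(_ <= i < n.+1) _ in e2 e3 *.
have := cos_max (u n); have := cos_max (u m).
rewrite !ler_norml => /andP[p1 p2] /andP[p3 p4] /andP[p5 p6].
have t : 2 * (2 / th) * 1 = 2 / th + 2 / th by ring.
by rewrite t in p5 p6; apply/andP; split; lra.
Qed.

(** * Roots of integers and their increments *)

Definition rt (R : realType) (k m : nat) : R := m%:R `^ (k%:R^-1).

Lemma rt_ge0 (R : realType) k m : 0 <= rt R k m.
Proof. exact: powR_ge0. Qed.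

Lemma rt_gt0 (R : realType) k m : (0 < m)%N -> 0 < rt R k m.
Proof. by move=> m0; apply: powR_gt0; rewrite ltr0n. Qed.

Lemma rtX (R : realType) k m : (0 < k)%N -> rt R k m ^+ k = m%:R.
Proof.
move=> k0; rewrite /rt -powR_mulrn ?powR_ge0 // -powRrM mulVf ?pnatr_eq0 -?lt0n //.
by rewrite powRr1.
Qed.

Lemma rtM (R : realType) k m n : rt R k (m * n) = rt R k m * rt R k n.
Proof. by rewrite /rt natrM powRM. Qed.

Lemma ler_rt (R : realType) k m n : (m <= n)%N -> rt R k m <= rt R k n.
Proof. by move=> mn; apply: ge0_ler_powR; rewrite ?nnegrE ?invr_ge0 ?ler_nat. Qed.

Lemma rt_ge1 (R : realType) k m : (0 < m)%N -> 1 <= rt R k m.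
Proof. by move=> m0; have := @ler_rt R k 1 m m0; rewrite {1}/rt powR1. Qed.

(* [m ^ ((k - 1) / k)]: the derivative of the [k]-th root at [m] is [1 / (k * sg k m)]. *)
Definition sg (R : realType) (k m : nat) : R := rt R k m ^+ k.-1.

Lemma sg_ge0 (R : realType) k m : 0 <= sg R k m.
Proof. by rewrite exprn_ge0 // rt_ge0. Qed.

Lemma sg_gt0 (R : realType) k m : (0 < m)%N -> 0 < sg R k m.
Proof. by move=> m0; rewrite exprn_gt0 // rt_gt0. Qed.

Lemma sgM (R : realType) k m n : sg R k (m * n) = sg R k m * sg R k n.
Proof. by rewrite /sg rtM exprMn. Qed.

Lemma ler_sg (R : realType) k m n : (m <= n)%N -> sg R k m <= sg R k n.
Proof. by move=> mn; rewrite /sg lerXn2r ?nnegrE ?rt_ge0 // ler_rt. Qed.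

Lemma sg_rt (R : realType) k m : (0 < k)%N -> sg R k m * rt R k m = m%:R.
Proof. by move=> k0; rewrite /sg -exprSr prednK // rtX. Qed.

(** Here [2 * (k - 1) >= k]. This keeps phase increments below [pi] as long as the fixed factor is
    at most of the order of the square root of the window. *)
Lemma sg_sqr_ge (R : realType) k m : (1 < k)%N -> (0 < m)%N -> m%:R <= sg R k m ^+ 2.
Proof.
move=> k1 m0; rewrite -(rtX R m (ltnW k1)) /sg -exprM.
by apply: ler_weXn2l; [exact: rt_ge1|case: k k1 => [|[|k]] // _; rewrite muln2 -addnn /= addSn ltnS addnS ltnS leq_addr].
Qed.

(** The cofactor of [x - y] in [x ^ k - y ^ k]. It makes differences of roots exact quotients, so
    that their size and concavity follow without derivatives. *)
Definition rsum (R : realType) (k a b : nat) : R :=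
  \sum_(i < k) rt R k b ^+ (k.-1 - i) * rt R k a ^+ i.

Lemma rt_diff (R : realType) k a b : (0 < k)%N ->
  (rt R k b - rt R k a) * rsum R k a b = b%:R - a%:R.
Proof. by move=> k0; rewrite -subrXX !rtX. Qed.

Lemma ler_rsum (R : realType) k a b a' b' : (a <= a')%N -> (b <= b')%N ->
  rsum R k a b <= rsum R k a' b'.
Proof.
move=> aa bb; apply: ler_sum => i _.
by apply: ler_pM; rewrite ?exprn_ge0 ?rt_ge0 // lerXn2r ?nnegrE ?rt_ge0 ?ler_rt.
Qed.

Lemma rsumxx (R : realType) k a : rsum R k a a = k%:R * sg R k a.
Proof.
rewrite /rsum (eq_bigr (fun=> sg R k a)) ?sumr_const ?card_ord ?mulr_natl // => i _.
by rewrite -exprD subnK // -ltnS prednK // (leq_ltn_trans _ (ltn_ord i)).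
Qed.

Lemma rsum_gt0 (R : realType) k a b : (0 < k)%N -> (0 < a)%N -> (a <= b)%N ->
  0 < rsum R k a b.
Proof.
move=> k0 a0 ab; apply: lt_le_trans (@ler_rsum R k a a a b (leqnn a) ab).
by rewrite rsumxx mulr_gt0 ?ltr0n // sg_gt0.
Qed.

Lemma rt_diffE (R : realType) k a b : (0 < k)%N -> (0 < a)%N -> (a <= b)%N ->
  rt R k b - rt R k a = (b%:R - a%:R) / rsum R k a b.
Proof.
move=> k0 a0 ab; rewrite -(@rt_diff R k a b k0) mulfK //.
by rewrite gt_eqF // rsum_gt0.
Qed.

Lemma rt_diff_ge (R : realType) k a b : (0 < k)%N -> (0 < a)%N -> (a <= b)%N ->
  (b%:R - a%:R) / (k%:R * sg R k b) <= rt R k b - rt R k a.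
Proof.
move=> k0 a0 ab; rewrite rt_diffE //; apply: ler_wpM2l; first by rewrite subr_ge0 ler_nat.
have b0 := leq_trans a0 ab.
rewrite lef_pV2 ?posrE ?rsum_gt0 //; last by rewrite mulr_gt0 ?ltr0n // sg_gt0.
by rewrite -rsumxx ler_rsum.
Qed.

Lemma rt_diff_le (R : realType) k a b : (0 < k)%N -> (0 < a)%N -> (a <= b)%N ->
  rt R k b - rt R k a <= (b%:R - a%:R) / (k%:R * sg R k a).
Proof.
move=> k0 a0 ab; rewrite rt_diffE //; apply: ler_wpM2l; first by rewrite subr_ge0 ler_nat.
rewrite lef_pV2 ?posrE ?rsum_gt0 //; last by rewrite mulr_gt0 ?ltr0n // sg_gt0.
by rewrite -rsumxx ler_rsum.
Qed.

Lemma rt_concave (R : realType) k a : (0 < k)%N -> (0 < a)%N ->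
  rt R k a.+2 - rt R k a.+1 <= rt R k a.+1 - rt R k a.
Proof.
move=> k0 a0; rewrite !rt_diffE // -!natrB // !subSnn !div1r.
by rewrite lef_pV2 ?posrE ?rsum_gt0 // ler_rsum.
Qed.

(** The increments of the phase lie between [c / (k * W)] and [c / (k * sg k m)], hence below [pi],
    and decrease by concavity of the root. *)
Lemma root_cos_sum (R : realType) k (c ph : R) m n (W : R) :
  (0 < k)%N -> (0 < m)%N -> 0 < c -> c < pi * (k%:R * sg R k m) ->
  ((m < n)%N -> sg R k n.-1 <= W) -> 0 <= W ->
  `|\sum_(m <= i < n) cos (c * rt R k i + ph)| <= 2 + 2 * (k%:R * W) / c.
Proof.
move=> k0 m0 c0 cpi HW W0.
have k0R : 0 < k%:R :> R by rewrite ltr0n.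
case: (leqP n m) => [nm|mn].
  by rewrite big_geq // normr0 addr_ge0 // divr_ge0 ?mulr_ge0 // ltW.
have {}HW := HW mn.
have W1 : 0 < W.
  apply: lt_le_trans HW; apply: sg_gt0; apply: leq_trans m0 _.
  by rewrite -ltnS prednK // (leq_ltn_trans _ mn).
have -> : 2 * (k%:R * W) / c = 2 / (c / (k%:R * W)) by rewrite invf_div -[LHS]mulrA.
apply: kusmin_landau; first by rewrite divr_gt0 // mulr_gt0.
  move=> i mi ni; rewrite (_ : _ - _ = c * (rt R k i.+1 - rt R k i)); last by ring.
  have i0 : (0 < i)%N by apply: leq_trans mi.
  apply/andP; split.
    apply: ler_wpM2l; first exact: ltW.
    apply: le_trans (rt_diff_ge R k0 i0 (leqnSn i)).
    rewrite -natrB // subSnn div1r lef_pV2 ?posrE ?mulr_gt0 ?sg_gt0 //.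
    apply: ler_wpM2l; first exact: ltW.
    apply: le_trans HW; apply: ler_sg; by rewrite -ltnS prednK // (leq_ltn_trans _ ni).
  have ks : 0 < k%:R * sg R k m by rewrite mulr_gt0 // sg_gt0.
  apply: (@le_lt_trans _ _ (c / (k%:R * sg R k m))); last by rewrite ltr_pdivrMr.
  apply: ler_wpM2l; first exact: ltW.
  apply: le_trans (rt_diff_le R k0 i0 (leqnSn i)) _.
  rewrite -natrB // subSnn div1r lef_pV2 ?posrE ?mulr_gt0 ?sg_gt0 //.
  by apply: ler_wpM2l; [exact: ltW|exact: ler_sg].
move=> i mi ni; have i0 : (0 < i)%N by apply: leq_trans mi.
have := ler_wpM2l (ltW c0) (rt_concave R k0 i0); lra.
Qed.

(** * Vaughan's identity *)

(** Every sum runs up to one cutoff [W] beyond which the summand vanishes, so ranges of products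
    need no separate truncation. *)
Lemma sum_multiples (R : nmodType) (H : nat -> R) (W x : nat) : (0 < x)%N ->
  (forall m, (W <= m)%N -> H m = 0) ->
  \sum_(1 <= y < W) H (x * y)%N = \sum_(1 <= n < W | (x %| n)%N) H n.
Proof.
move=> x0 HW.
transitivity (\sum_(1 <= y < W) \sum_(1 <= n < W | n == (x * y)%N) H n).
  apply: eq_big_nat => y /andP[y0 yW]; rewrite big_nat1_eq muln_gt0 x0 y0 /=.
  by case: leqP => // /HW.
rewrite (@exchange_big_dep_nat _ _ _ _ _ _ _ _ _ (fun n => (x %| n)%N)) /=; last first.
  by move=> y n _ _ _ /eqP->; exact: dvdn_mulr.
rewrite big_nat_cond [RHS]big_nat_cond; apply: eq_bigr => n /andP[/andP[n0 nW] xn].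
rewrite (eq_bigl (fun y => y == n %/ x)%N).
  rewrite (big_nat1_eq _ (fun=> H n)) divn_gt0 // dvdn_leq //=.
  by rewrite (leq_ltn_trans (leq_div _ _)).
by move=> y /=; rewrite eq_sym mulnC -eqn_div // eq_sym.
Qed.

Lemma sum_multiples2 (R : comNzRingType) (a H : nat -> R) (W : nat) :
  (forall m, (W <= m)%N -> H m = 0) ->
  \sum_(1 <= x < W) a x * \sum_(1 <= y < W) H (x * y)%N =
  \sum_(1 <= n < W) (\sum_(1 <= x < W | (x %| n)%N) a x) * H n.
Proof.
move=> HW; under [RHS]eq_bigr do rewrite big_distrl big_mkcond /=.
rewrite exchange_big /= big_nat [RHS]big_nat; apply: eq_bigr => x /andP[x0 _].
by rewrite sum_multiples // big_distrr /= big_mkcond.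
Qed.

(** * The Moebius function [mu] and the von Mangoldt function [vM] *)

Definition mu (R : pzRingType) (n : nat) : R :=
  if all (fun p => logn p n == 1%N) (primes n) then (-1) ^+ size (primes n) else 0.

Lemma mu1 (R : pzRingType) : mu R 1 = 1.
Proof. by rewrite /mu /= expr0. Qed.

Lemma norm_mu_le1 (R : numDomainType) n : `|mu R n| <= 1.
Proof. by rewrite /mu; case: ifP; rewrite ?normr0 // normrX normrN1 expr1n. Qed.

Lemma mu_primeM (R : pzRingType) p d : prime p -> (0 < d)%N ->
  mu R (p * d) = if (p %| d)%N then 0 else - mu R d.
Proof.
move=> pp d0; have p0 := prime_gt0 pp.
rewrite /mu; case: (boolP (p %| d)%N) => pd.
  rewrite ifN //; apply/allPn; exists p.
    by rewrite primesM // primes_prime // mem_head.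
  rewrite lognM // logn_prime // eqxx.
  have : (0 < logn p d)%N by rewrite logn_gt0 mem_primes pp d0.
  by case: (logn p d).
have pe : perm_eq (primes (p * d)) (p :: primes d).
  apply: uniq_perm; rewrite ?primes_uniq //= ?primes_uniq ?andbT.
    by rewrite mem_primes pp d0.
  by move=> q; rewrite primesM // primes_prime // !inE.
rewrite (perm_size pe) (perm_all _ pe) /= exprS mulN1r.
rewrite lognM // logn_prime // eqxx lognE pp d0 (negbTE pd) /=.
have -> : all (fun q => logn q (p * d) == 1%N) (primes d) =
          all (fun q => logn q d == 1%N) (primes d).
  apply: eq_in_all => q; rewrite mem_primes => /and3P[pq _ qd].
  rewrite lognM // logn_prime //; case: (eqVneq q p) => [e|//].
  by move: pd; rewrite -e qd.
by case: ifP; rewrite ?oppr0.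
Qed.

(** For the least prime factor [p] of [n], [mu (p * d) = - mu d] when [p] does not divide [d], so
    the divisors with exactly one factor [p] cancel those with none; the others have [mu = 0]. *)
Lemma sum_mu (R : comNzRingType) n W : (0 < n < W)%N ->
  \sum_(1 <= d < W | (d %| n)%N) mu R d = (n == 1%N)%:R.
Proof.
move=> /andP[n0 nW]; case: eqVneq => [->|n1].
  under eq_bigl do rewrite dvdn1.
  by rewrite big_nat1_eq (leq_ltn_trans n0 nW) mu1.
have pp : prime (pdiv n) by apply: pdiv_prime; lia.
have pn : (pdiv n %| n)%N := pdiv_dvd n.
move: (pdiv n) pp pn => p pp pn; have p0 := prime_gt0 pp.
rewrite (bigID (fun d => p %| d)%N) /=.
have -> : \sum_(1 <= d < W | (d %| n)%N && (p %| d)%N) mu R d =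
    \sum_(1 <= d < W | (p %| d)%N) (if (d %| n)%N then mu R d else 0).
  rewrite big_mkcond [RHS]big_mkcond; apply: eq_bigr => d _.
  by case: (p %| d)%N; case: (d %| n)%N.
rewrite -(@sum_multiples _ (fun d => if (d %| n)%N then mu R d else 0)) //; last first.
  move=> m mW; rewrite ifN //; apply/negP => /dvdn_leq; rewrite n0 => /(_ isT); lia.
rewrite -[X in X + _]opprK -sumrN addrC; apply/eqP; rewrite subr_eq0; apply/eqP.
rewrite [LHS]big_mkcond /= big_nat [RHS]big_nat; apply: eq_bigr => d /andP[d0 _].
rewrite mu_primeM //; case: (boolP (p %| d)%N) => pd.
  by rewrite andbF if_same oppr0.
rewrite andbT Gauss_dvd ?pn ?prime_coprime //=.
by case: ifP; rewrite ?opprK ?oppr0.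
Qed.

Definition vM (R : realType) (n : nat) : R :=
  if size (primes n) == 1%N then ln (pdiv n)%:R else 0.

Lemma vM_prime (R : realType) p : prime p -> vM R p = ln p%:R.
Proof. by move=> pp; rewrite /vM primes_prime //= pdiv_id. Qed.

Lemma vM_neq0P (R : realType) n : vM R n != 0 ->
  exists p i, [/\ prime p, n = (p ^ i.+1)%N & vM R n = ln p%:R].
Proof.
rewrite /vM; case: ifP => [|_]; last by rewrite eqxx.
case: (posnP n) => [->//|n0]; case e : (primes n) => [|p [|//]] // _ _.
have pp : prime p by have := mem_primes p n; rewrite e mem_head => /esym/andP[].
have en : n = (p ^ logn p n)%N.
  by rewrite {1}(prod_prime_decomp n0) prime_decompE e /= big_seq1.
exists p, (logn p n).-1; rewrite prednK -?en; last by rewrite logn_gt0 e mem_head.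
split=> //; have : pdiv n \in primes n.
  rewrite pi_pdiv //; case: (n) e => [|[|]] //.
by rewrite e inE => /eqP->.
Qed.

Lemma vM_ge0 (R : realType) n : 0 <= vM R n.
Proof.
have [->//|/vM_neq0P[p [i [pp _ ->]]]] := eqVneq (vM R n) 0.
by rewrite ln_ge0 // ler1n prime_gt0.
Qed.

Lemma vM_le (R : realType) n : (0 < n)%N -> vM R n <= ln n%:R.
Proof.
move=> n0; have [->|/vM_neq0P[p [i [pp en ->]]]] := eqVneq (vM R n) 0.
  by rewrite ln_ge0 // ler1n.
have p0 := prime_gt0 pp; rewrite ler_ln ?posrE ?ltr0n // ler_nat en.
by rewrite -[X in (X <= _)%N]expn1 leq_pexp2l.
Qed.

(** With [n = p * n'], the divisors of [n] that do not divide [n'] carry the full power of [p]; the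
    only prime power among them is that power itself, which contributes [ln p]. *)
Lemma sum_vM (R : realType) n W : (0 < n < W)%N ->
  \sum_(1 <= d < W | (d %| n)%N) vM R d = ln n%:R.
Proof.
elim/ltn_ind: n => n IH /andP[n0 nW]; have [->|n1] := eqVneq n 1%N.
  under eq_bigl do rewrite dvdn1.
  by rewrite big_nat1_eq ln1; case: ifP; rewrite /vM.
have pp : prime (pdiv n) by apply: pdiv_prime; lia.
have pn : (pdiv n %| n)%N := pdiv_dvd n.
move: (pdiv n) pp pn => p pp pn; have p0 := prime_gt0 pp.
set n' := (n %/ p)%N; have en : n = (p * n')%N by rewrite mulnC divnK.
have n'0 : (0 < n')%N by rewrite divn_gt0 // dvdn_leq.
have n'n : (n' < n)%N by rewrite ltn_Pdiv // prime_gt1.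
rewrite (bigID (fun d => d %| n')%N) /=.
have n'W : (0 < n' < W)%N by rewrite n'0 (ltn_trans n'n).
have -> : \sum_(1 <= d < W | (d %| n)%N && (d %| n')%N) vM R d = ln n'%:R.
  rewrite -(IH n' n'n n'W) big_mkcond [RHS]big_mkcond.
  apply: eq_bigr => d _; case: (boolP (d %| n')%N) => [dn|]; last by rewrite andbF.
  by rewrite en dvdn_mull.
have l0 : (0 < logn p n)%N by rewrite logn_gt0 mem_primes pp n0.
rewrite [in RHS]en natrM lnM ?posrE ?ltr0n // addrC; congr (_ + _).
set q := (p ^ logn p n)%N.
have vq : vM R q = ln p%:R by rewrite /vM /q primesX // primes_prime //= -(prednK l0) pdiv_pfactor.
have qn : (q %| n)%N by rewrite pfactor_dvdn.
have ln' : logn p n = (logn p n').+1 by rewrite en lognM // logn_prime // eqxx.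
have qW : (0 < q < W)%N by rewrite expn_gt0 p0 (leq_ltn_trans (dvdn_leq n0 qn)).
rewrite big_mkcond (bigD1_seq q) ?mem_index_iota ?iota_uniq //=.
rewrite qn pfactor_dvdn // ln' ltnn /= vq big1_seq ?addr0 // => d /andP[dq _].
case: ifP => // /andP[dn dn'].
apply/eqP/negPn/negP => /vM_neq0P[r [i [pr ed _]]].
have [erp|nrp] := eqVneq r p.
  move: dn dn' dq; rewrite ed erp !pfactor_dvdn // -ltnNge ln' ltnS => h1 h2.
  by rewrite /q ln' (_ : i.+1 = (logn p n').+1) ?eqxx //; lia.
move: dn dn'; rewrite en Gauss_dvdr; first by move->.
by rewrite ed coprime_sym coprimeXr // prime_coprime // dvdn_prime2 // eq_sym.
Qed.

Definition vaughan_coef (R : pzRingType) (W V b : nat) : R :=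
  \sum_(1 <= x < W | (x %| b)%N && (V < x)%N) mu R x.

(** For [z > U], [sum_mu] expands [G z] into terms [mu x * G (z * (x * y))], which are split at
    [x = V]. The part [x > V] is the last sum. In the part [x <= V] the range [z > U] is the full
    range minus [z <= U], and over the full range [vM] adds up to [ln] by [sum_vM]. *)
Lemma vaughan (R : realType) (G : nat -> R) (W U V : nat) :
  (forall m, (W <= m)%N -> G m = 0) ->
  \sum_(1 <= n < W) vM R n * G n =
  \sum_(1 <= n < W | (n <= U)%N) vM R n * G n
  + \sum_(1 <= x < W | (x <= V)%N) mu R x * (\sum_(1 <= n < W) ln n%:R * G (x * n)%N)
  - \sum_(1 <= x < W | (x <= V)%N) \sum_(1 <= z < W | (z <= U)%N)
      mu R x * vM R z * (\sum_(1 <= y < W) G (x * z * y)%N)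
  + \sum_(1 <= z < W | (U < z)%N) vM R z *
      \sum_(1 <= b < W) vaughan_coef R W V b * G (z * b)%N.
Proof.
move=> GW.
have GW' z m : (0 < z)%N -> (W <= m)%N -> G (z * m)%N = 0.
  by move=> z0 mW; apply: GW; apply: leq_trans mW _; rewrite leq_pmull.
rewrite (bigID (fun n => n <= U)%N) /= -!addrA; congr (_ + _).
under eq_bigl do rewrite -ltnNge.
have split1 z : (0 < z < W)%N -> G z =
    \sum_(1 <= x < W | (x <= V)%N) mu R x * (\sum_(1 <= y < W) G (z * (x * y))%N)
    + \sum_(1 <= b < W) vaughan_coef R W V b * G (z * b)%N.
  move=> /andP[z0 zW].
  have -> : \sum_(1 <= b < W) vaughan_coef R W V b * G (z * b)%N =
     \sum_(1 <= x < W | ~~ (x <= V)%N) mu R x * (\sum_(1 <= y < W) G (z * (x * y))%N).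
    have := @sum_multiples2 R (fun x => if (V < x)%N then mu R x else 0) (fun m => G (z * m)%N) W (GW' z ^~ z0).
    rewrite /vaughan_coef; under [in RHS]eq_bigr do rewrite -big_mkcondr.
    move=> <-; rewrite [RHS]big_mkcond; apply: eq_bigr => x _.
    by rewrite -ltnNge; case: ifP; rewrite ?mul0r.
  transitivity (\sum_(1 <= x < W) mu R x * (\sum_(1 <= y < W) G (z * (x * y))%N)); last first.
    by rewrite [LHS](bigID (fun x => x <= V)%N).
  rewrite (@sum_multiples2 R _ (fun m => G (z * m)%N) W (GW' z ^~ z0)).
  rewrite (eq_big_nat _ _ (F2 := fun n => if n == 1%N then G z else 0)); last first.
    move=> n /andP[n0 nW]; rewrite sum_mu ?n0 //; case: eqP => [->|_].
      by rewrite muln1 mul1r.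
    by rewrite mul0r.
  by rewrite -big_mkcond big_nat1_eq (leq_ltn_trans z0 zW).
have -> : \sum_(1 <= n < W | (U < n)%N) vM R n * G n =
  \sum_(1 <= n < W | (U < n)%N) \sum_(1 <= x < W | (x <= V)%N) mu R x * vM R n * (\sum_(1 <= y < W) G (x * n * y)%N)
  + \sum_(1 <= z < W | (U < z)%N) vM R z *
      \sum_(1 <= b < W) vaughan_coef R W V b * G (z * b)%N.
  rewrite -big_split /= big_nat_cond [RHS]big_nat_cond.
  apply: eq_bigr => z /andP[/andP[z0 zW] _].
  rewrite (split1 z) ?z0 // mulrDr; congr (_ + _).
  rewrite big_distrr /=; apply: eq_bigr => x _.
  rewrite mulrA [vM _ _ * _]mulrC; congr (_ * _); apply: eq_bigr => y _; congr G.
  by rewrite mulnCA mulnA.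
rewrite !addrA; congr (_ + _).
apply/eqP; rewrite eq_sym subr_eq; apply/eqP.
rewrite exchange_big /= -big_split /=.
rewrite big_nat_cond [RHS]big_nat_cond; apply: eq_bigr => x /andP[/andP[x0 xW] _].
have -> : \sum_(1 <= n < W) ln n%:R * G (x * n)%N =
    \sum_(1 <= n < W) vM R n * \sum_(1 <= y < W) G (x * (n * y))%N.
  rewrite (sum_multiples2 _ (GW' x ^~ x0)); apply: eq_big_nat => n /andP[n0 nW].
  by rewrite sum_vM ?n0.
rewrite big_distrr /= (bigID (fun n => n <= U)%N) /= addrC; congr (_ + _).
  apply: eq_big => [n|n _]; first by rewrite -ltnNge.
  by rewrite mulrA; congr (_ * _); apply: eq_bigr => y _; rewrite mulnA.
apply: eq_bigr => n _.
by rewrite mulrA; congr (_ * _); apply: eq_bigr => y _; rewrite mulnA.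
Qed.

(** * Bilinear sums *)

Lemma cauchy_schwarz_sum (R : realFieldType) (I : Type) (r : seq I) (a b : I -> R) :
  (\sum_(i <- r) a i * b i) ^+ 2 <= (\sum_(i <- r) a i ^+ 2) * (\sum_(i <- r) b i ^+ 2).
Proof.
elim: r => [|i r IH]; first by rewrite !big_nil expr0n mul0r.
rewrite !big_cons; set S := \sum_(_ <- r) (a _ * b _) in IH *.
set A := \sum_(_ <- r) (a _ ^+ 2) in IH *; set B := \sum_(_ <- r) (b _ ^+ 2) in IH *.
have A0 : 0 <= A by apply: sumr_ge0 => j _; exact: sqr_ge0.
have B0 : 0 <= B by apply: sumr_ge0 => j _; exact: sqr_ge0.
have : 2 * (a i * b i * S) <= a i ^+ 2 * B + b i ^+ 2 * A.
  have y0 : 0 <= a i ^+ 2 * B + b i ^+ 2 * A by apply: addr_ge0; apply: mulr_ge0 => //; exact: sqr_ge0.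
  have h : (2 * (a i * b i * S)) ^+ 2 <= (a i ^+ 2 * B + b i ^+ 2 * A) ^+ 2.
    apply: (@le_trans _ _ (4 * (a i ^+ 2 * b i ^+ 2) * (A * B))).
      have -> : (2 * (a i * b i * S)) ^+ 2 = 4 * (a i ^+ 2 * b i ^+ 2) * S ^+ 2 by ring.
      by apply: ler_wpM2l => //; apply: mulr_ge0 => //; apply: mulr_ge0; exact: sqr_ge0.
    rewrite -subr_ge0 (_ : _ - _ = (a i ^+ 2 * B - b i ^+ 2 * A) ^+ 2); last by ring.
    exact: sqr_ge0.
  by rewrite -subr_ge0 in h; rewrite leNgt; apply/negP => lt; nra.
by move=> h; nra.
Qed.

Lemma sum_dyadic (R : nmodType) (f : nat -> R) L :
  \sum_(1 <= y < 2 ^ L) f y = \sum_(i < L) \sum_(2 ^ i <= y < 2 ^ i.+1) f y.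
Proof.
elim: L => [|L IH]; first by rewrite big_ord0 big_geq.
rewrite big_ord_recr /= -IH (@big_cat_nat _ _ _ (2 ^ L)) //=.
  by rewrite expn_gt0.
by rewrite leq_exp2l.
Qed.

Lemma harmonic_le (R : realFieldType) N L : (N <= 2 ^ L)%N ->
  \sum_(1 <= r < N) (r%:R)^-1 <= L%:R :> R.
Proof.
move=> NL; have : \sum_(1 <= r < N) (r%:R)^-1 <= \sum_(1 <= r < 2 ^ L) (r%:R)^-1 :> R.
  case: (leqP 1 N) => N1; last first.
    by rewrite big_geq ?(ltnW N1) //; apply: sumr_ge0 => i _; rewrite invr_ge0.
  rewrite [leRHS](@big_cat_nat _ _ _ N) //= lerDl.
  by apply: sumr_ge0 => i _; rewrite invr_ge0.
move/le_trans; apply; rewrite sum_dyadic.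
rewrite (_ : L%:R = \sum_(i < L) 1); last by rewrite sumr_const card_ord.
apply: ler_sum => i _.
apply: (@le_trans _ _ (\sum_(2 ^ i <= y < 2 ^ i.+1) ((2 ^ i)%:R)^-1)).
  apply: ler_sum_nat => y /andP[iy _].
  have i0 : (0 < 2 ^ i)%N by rewrite expn_gt0.
  by rewrite lef_pV2 ?posrE ?ltr0n ?(leq_trans i0) // ler_nat.
rewrite sumr_const_nat expnS mul2n -addnn addnK -[leLHS]mulr_natl mulfV //.
by rewrite pnatr_eq0 -lt0n expn_gt0.
Qed.

Definition ndiv (R : pzRingType) (W b : nat) : R := \sum_(1 <= x < W | (x %| b)%N) 1.

Lemma coef_small (R : pzRingType) W V b : (0 < b <= V)%N -> vaughan_coef R W V b = 0.
Proof.
move=> /andP[b0 bV]; rewrite /vaughan_coef big1 // => x /andP[xb Vx].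
by have := dvdn_leq b0 xb; lia.
Qed.

Lemma coef_le_ndiv (R : realType) W V b : `|vaughan_coef R W V b| <= ndiv R W b.
Proof.
apply: le_trans (ler_norm_sum _ _ _) _; rewrite /ndiv big_mkcond [leRHS]big_mkcond.
apply: ler_sum => x _; case: (boolP (x %| b)%N) => //= _.
by case: ifP => // _; exact: norm_mu_le1.
Qed.

(** For [b > V] the full divisor sum of [mu] vanishes, so the coefficient is minus the sum over
    divisors up to [V], which has at most [V] terms. *)
Lemma coef_le_cut (R : realType) W V b : (0 < b < W)%N -> (0 < V)%N ->
  `|vaughan_coef R W V b| <= V%:R.
Proof.
move=> bW V0; case: (leqP b V) => bV.
  by rewrite coef_small ?normr0 //; case/andP: bW => ->.
have := @sum_mu R b W bW; rewrite (bigID (fun x => x <= V)%N) /=.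
have -> : (b == 1%N) = false by lia.
have -> : \sum_(1 <= i < W | (i %| b)%N && ~~ (i <= V)%N) mu R i = vaughan_coef R W V b.
  by apply: eq_bigl => x; rewrite -ltnNge.
move/eqP; rewrite addr_eq0 => /eqP; move/(congr1 Num.norm); rewrite normrN => <-.
apply: le_trans (ler_norm_sum _ _ _) _.
have VW : (V.+1 <= W)%N by case/andP: bW => _; apply: leq_ltn_trans; exact: ltnW.
apply: (@le_trans _ _ (\sum_(1 <= x < W | (x <= V)%N) 1)).
  rewrite big_mkcond [leRHS]big_mkcond; apply: ler_sum => x _.
  by case: (x <= V)%N; rewrite ?andbF //=; case: ifP => // _; rewrite ?norm_mu_le1.
rewrite (eq_bigl (fun x => true && (x < V.+1)%N)) // -big_nat_widen //.
by rewrite sumr_const_nat subn1.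
Qed.

(** With [s] the integer square root of [b], at most [s] divisors are up to [s], and [x -> b %/ x]
    sends the others injectively into the same range. *)
Lemma ndiv_sqr (R : realType) W b : (0 < b < W)%N -> ndiv R W b ^+ 2 <= (4 * b)%:R.
Proof.
move=> /andP[b0 bW].
have [s2 sb] := floor_rootP b (ltn0Sn 1); move: (floor_root 2 b) s2 sb => s s2 sb.
have : (size [seq x <- index_iota 1 W | (x %| b)%N] <= s.*2)%N.
  pose t := [seq x <- index_iota 1 W | (x %| b)%N].
  have -> : size t = (size [seq x <- t | x <= s] + size [seq x <- t | ~~ (x <= s)])%N.
    by rewrite -[LHS](count_predC (fun x => x <= s)%N) -!size_filter.
  have ut : uniq t by rewrite filter_uniq // iota_uniq.
  rewrite -addnn; apply: leq_add.
    rewrite -[X in (_ <= X)%N](size_iota 1 s); apply: uniq_leq_size; first exact: filter_uniq.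
    move=> x; rewrite !mem_filter mem_index_iota mem_iota add1n ltnS.
    by move=> /and3P[-> _ /andP[-> _]].
  rewrite -(size_map (fun x => b %/ x)%N) -[X in (_ <= X)%N](size_iota 1 s).
  have mt x : x \in [seq x <- t | ~~ (x <= s)%N] -> [/\ (x %| b)%N, (0 < x)%N & (s < x)%N].
    by rewrite !mem_filter mem_index_iota -ltnNge => /and3P[-> -> /andP[-> _]].
  apply: uniq_leq_size.
    rewrite map_inj_in_uniq; [exact: filter_uniq|move=> x y /mt[xb x0 _] /mt[yb y0 _] e].
    have := divnK xb; have := divnK yb; rewrite -e => h1 h2.
    have q0 : (0 < b %/ x)%N by rewrite divn_gt0 // dvdn_leq.
    by apply/eqP; rewrite -(eqn_pmul2l q0) h1 h2.
  move=> y /mapP[x /mt[xb x0 sx] ->]; rewrite mem_iota add1n ltnS divn_gt0 // dvdn_leq //=.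
  rewrite -ltnS ltn_divLR //; apply: leq_trans sb _.
  by rewrite expnS expn1 leq_mul2l sx orbT.
have -> : ndiv R W b = (size [seq x <- index_iota 1 W | (x %| b)%N])%:R.
  by rewrite /ndiv -big_filter big_const_seq count_predT iter_addr_0.
move: (size _) => n ns; rewrite -natrX ler_nat.
apply: (@leq_trans (s.*2 ^ 2)); first by rewrite leq_exp2r.
by rewrite -mul2n expnMn leq_mul2l s2.
Qed.

Lemma sum_ndiv (R : realType) W N L : (N <= W)%N -> (N <= 2 ^ L)%N ->
  \sum_(1 <= b < N) ndiv R W b <= N%:R * L%:R.
Proof.
move=> NW NL; pose H n : R := if (n < N)%N then 1 else 0.
have -> : \sum_(1 <= b < N) ndiv R W b = \sum_(1 <= x < W) \sum_(1 <= n < W | (x %| n)%N) H n.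
  rewrite [RHS](exchange_big_dep xpredT) //= (big_nat_widen _ _ _ _ _ NW) big_mkcond /=.
  apply: eq_bigr => n _; rewrite /H /ndiv; case: ifP => nN.
    by rewrite big_mkcond [RHS]big_mkcond.
  by rewrite big1.
apply: (@le_trans _ _ (\sum_(1 <= x < W) if (x < N)%N then N%:R / x%:R else 0)).
  apply: ler_sum_nat => x /andP[x0 xW]; rewrite -sum_multiples //; last first.
    by move=> m Wm; rewrite /H ifN // -leqNgt (leq_trans NW).
  case: (ltnP x N) => xN; last first.
    rewrite big_nat big1 // => y /andP[y0 _]; rewrite /H ifN // -leqNgt.
    by rewrite (leq_trans xN) // leq_pmulr.
  apply: (@le_trans _ _ (\sum_(1 <= y < (N %/ x).+1) 1)).
    have -> : \sum_(1 <= y < W) H (x * y)%N = \sum_(1 <= y < W | (y < (N %/ x).+1)%N) H (x * y)%N.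
      rewrite [RHS]big_mkcond; apply: eq_bigr => y _; case: ifP => // /negbT; rewrite -leqNgt => h.
      by rewrite /H ifN // -leqNgt; apply: ltnW; rewrite mulnC -ltn_divLR.
    have [h|h] := leqP (N %/ x).+1 W.
      rewrite -(big_nat_widen _ _ _ xpredT _ h); apply: ler_sum => y _.
      by rewrite /H; case: ifP.
    rewrite big_mkcond [leRHS](@big_cat_nat _ _ _ W) ?(ltnW h) //=; last by lia.
    rewrite -[leLHS]addr0; apply: lerD; last by apply: sumr_ge0.
    by apply: ler_sum => y _; rewrite /H; case: (y < _)%N => //; case: ifP.
  rewrite sumr_const_nat subn1 /= ler_pdivlMr ?ltr0n // -natrM ler_nat; exact: leq_divM.
rewrite -big_mkcond -(big_nat_widen _ _ _ xpredT _ NW) -big_distrr /=.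
by apply: ler_wpM2l => //; exact: harmonic_le.
Qed.

(** One factor of the square is bounded pointwise by [K], the other by the divisor function, whose
    mean is only logarithmic. *)
Lemma coef_sqr_sum (R : realType) W V m N L (K : R) :
  (0 < m)%N -> (N <= W)%N -> (N <= 2 ^ L)%N -> 0 <= K ->
  (forall b, (m <= b < N)%N -> `|vaughan_coef R W V b| <= K) ->
  \sum_(m <= b < N) vaughan_coef R W V b ^+ 2 <= K * (N%:R * L%:R).
Proof.
move=> m0 NW NL K0 HK.
apply: (@le_trans _ _ (K * \sum_(1 <= b < N) ndiv R W b)); last first.
  by apply: ler_wpM2l => //; exact: sum_ndiv.
have nd0 b : 0 <= ndiv R W b by apply: sumr_ge0.
rewrite (big_nat_widenl m 1) // big_distrr big_mkcond /= big_nat [leRHS]big_nat.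
apply: ler_sum => b /andP[b1 bN]; case: (leqP m b) => mb; last exact: mulr_ge0.
rewrite -real_normK ?num_real // expr2.
by apply: ler_pM => //; [apply: HK; rewrite mb|exact: coef_le_ndiv].
Qed.

(** * Sums of type I and type II over a window *)

Definition win (R : pzRingType) (Y Z : nat) (f : nat -> R) (m : nat) : R :=
  if (Y < m <= Z)%N then f m else 0.

(** The correlation of the phases at [x * y1] and [x * y2]. Since roots are multiplicative, it is
    again a cosine sum along roots, of frequency [c0 * (rt y2 - rt y1)]. *)
Definition kernel (R : realType) (k Y Z X0 : nat) (c0 : R) (y1 y2 : nat) : R :=
  \sum_(1 <= x < X0) (if (Y < x * y1 <= Z)%N && (Y < x * y2 <= Z)%N
     then cos (c0 * (rt R k y2 - rt R k y1) * rt R k x) else 0).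

Lemma kernelC (R : realType) k Y Z X0 (c0 : R) y1 y2 :
  kernel k Y Z X0 c0 y1 y2 = kernel k Y Z X0 c0 y2 y1.
Proof.
apply: eq_bigr => x _; rewrite andbC -cosN -mulNr -mulrN opprB.
by [].
Qed.

Lemma kernel_le (R : realType) k Y Z X0 (c0 : R) y1 y2 :
  `|kernel k Y Z X0.+1 c0 y1 y2| <= X0%:R.
Proof.
apply: le_trans (ler_norm_sum _ _ _) _.
apply: (@le_trans _ _ (\sum_(1 <= x < X0.+1) 1)); last by rewrite sumr_const_nat subn1.
by apply: ler_sum => x _; case: ifP => _; rewrite ?normr0 ?cos_max.
Qed.

(** The window restricts [x] to [m <= x < n] with [2 * B * m > Y]. Together with [B * B <= 2 * Y]
    this gives [sg (B * m) > B / 2], which keeps the phase increments below [pi]; the gap [y2 - y1]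
    enters the bound through the size of the frequency. *)
Lemma kernel_lt_le (R : realType) k Y Z B (c0 : R) y1 y2 :
  (1 < k)%N -> (0 < Y)%N -> (0 < B)%N -> (B * B <= 2 * Y)%N ->
  0 < c0 <= 2 * pi -> (B <= y1)%N -> (y1 < y2)%N -> (y2 < 2 * B)%N ->
  `|kernel k Y Z (Z %/ B).+1 c0 y1 y2| <=
    2 + 2 * k%:R ^+ 2 * sg R k (2 * Z) / c0 / (y2 - y1)%:R.
Proof.
move=> k1 Y0 B0 BY /andP[c00 c02] By1 y12 y2B.
have k0 : (0 < k)%N by lia.
have y10 : (0 < y1)%N by lia.
have y20 : (0 < y2)%N by lia.
set d : R := rt R k y2 - rt R k y1.
set m := (Y %/ y1).+1; set n := (Z %/ y2).+1.
have -> : kernel k Y Z (Z %/ B).+1 c0 y1 y2 = \sum_(m <= x < n) cos (c0 * d * rt R k x + 0).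
  rewrite (big_nat_widenl _ 1) // (big_nat_widen _ n (Z %/ B).+1); last first.
    by rewrite ltnS leq_div2l //; lia.
  rewrite [RHS]big_mkcond /kernel.
  apply: eq_big_nat => x /andP[x0 xX]; rewrite /= addr0 /m /n.
  rewrite ltn_divLR // ltnS leq_divRL //.
  have -> : (Y < x * y1 <= Z)%N && (Y < x * y2 <= Z)%N = (Y < x * y1)%N && (x * y2 <= Z)%N.
    have : (x * y1 <= x * y2)%N by rewrite leq_mul2l ltnW ?orbT.
    by move: (x * y1)%N (x * y2)%N => p q pq; apply/idP/idP; lia.
  by [].
have k0R : 0 < k%:R :> R by rewrite ltr0n.
have dR : 0 < (y2 - y1)%:R :> R by rewrite ltr0n subn_gt0.
have y1B : (y1 <= 2 * B)%N by exact: ltnW (ltn_trans y12 y2B).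
have B20 : (0 < 2 * B)%N by lia.
have sB2 : 0 < sg R k (2 * B) by apply: sg_gt0; lia.
have dge : (y2 - y1)%:R / (k%:R * sg R k (2 * B)) <= d.
  apply: le_trans (rt_diff_ge R k0 y10 (ltnW y12)).
  rewrite natrB ?(ltnW y12) //; apply: ler_wpM2l; first by rewrite subr_ge0 ler_nat ltnW.
  rewrite lef_pV2 ?posrE ?mulr_gt0 ?sg_gt0 //; apply: ler_wpM2l; first exact: ltW.
  by apply: ler_sg; exact: ltnW.
have d0 : 0 < d by apply: lt_le_trans dge; rewrite divr_gt0 // mulr_gt0.
have c0' : 0 < c0 * d by rewrite mulr_gt0.
have sB : 0 < sg R k B by exact: sg_gt0.
have dle : d <= B%:R / (k%:R * sg R k B).
  apply: le_trans (rt_diff_le R k0 y10 (ltnW y12)) _.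
  apply: ler_pM.
  - by rewrite subr_ge0 ler_nat ltnW.
  - by rewrite invr_ge0 mulr_ge0 // sg_ge0.
  - rewrite -natrB ?(ltnW y12) // ler_nat; move: By1 y2B; clear; lia.
  - rewrite lef_pV2 ?posrE ?mulr_gt0 ?sg_gt0 //; apply: ler_wpM2l; first exact: ltW.
    exact: ler_sg.
have mY : (Y < 2 * (B * m))%N.
  have -> : (2 * (B * m) = m * (2 * B))%N by rewrite [(B * m)%N]mulnC mulnCA.
  apply: (@leq_trans (m * y1)); first by rewrite -ltn_divLR.
  by rewrite leq_mul2l y1B orbT.
have sBm : B%:R < 2 * sg R k (B * m).
  have h : (B * m)%:R <= sg R k (B * m) ^+ 2 by apply: sg_sqr_ge => //; rewrite muln_gt0 B0.
  have h2 : (B * B)%:R < 4 * (B * m)%:R :> R by rewrite -natrM ltr_nat (leq_ltn_trans BY) // -[4%N]/(2 * 2)%N -mulnA ltn_pmul2l.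
  have s0 := sg_ge0 R k (B * m).
  rewrite natrM in h2; rewrite ltNge; apply/negP => h3.
  have : 0 <= B%:R :> R by []. 
  nra.
have pi0 := pi_gt0 R.
have cpi : c0 * d < pi * (k%:R * sg R k m).
  apply: (@le_lt_trans _ _ (c0 * (B%:R / (k%:R * sg R k B)))).
    by apply: ler_wpM2l => //; exact: ltW.
  rewrite [ltLHS]mulrA ltr_pdivrMr ?mulr_gt0 //.
  have -> : pi * (k%:R * sg R k m) * (k%:R * sg R k B) = pi * k%:R ^+ 2 * sg R k (B * m).
    by rewrite sgM; ring.
  apply: (@le_lt_trans _ _ (2 * pi * B%:R)); first by apply: ler_wpM2r.
  apply: (@lt_le_trans _ _ (4 * pi * sg R k (B * m))).
    have : pi * B%:R < pi * (2 * sg R k (B * m)) by rewrite ltr_pM2l.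
    lra.
  apply: ler_wpM2r; first exact: sg_ge0.
  rewrite mulrC; apply: ler_wpM2l; first exact: ltW.
  rewrite -natrX ler_nat; have : (2 ^ 2 <= k ^ 2)%N by rewrite leq_exp2r. 
  by [].
(* The denominator cancels against the factor [sg R k (2 * B)] in the lower bound for [d], so the
   result does not depend on [B]. *)
set W := sg R k (2 * Z) / sg R k (2 * B).
have W0 : 0 <= W by rewrite divr_ge0 ?sg_ge0.
apply: le_trans (root_cos_sum (W := W) 0 k0 (ltn0Sn _) c0' cpi _ W0) _.
  move=> _; rewrite /W ler_pdivlMr // -sgM; apply: ler_sg; rewrite /n /=.
  rewrite mulnCA leq_mul2l /=; apply: leq_trans (leq_divM Z y2).
  by rewrite leq_mul2l (leq_trans By1 (ltnW y12)) orbT.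
rewrite lerD2l.
have -> : 2 * k%:R ^+ 2 * sg R k (2 * Z) / c0 / (y2 - y1)%:R =
   2 * (k%:R * W) / (c0 * ((y2 - y1)%:R / (k%:R * sg R k (2 * B)))).
  rewrite /W; field; rewrite !gt_eqF //.
apply: ler_wpM2l; first by apply: mulr_ge0 => //; exact: mulr_ge0.
have kB : 0 < k%:R * sg R k (2 * B) by exact: mulr_gt0.
have q0 : 0 < c0 * ((y2 - y1)%:R / (k%:R * sg R k (2 * B))) by rewrite mulr_gt0 // divr_gt0.
rewrite lef_pV2 ?posrE //.
by apply: ler_wpM2l => //; exact: ltW.
Qed.

(** The diagonal is bounded trivially by [Z %/ B]; on each side the terms [1 / |y2 - y1|] form a
    harmonic sum. *)
Lemma kernel_row (R : realType) k Y Z B L (c0 : R) y1 :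
  (1 < k)%N -> (0 < Y)%N -> (0 < B)%N -> (B * B <= 2 * Y)%N -> (B <= 2 ^ L)%N ->
  0 < c0 <= 2 * pi -> (B <= y1 < 2 * B)%N ->
  \sum_(B <= y2 < 2 * B) `|kernel k Y Z (Z %/ B).+1 c0 y1 y2| <=
    (Z %/ B)%:R + 4 * B%:R + 4 * k%:R ^+ 2 * sg R k (2 * Z) / c0 * L%:R.
Proof.
move=> k1 Y0 B0 BY BL c0P /andP[By1 y1B].
set Q := 2 * k%:R ^+ 2 * sg R k (2 * Z) / c0.
have /andP[c00 _] := c0P.
have Q0 : 0 <= Q by rewrite divr_ge0 ?(ltW c00) // mulr_ge0 ?sg_ge0 // mulr_ge0 // sqr_ge0.
pose D (r : nat) : R := 2 + Q / r%:R.
have D0 r : 0 <= D r by rewrite addr_ge0 // divr_ge0.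
have DS : \sum_(1 <= r < B) D r <= 2 * B%:R + Q * L%:R.
  rewrite big_split /= sumr_const_nat; apply: lerD.
    by rewrite -[leLHS]mulr_natr; apply: ler_wpM2l => //; rewrite ler_nat leq_subr.
  by rewrite -big_distrr /=; apply: ler_wpM2l => //; exact: harmonic_le.
have trunc N : (N <= B)%N -> \sum_(1 <= r < N) D r <= \sum_(1 <= r < B) D r.
  move=> NB; case: (leqP 1 N) => N1; last first.
    by rewrite big_geq ?(ltnW N1) //; apply: sumr_ge0.
  by rewrite [leRHS](@big_cat_nat _ _ _ N) //= lerDl; apply: sumr_ge0.
rewrite (@big_cat_nat _ _ _ y1) ?(ltnW y1B) //= [X in _ + X]big_ltn //.
have h1 : \sum_(B <= y2 < y1) `|kernel k Y Z (Z %/ B).+1 c0 y1 y2| <= 2 * B%:R + Q * L%:R.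
  apply: le_trans DS; apply: (@le_trans _ _ (\sum_(B <= y2 < y1) D (y1 - y2)%N)).
    apply: ler_sum_nat => y /andP[By yy1]; rewrite kernelC; exact: kernel_lt_le.
  rewrite big_nat_rev /= -{1}[B]add0n big_addn.
  rewrite (eq_big_nat _ _ (F2 := fun i => D i.+1)).
    by rewrite -(big_add1 _ _ 0 (y1 - B).+1 xpredT D); apply: trunc; move: y1B; clear; lia.
  by move=> i /andP[_ iB]; congr D; lia.
have h2 : \sum_(y1.+1 <= y2 < 2 * B) `|kernel k Y Z (Z %/ B).+1 c0 y1 y2| <= 2 * B%:R + Q * L%:R.
  apply: le_trans DS; apply: (@le_trans _ _ (\sum_(y1.+1 <= y2 < 2 * B) D (y2 - y1)%N)).
    by apply: ler_sum_nat => y /andP[By yy1]; exact: kernel_lt_le.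
  rewrite -[y1.+1]add1n big_addn (eq_bigr D); last by move=> i _; rewrite addnK.
  by apply: trunc; move: By1; clear; lia.
have h3 := kernel_le k Y Z (Z %/ B) c0 y1 y1.
have -> : 4 * k%:R ^+ 2 * sg R k (2 * Z) / c0 * L%:R = 2 * (Q * L%:R).
  by rewrite /Q; field; rewrite gt_eqF.
apply: le_trans (lerD h1 (lerD h3 h2)) _; move: (Q * L%:R) => q; lra.
Qed.

(* Cauchy-Schwarz over [x], then the kernel bounds the correlations of [y1] and [y2]. *)
Lemma type2 (R : realType) k Y Z B L X (c0 ph : R) (a b : nat -> R) :
  (1 < k)%N -> (0 < Y)%N -> (0 < B)%N -> (B * B <= 2 * Y)%N -> (B <= 2 ^ L)%N ->
  0 < c0 <= 2 * pi -> (Z %/ B < X)%N ->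
  (\sum_(1 <= x < X) a x * \sum_(B <= y < 2 * B) b y *
     win Y Z (fun m => cos (c0 * rt R k m + ph)) (x * y)) ^+ 2 <=
  (\sum_(1 <= x < (Z %/ B).+1) a x ^+ 2) * ((\sum_(B <= y < 2 * B) b y ^+ 2) *
    ((Z %/ B)%:R + 4 * B%:R + 4 * k%:R ^+ 2 * sg R k (2 * Z) / c0 * L%:R)).
Proof.
move=> k1 Y0 B0 BY BL c0P ZX; have k0 : (0 < k)%N by lia.
set G := win _ _ _; set X0 := (Z %/ B).+1.
pose I x y := (Y < x * y <= Z)%N.
have -> : \sum_(1 <= x < X) a x * \sum_(B <= y < 2 * B) b y * G (x * y)%N =
    \sum_(1 <= x < X0) a x * \sum_(B <= y < 2 * B) b y * G (x * y)%N.
  rewrite (@big_cat_nat _ _ _ X0) //= [X in _ + X]big_nat [X in _ + X]big1 ?addr0 //.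
  move=> x /andP[Xx _]; rewrite big_nat big1 ?mulr0 // => y /andP[By _].
  rewrite /G /win ifN ?mulr0 // negb_and; apply/orP; right; rewrite -ltnNge.
  by apply: (@leq_trans (x * B)); rewrite -?ltn_divLR // leq_mul2l By orbT.
apply: le_trans (cauchy_schwarz_sum _ _ _) _.
apply: ler_wpM2l; first by apply: sumr_ge0 => x _; exact: sqr_ge0.
(* [C] and [S] are the real and imaginary parts of a complex inner sum; passing to
   [C x ^+ 2 + S x ^+ 2] removes the phase [ph]. *)
pose u x y := c0 * rt R k (x * y).
pose C x := \sum_(B <= y < 2 * B) b y * (if I x y then cos (u x y) else 0).
pose S x := \sum_(B <= y < 2 * B) b y * (if I x y then sin (u x y) else 0).
have TCS x : \sum_(B <= y < 2 * B) b y * G (x * y)%N = cos ph * C x - sin ph * S x.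
  rewrite /C /S !big_distrr /= -sumrB; apply: eq_bigr => y _.
  rewrite /G /win /I; case: ifP => _; last by ring.
  by rewrite cosD /u; ring.
apply: (@le_trans _ _ (\sum_(1 <= x < X0) (C x ^+ 2 + S x ^+ 2))).
  apply: ler_sum => x _; rewrite TCS -subr_ge0.
  rewrite (_ : _ - _ = (sin ph * C x + cos ph * S x) ^+ 2); first exact: sqr_ge0.
  have := cos2Dsin2 ph => h.
  rewrite -[C x ^+ 2 + S x ^+ 2]mul1r -h; ring.
have -> : \sum_(1 <= x < X0) (C x ^+ 2 + S x ^+ 2) =
    \sum_(B <= y1 < 2 * B) \sum_(B <= y2 < 2 * B) b y1 * b y2 * kernel k Y Z X0 c0 y1 y2.
  under eq_bigr => x _.
    have -> : C x ^+ 2 + S x ^+ 2 = \sum_(B <= y1 < 2 * B) \sum_(B <= y2 < 2 * B)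
        b y1 * b y2 * (if I x y1 && I x y2 then cos (c0 * (rt R k y2 - rt R k y1) * rt R k x) else 0).
      rewrite !expr2 {1}/C {1}/S !big_distrl -big_split /=; apply: eq_bigr => y1 _.
      rewrite /C /S !big_distrr -big_split /=; apply: eq_bigr => y2 _.
      case: (I x y1); case: (I x y2); rewrite /= ?(mul0r, mulr0, addr0) //.
      have -> : c0 * (rt R k y2 - rt R k y1) * rt R k x = u x y2 - u x y1.
        by rewrite /u !rtM; ring.
      by rewrite cosB; ring.
    over.
  rewrite exchange_big /=; apply: eq_bigr => y1 _.
  rewrite exchange_big /=; apply: eq_bigr => y2 _.
  by rewrite /kernel big_distrr.
set V := (_ + _ : R).
apply: (@le_trans _ _ (\sum_(B <= y1 < 2 * B) \sum_(B <= y2 < 2 * B)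
    (b y1 ^+ 2 / 2 * `|kernel k Y Z X0 c0 y1 y2| + b y2 ^+ 2 / 2 * `|kernel k Y Z X0 c0 y1 y2|))).
  apply: ler_sum => y1 _; apply: ler_sum => y2 _.
  rewrite -mulrDl; apply: le_trans (ler_norm _) _; rewrite normrM.
  apply: ler_wpM2r => //.
  have h1 : 0 <= (b y1 - b y2) ^+ 2 by exact: sqr_ge0.
  have h2 : 0 <= (b y1 + b y2) ^+ 2 by exact: sqr_ge0.
  rewrite ler_norml; apply/andP; split; nra.
under eq_bigr do rewrite big_split /=.
rewrite big_split /= [X in _ + X]exchange_big /=.
have row : forall y1, (B <= y1 < 2 * B)%N ->
    \sum_(B <= y2 < 2 * B) b y1 ^+ 2 / 2 * `|kernel k Y Z X0 c0 y1 y2| <= b y1 ^+ 2 / 2 * V.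
  move=> y1 y1B; rewrite -big_distrr /=; apply: ler_wpM2l; first by rewrite divr_ge0 // sqr_ge0.
  exact: kernel_row.
have half : \sum_(B <= y1 < 2 * B) b y1 ^+ 2 / 2 * V = (\sum_(B <= y < 2 * B) b y ^+ 2) * V / 2.
  by rewrite -!big_distrl /=; ring.
have e1 : \sum_(B <= y1 < 2 * B) \sum_(B <= y2 < 2 * B) b y1 ^+ 2 / 2 * `|kernel k Y Z X0 c0 y1 y2|
    <= (\sum_(B <= y < 2 * B) b y ^+ 2) * V / 2.
  by rewrite -half; apply: ler_sum_nat => y1; exact: row.
have e2 : \sum_(B <= y2 < 2 * B) \sum_(B <= y1 < 2 * B) b y2 ^+ 2 / 2 * `|kernel k Y Z X0 c0 y1 y2|
    <= (\sum_(B <= y < 2 * B) b y ^+ 2) * V / 2.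
  rewrite -half; apply: ler_sum_nat => y2 y2B; apply: le_trans (row _ y2B).
  by apply: ler_sum => y1 _; rewrite kernelC.
lra.
Qed.

Lemma ln_nat_le (R : realType) n L : (0 < n)%N -> (n <= 2 ^ L)%N -> ln n%:R <= L%:R :> R.
Proof.
move=> n0 nL.
have l2 : ln 2%:R <= 1 :> R.
  by have := @le_ln1Dx R 1; rewrite -[1 + 1]/(2%:R); apply; lra.
apply: (@le_trans _ _ (ln (2 ^ L)%:R)).
  by rewrite ler_ln ?posrE ?ltr0n ?expn_gt0 // ler_nat.
rewrite natrX lnXn // -[leLHS]mulr_natl -[leRHS]mulr1; exact: ler_wpM2l.
Qed.

(** The frequency along [y] is [c0 * rt R k d], and [d * d <= Y] keeps its increments below [pi].
    The gain [sg R k d * rt R k d = d] in the denominator is given away. *)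
Lemma type1 (R : realType) k Y Z d j (c0 ph : R) :
  (1 < k)%N -> (0 < d)%N -> (d * d <= Y)%N -> 0 < c0 <= 2 * pi ->
  `|\sum_(1 <= y < j) win Y Z (fun m => cos (c0 * rt R k m + ph)) (d * y)| <=
    2 + 2 * (k%:R * sg R k Z) / c0.
Proof.
move=> k1 d0 dY /andP[c00 c02]; have k0 : (0 < k)%N by exact: ltnW.
set m := (Y %/ d).+1; set n := minn j (Z %/ d).+1.
have -> : \sum_(1 <= y < j) win Y Z (fun m => cos (c0 * rt R k m + ph)) (d * y) =
    \sum_(m <= y < n) cos (c0 * rt R k d * rt R k y + ph).
  rewrite [RHS](big_nat_widenl _ 1) // (big_nat_widen _ n j) ?geq_minl // [RHS]big_mkcond.
  apply: eq_big_nat => y /andP[y0 yj]; rewrite /win /= /m /n leq_min yj /=.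
  rewrite ltn_divLR // ltnS leq_divRL // [(d * y)%N]mulnC rtM.
  by case: ifP => // _; congr (cos (_ + _)); ring.
have k0R : 0 < k%:R :> R by rewrite ltr0n.
have rd : 0 < rt R k d by exact: rt_gt0.
have sd : 0 < sg R k d by exact: sg_gt0.
have W0 : 0 <= sg R k Z / sg R k d by rewrite divr_ge0 ?sg_ge0.
have dR1 : 1 <= d%:R :> R by rewrite ler1n.
apply: le_trans (root_cos_sum (W := sg R k Z / sg R k d) ph k0 (ltn0Sn _) _ _ _ W0) _.
- by rewrite mulr_gt0.
- have mY : (Y < d * m)%N by rewrite mulnC -ltn_divLR.
  have h : (d * m)%:R <= sg R k (d * m) ^+ 2 by apply: sg_sqr_ge; rewrite // muln_gt0 d0.
  have s0 := sg_ge0 R k (d * m).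
  have h2 : d%:R * d%:R < (d * m)%:R :> R by rewrite -natrM ltr_nat (leq_ltn_trans dY).
  have h3 : d%:R < sg R k (d * m) by rewrite ltNge; apply/negP => h3; nra.
  rewrite -(ltr_pM2r sd) -[ltLHS]mulrA [rt _ _ _ * _]mulrC sg_rt // -[ltRHS]mulrA -[k%:R * _ * _]mulrA.
  rewrite [sg _ _ m * _]mulrC -sgM.
  have pi0 := pi_gt0 R; apply: (@le_lt_trans _ _ (2 * pi * d%:R)); first by apply: ler_wpM2r.
  rewrite [2 * pi]mulrC -[ltLHS]mulrA ltr_pM2l //.
  have : 2 * sg R k (d * m) <= k%:R * sg R k (d * m) by apply: ler_wpM2r => //; rewrite ler_nat.
  move: h3; clear; lra.
- move=> mn; rewrite ler_pdivlMr // -sgM; apply: ler_sg.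
  apply: leq_trans (leq_divM Z d); rewrite leq_mul2r; apply/orP; right.
  by rewrite -ltnS (leq_trans _ (geq_minr j (Z %/ d).+1)) // prednK // (leq_ltn_trans _ mn).
rewrite lerD2l (_ : 2 * _ / _ = 2 * (k%:R * sg R k Z) / c0 / (sg R k d * rt R k d)).
  rewrite sg_rt // ler_pdivrMr ?ltr0n // ler_peMr //.
  by rewrite divr_ge0 ?(ltW c00) // !mulr_ge0 // sg_ge0.
by field; rewrite !gt_eqF.
Qed.

Lemma type1_ln (R : realType) k Y Z d L (c0 ph : R) :
  (1 < k)%N -> (0 < d)%N -> (d * d <= Y)%N -> 0 < c0 <= 2 * pi ->
  `|\sum_(1 <= y < 2 ^ L) ln y%:R * win Y Z (fun m => cos (c0 * rt R k m + ph)) (d * y)| <=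
    2 * L%:R * (2 + 2 * (k%:R * sg R k Z) / c0).
Proof.
move=> k1 d0 dY c0P; have /andP[c00 _] := c0P.
set G := win _ _ _.
pose s i := \sum_(1 <= y < i) G (d * y)%N.
rewrite (eq_big_nat _ _ (F2 := fun i => ln i%:R * (s i.+1 - s i))); last first.
  by move=> i /andP[i1 _]; rewrite /s big_nat_recr //= [X in _ * (X - _)]addrC addrK.
apply: abel_bound.
- move=> i /andP[i1 iL]; rewrite ln_ge0 ?ler1n //=; apply: ln_nat_le => //; exact: ltnW.
- by move=> i i1 _; rewrite ler_ln ?posrE ?ltr0n // ler_nat.
- by move=> i _; exact: type1.
- by [].
- by apply: addr_ge0 => //; rewrite divr_ge0 ?(ltW c00) // !mulr_ge0 // sg_ge0.
Qed.

(** The off-diagonal weight of [kernel_row], of size [Z ^ ((k - 1) / k) / c0] up to a factor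
    depending on [k]. *)
Definition qbound (R : realType) (k Z : nat) (c0 : R) : R :=
  4 * k%:R ^+ 2 * sg R k (2 * Z) / c0.

(** Serves to absorb terms of size [B]: [sg R k (2 * Z)] is at least the square root of [2 * Z], and
    [4 * k ^ 2 >= 16] exceeds [2 * pi]. *)
Lemma qbound_ge (R : realType) k Y Z (c0 : R) B : (1 < k)%N -> (0 < Y < Z)%N ->
  0 < c0 <= 2 * pi -> (B * B <= 2 * Y)%N -> B%:R <= qbound k Z c0.
Proof.
move=> k1 /andP[Y0 YZ] /andP[c00 c02] BY.
have pi4 : pi < 4 :> R by have := pihalf_lt2 R; lra.
have s0 := sg_ge0 R k (2 * Z).
have Bs : B%:R <= sg R k (2 * Z).
  have Z0 : (0 < 2 * Z)%N by rewrite muln_gt0 /= (leq_ltn_trans _ YZ).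
  have h := sg_sqr_ge R k1 Z0.
  have h2 : B%:R * B%:R <= (2 * Z)%:R :> R.
    by rewrite -natrM ler_nat (leq_trans BY) // leq_mul2l ltnW.
  have B0 : 0 <= B%:R :> R by [].
  by rewrite leNgt; apply/negP => h3; nra.
apply: le_trans Bs _; rewrite /qbound ler_pdivlMr // mulrC.
apply: ler_wpM2r => //.
have : 2 ^+ 2 <= k%:R ^+ 2 :> R by rewrite lerXn2r ?nnegrE ?ler_nat.
move: c02 pi4; clear; lra.
Qed.

Lemma sum_sqr_vM (R : realType) L m n : (0 < m)%N -> (n <= 2 ^ L)%N ->
  \sum_(m <= z < n) vM R z ^+ 2 <= (n - m)%:R * L%:R ^+ 2.
Proof.
move=> m0 nW; rewrite mulr_natl -sumr_const_nat; apply: ler_sum_nat => z /andP[mz zn].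
have z0 := leq_trans m0 mz.
rewrite lerXn2r ?nnegrE ?vM_ge0 //; apply: le_trans (vM_le _ z0) _.
by apply: ln_nat_le => //; exact: ltnW (leq_trans zn nW).
Qed.

Lemma sum_sqr_cond (R : realDomainType) (f : nat -> R) (P : pred nat) m n :
  \sum_(m <= i < n) (if P i then f i else 0) ^+ 2 <= \sum_(m <= i < n) f i ^+ 2.
Proof. by apply: ler_sum => i _; case: (P i) => //; rewrite expr0n sqr_ge0. Qed.

(** Two bounds for [A2 * B2] are used side by side: the one with [B / v] against the diagonal
    [Z %/ B], where [B] cancels, and the one with [v ^ 2] against the rest, where [4 * B] is
    absorbed by [qbound]. *)
Lemma piece_le (R : realType) k Y Z L v (c0 S A2 B2 : R) B :
  (1 < k)%N -> (0 < Y < Z)%N -> (Z <= 2 * Y)%N -> 0 < c0 <= 2 * pi ->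
  (0 < B)%N -> (B * B <= 2 * Y)%N -> (0 < L)%N ->
  0 <= A2 -> 0 <= B2 ->
  A2 * B2 <= 4 * Y%:R * L%:R ^+ 3 * (4 * B%:R / v%:R) ->
  A2 * B2 <= 4 * Y%:R * L%:R ^+ 3 * v%:R ^+ 2 ->
  S ^+ 2 <= A2 * (B2 * ((Z %/ B)%:R + 4 * B%:R + qbound k Z c0 * L%:R)) ->
  S ^+ 2 <= 4 * Y%:R * L%:R ^+ 3 * (8 * Y%:R / v%:R + 5 * v%:R ^+ 2 * qbound k Z c0 * L%:R).
Proof.
move=> k1 YZ Z2Y c0P B0 BY L0 A0 B20 h6 h2 h3; apply: le_trans h3 _.
have BR : 0 < B%:R :> R by rewrite ltr0n.
have BQ := qbound_ge k1 YZ c0P BY.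
have Q0 : 0 <= qbound k Z c0 by apply: le_trans BQ.
have L1 : 1 <= L%:R :> R by rewrite ler1n.
have AB0 : 0 <= A2 * B2 by rewrite mulr_ge0.
have h4 : (Z %/ B)%:R * B%:R <= 2 * Y%:R :> R.
  by rewrite -!natrM ler_nat (leq_trans (leq_divM Z B)).
set Q := qbound k Z c0 in BQ Q0 *.
set y : R := Y%:R in h2 h6 h4 *; have y0 : 0 <= y by [].
set l : R := L%:R in h2 h6 L1 *.
have yl0 : 0 <= 4 * y * l ^+ 3 by rewrite mulr_ge0 ?mulr_ge0 // exprn_ge0 // (le_trans ler01).
have h5 : A2 * B2 * (Z %/ B)%:R <= 4 * y * l ^+ 3 * (8 * y / v%:R).
  apply: le_trans (ler_wpM2r _ h6) _ => //.
  rewrite -[X in X <= _]mulrA; apply: ler_wpM2l => //.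
  have vi : 0 <= v%:R^-1 :> R by rewrite invr_ge0.
  have := ler_wpM2r vi h4; move: (v%:R^-1) ((Z %/ B)%:R) => a b; clear; lra.
have h7 : A2 * B2 * (4 * B%:R + Q * l) <= 4 * y * l ^+ 3 * (5 * v%:R ^+ 2 * Q * l).
  apply: (@le_trans _ _ (4 * y * l ^+ 3 * v%:R ^+ 2 * (5 * Q * l))); last first.
    by rewrite le_eqVlt; apply/orP; left; apply/eqP; ring.
  have h8 : Q * 1 <= Q * l by apply: ler_wpM2l.
  apply: ler_pM => //; first by apply: addr_ge0; apply: mulr_ge0 => //; exact: le_trans L1.
  move: h8 BQ; rewrite mulr1 -[5 * Q * l]mulrA; move: (Q * l) => ql; clear; lra.
rewrite mulrA -addrA mulrDr [leRHS]mulrDr; exact: lerD.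
Qed.

Lemma ler_sqr_norm (R : realDomainType) (x d : R) : 0 <= d -> x ^+ 2 <= d ^+ 2 -> `|x| <= d.
Proof.
by move=> d0 h; rewrite -(ler_pXn2r (n := 2)) ?nnegrE // real_normK ?num_real.
Qed.

Lemma win_eq0 (R : pzRingType) Y Z (f : nat -> R) m : (Z < m)%N -> win Y Z f m = 0.
Proof. by move=> h; rewrite /win ifN // negb_and -(ltnNge Z m) h orbT. Qed.

Lemma win_eq0l (R : pzRingType) Y Z (f : nat -> R) m : (m <= Y)%N -> win Y Z f m = 0.
Proof. by move=> h; rewrite /win ifN // negb_and -leqNgt h. Qed.

Lemma sum_cut_le (R : numDomainType) (f : nat -> R) V W (C : R) : 0 <= C ->
  (forall x, (0 < x <= V)%N -> `|f x| <= C) ->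
  `|\sum_(1 <= x < W | (x <= V)%N) f x| <= V%:R * C.
Proof.
move=> C0 H; apply: le_trans (ler_norm_sum _ _ _) _.
apply: (@le_trans _ _ (\sum_(1 <= x < V.+1) C)); last first.
  by rewrite sumr_const_nat subn1 -[leLHS]mulr_natl.
have [VW|WV] := leqP V.+1 W.
  rewrite [leRHS](big_nat_widen _ V.+1 W) // big_mkcond [leRHS]big_mkcond.
  apply: ler_sum_nat => x /andP[x0 _]; rewrite ltnS /=.
  by case: ifP => // xV; apply: H; rewrite x0.
case: (leqP 1 W) => W1; last by rewrite big_geq ?sumr_ge0 // ltnW.
rewrite [leRHS](@big_cat_nat _ _ _ W) ?(ltnW WV) //=.
rewrite -[leLHS]addr0; apply: lerD; last by apply: sumr_ge0.
rewrite big_mkcond; apply: ler_sum_nat => x /andP[x0 _].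
by case: ifP => // xV; apply: H; rewrite x0.
Qed.

(** * Vaughan's identity applied to the cosine sum over a window *)

Section Bilinear.
Variables (R : realType) (k Y Z L v : nat) (c0 ph D : R).
Hypotheses (k1 : (1 < k)%N) (YZ : (0 < Y < Z)%N) (Z2Y : (Z <= 2 * Y)%N)
  (YL : (2 * Y < 2 ^ L)%N) (v0 : (0 < v)%N) (c0P : 0 < c0 <= 2 * pi) (D0 : 0 <= D)
  (DE : 4 * Y%:R * L%:R ^+ 3 * (8 * Y%:R / v%:R + 5 * v%:R ^+ 2 * qbound k Z c0 * L%:R) <= D ^+ 2).
(** A dyadic block [[B, 2 * B)] beyond [V] has [v ^ 2 < 2 * B], and one beyond [U] has
    [v ^ 4 < 2 * B]. In the first case the divisor bound [sqrt (8 * B)], in the second the uniform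
    bound [V], is at most [4 * B / v], as [piece_le] asks. *)
Let V := (v ^ 2)%N.
Let U := (v ^ 4)%N.
Let G := win Y Z (fun m => cos (c0 * rt R k m + ph)).
Let c := vaughan_coef R (2 ^ L) V.

Let L0 : (0 < L)%N.
Proof. by case: (L) YL => //; case/andP: YZ; lia. Qed.

Let Y0 : (0 < Y)%N. Proof. by case/andP: YZ. Qed.

Let V0 : (0 < V)%N. Proof. by rewrite expn_gt0 v0. Qed.

Lemma coef_le_sqrt B b : (B <= b < 2 * B)%N -> (0 < B)%N -> (2 * B <= 2 ^ L)%N ->
  `|c b| <= Num.sqrt (8 * B)%:R.
Proof.
move=> /andP[Bb bB] B0 BL; apply: le_trans (coef_le_ndiv _ _ _ _) _.
have n0 : 0 <= ndiv R (2 ^ L) b by apply: sumr_ge0.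
rewrite -(ger0_norm n0) -sqrtr_sqr ler_wsqrtr //.
apply: le_trans (@ndiv_sqr R _ b _) _; first by rewrite (leq_trans B0) // (leq_trans bB).
by rewrite ler_nat; move: bB; clear; lia.
Qed.

Lemma bilinear_low_piece i : (i < L)%N ->
  `|\sum_(1 <= z < 2 ^ L) (if (U < z)%N then vM R z else 0) *
     \sum_(2 ^ i <= b < 2 ^ i.+1) (if (b * b <= 2 * Y)%N then c b else 0) * G (z * b)%N| <= D.
Proof.
move=> iL; apply: ler_sqr_norm => //; apply: le_trans DE.
have B0 : (0 < 2 ^ i)%N by rewrite expn_gt0.
have BL : (2 * 2 ^ i <= 2 ^ L)%N by rewrite -expnS leq_exp2l.
have BL1 : (2 ^ i <= 2 ^ L)%N by rewrite leq_exp2l // ltnW.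
rewrite expnS; move: (2 ^ i)%N B0 BL BL1 => B B0 BL BL1.
have E0 : 0 <= 4 * Y%:R * L%:R ^+ 3 * (8 * Y%:R / v%:R + 5 * v%:R ^+ 2 * qbound k Z c0 * L%:R).
  have Q0 : 0 <= qbound k Z c0 by apply: le_trans (@qbound_ge R k Y Z c0 0 k1 YZ c0P _).
  apply: mulr_ge0; first by rewrite !mulr_ge0 // exprn_ge0.
  apply: addr_ge0; first by rewrite divr_ge0 // mulr_ge0.
  by do 3 (apply: mulr_ge0 => //); exact: exprn_ge0.
case: (leqP (B * B) (2 * Y)) => BY; last first.
  rewrite big1 ?expr0n // => z _; rewrite big_nat big1 ?mulr0 // => b /andP[Bb _].
  by rewrite ifN ?mul0r // -ltnNge (leq_trans BY) // leq_mul.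
case: (leqP (2 * B) V) => BV.
  rewrite big1 ?expr0n // => z _; rewrite big_nat big1 ?mulr0 // => b /andP[Bb bB].
  rewrite /c coef_small ?if_same ?mul0r // (leq_trans B0 Bb) /=.
  exact: ltnW (leq_trans bB BV).
have ZL : (Z %/ B < 2 ^ L)%N by rewrite (leq_ltn_trans (leq_div _ _)) // (leq_ltn_trans Z2Y).
(* Each of the two bounds under the minimum serves one hypothesis of [piece_le]. *)
set K := Num.min (V%:R : R) (Num.sqrt (8 * B)%:R).
have K0 : 0 <= K by rewrite le_min sqrtr_ge0 ler0n.
have BR : 0 < B%:R :> R by rewrite ltr0n.
have vR : 0 < v%:R :> R by rewrite ltr0n.
set A2 := \sum_(1 <= z < (Z %/ B).+1) (if (U < z)%N then vM R z else 0) ^+ 2.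
set B2 := \sum_(B <= b < 2 * B) (if (b * b <= 2 * Y)%N then c b else 0) ^+ 2.
have A20 : 0 <= A2 by apply: sumr_ge0 => z _; exact: sqr_ge0.
have B20 : 0 <= B2 by apply: sumr_ge0 => z _; exact: sqr_ge0.
have A2le : A2 <= (Z %/ B)%:R * L%:R ^+ 2.
  by apply: le_trans (sum_sqr_cond _ _ _ _) _; have := @sum_sqr_vM R L 1 (Z %/ B).+1 isT ZL; rewrite subn1.
have B2le : B2 <= K * ((2 * B)%:R * L%:R).
  apply: le_trans (sum_sqr_cond _ _ _ _) _; apply: coef_sqr_sum => // b /andP[Bb bB].
  rewrite le_min coef_le_cut //=; first by rewrite coef_le_sqrt ?Bb.
  by rewrite (leq_trans B0 Bb) (leq_trans bB BL).
have AB : A2 * B2 <= 4 * Y%:R * L%:R ^+ 3 * K.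
  apply: le_trans (ler_pM A20 B20 A2le B2le) _.
  rewrite [leLHS](_ : _ = (Z %/ B * B)%:R * (2 * K * L%:R ^+ 3)); last by rewrite !natrM; ring.
  rewrite [leRHS](_ : _ = (2 * Y)%:R * (2 * K * L%:R ^+ 3)); last by rewrite !natrM; ring.
  apply: ler_wpM2r; first by rewrite !mulr_ge0 // exprn_ge0.
  by rewrite ler_nat (leq_trans (leq_divM _ _)).
have yl0 : 0 <= 4 * Y%:R * L%:R ^+ 3 :> R by rewrite !mulr_ge0 // exprn_ge0.
apply: (@piece_le R k Y Z L v c0 _ A2 B2 B) => //.
- apply: le_trans AB _; apply: ler_wpM2l => //.
  apply: (@le_trans _ _ (Num.sqrt (8 * B)%:R)); first by rewrite ge_min lexx orbT.
  have q0 : 0 <= 4 * B%:R / v%:R :> R by rewrite divr_ge0 ?mulr_ge0.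
  rewrite -(ger0_norm q0) -sqrtr_sqr ler_wsqrtr //.
  rewrite exprMn exprVn ler_pdivlMr ?exprn_gt0 //.
  have : v%:R ^+ 2 <= 2 * B%:R :> R by rewrite -natrX -natrM ler_nat ltnW.
  rewrite natrM; move: (v%:R ^+ 2) => w; move: BR; nra.
- apply: le_trans AB _; apply: ler_wpM2l => //.
  by rewrite ge_min /V natrX lexx.
apply: type2 => //.
Qed.

(** The roles are exchanged: [z] is the short variable, and the coefficient [c] sits on the long
    one, where [coef_le_cut] bounds it uniformly by [V]. *)
Lemma bilinear_high_piece i : (i < L)%N ->
  `|\sum_(1 <= b < 2 ^ L) (if (2 * Y < b * b)%N then c b else 0) *
     \sum_(2 ^ i <= z < 2 ^ i.+1) (if (U < z)%N && (z * z <= 2 * Y)%N then vM R z else 0) * G (b * z)%N| <= D.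
Proof.
move=> iL; apply: ler_sqr_norm => //; apply: le_trans DE.
have B0 : (0 < 2 ^ i)%N by rewrite expn_gt0.
have BL : (2 * 2 ^ i <= 2 ^ L)%N by rewrite -expnS leq_exp2l.
have BL1 : (2 ^ i <= 2 ^ L)%N by rewrite leq_exp2l // ltnW.
rewrite expnS; move: (2 ^ i)%N B0 BL BL1 => B B0 BL BL1.
have E0 : 0 <= 4 * Y%:R * L%:R ^+ 3 * (8 * Y%:R / v%:R + 5 * v%:R ^+ 2 * qbound k Z c0 * L%:R).
  have Q0 : 0 <= qbound k Z c0 by apply: le_trans (@qbound_ge R k Y Z c0 0 k1 YZ c0P _).
  apply: mulr_ge0; first by rewrite !mulr_ge0 // exprn_ge0.
  apply: addr_ge0; first by rewrite divr_ge0 // mulr_ge0.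
  by do 3 (apply: mulr_ge0 => //); exact: exprn_ge0.
case: (leqP (B * B) (2 * Y)) => BY; last first.
  rewrite big1 ?expr0n // => z _; rewrite big_nat big1 ?mulr0 // => b /andP[Bb _].
  by rewrite ifN ?mul0r // negb_and -!ltnNge (leq_trans BY) ?orbT // leq_mul.
case: (leqP (2 * B) U) => BU.
  rewrite big1 ?expr0n // => z _; rewrite big_nat big1 ?mulr0 // => b /andP[Bb bB].
  by rewrite ifN ?mul0r // negb_and -leqNgt (ltnW (leq_trans bB BU)).
have ZL : (Z %/ B < 2 ^ L)%N by rewrite (leq_ltn_trans (leq_div _ _)) // (leq_ltn_trans Z2Y).
have BR : 0 < B%:R :> R by rewrite ltr0n.
have vR : 0 < v%:R :> R by rewrite ltr0n.
set A2 := \sum_(1 <= z < (Z %/ B).+1) (if (2 * Y < z * z)%N then c z else 0) ^+ 2.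
set B2 := \sum_(B <= b < 2 * B) (if (U < b)%N && (b * b <= 2 * Y)%N then vM R b else 0) ^+ 2.
have A20 : 0 <= A2 by apply: sumr_ge0 => z _; exact: sqr_ge0.
have B20 : 0 <= B2 by apply: sumr_ge0 => z _; exact: sqr_ge0.
have A2le : A2 <= V%:R * ((Z %/ B).+1%:R * L%:R).
  apply: le_trans (sum_sqr_cond _ _ _ _) _; apply: coef_sqr_sum => // b /andP[b1 bB].
  by apply: coef_le_cut => //; rewrite b1 (leq_trans bB).
have B2le : B2 <= B%:R * L%:R ^+ 2.
  apply: le_trans (sum_sqr_cond _ (fun b => (U < b)%N && (b * b <= 2 * Y)%N) _ _) _.
  by have := @sum_sqr_vM R L B (2 * B) B0 BL; rewrite mul2n -addnn addnK.
have BZ : (B <= Z)%N.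
  case/andP: YZ => _ YZ'; case: (leqP B 1) => B1; first by rewrite (leq_trans B1) // (leq_trans Y0) // ltnW.
  have : (2 * B <= B * B)%N by rewrite leq_mul2r B1 orbT.
  by move/leq_trans/(_ BY); rewrite leq_mul2l /= => h; exact: leq_trans h (ltnW YZ').
have AB : A2 * B2 <= 4 * Y%:R * L%:R ^+ 3 * V%:R.
  apply: le_trans (ler_pM A20 B20 A2le B2le) _.
  rewrite [leLHS](_ : _ = ((Z %/ B).+1 * B)%:R * (V%:R * L%:R ^+ 3)); last by rewrite !natrM; ring.
  rewrite [leRHS](_ : _ = (4 * Y)%:R * (V%:R * L%:R ^+ 3)); last by rewrite !natrM; ring.
  apply: ler_wpM2r; first by rewrite !mulr_ge0 // exprn_ge0.
  rewrite ler_nat mulSn; have := leq_divM Z B; move: BZ Z2Y (Z %/ B * B)%N; clear; lia.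
have yl0 : 0 <= 4 * Y%:R * L%:R ^+ 3 :> R by rewrite !mulr_ge0 // exprn_ge0.
apply: (@piece_le R k Y Z L v c0 _ A2 B2 B) => //.
- apply: le_trans AB _; apply: ler_wpM2l => //.
  rewrite ler_pdivlMr // -!natrM ler_nat.
  have : (v ^ 3 <= v ^ 4)%N by rewrite leq_pexp2l.
  rewrite /V -expnSr; move: BU; rewrite /U; clear; lia.
- by apply: le_trans AB _; apply: ler_wpM2l => //; rewrite /V natrX.
by apply: type2.
Qed.

(* The factor not exceeding [sqrt (2 * Y)] is the one that is cut dyadically. *)
Lemma bilinear_le :
  `|\sum_(1 <= z < 2 ^ L | (U < z)%N) vM R z * \sum_(1 <= b < 2 ^ L) c b * G (z * b)%N|
    <= 2 * L%:R * D.
Proof.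
have -> : \sum_(1 <= z < 2 ^ L | (U < z)%N) vM R z * \sum_(1 <= b < 2 ^ L) c b * G (z * b)%N =
  \sum_(i < L) \sum_(1 <= z < 2 ^ L) (if (U < z)%N then vM R z else 0) *
     \sum_(2 ^ i <= b < 2 ^ i.+1) (if (b * b <= 2 * Y)%N then c b else 0) * G (z * b)%N
  + \sum_(i < L) \sum_(1 <= b < 2 ^ L) (if (2 * Y < b * b)%N then c b else 0) *
     \sum_(2 ^ i <= z < 2 ^ i.+1) (if (U < z)%N && (z * z <= 2 * Y)%N then vM R z else 0) * G (b * z)%N.
  rewrite [X in _ = X + _]exchange_big /= [X in _ = _ + X]exchange_big /=.
  under [X in _ = X + _]eq_bigr do rewrite -big_distrr -sum_dyadic.
  under [X in _ = _ + X]eq_bigr do rewrite -big_distrr -sum_dyadic.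
  under [X in _ = _ + X]eq_bigr do rewrite big_distrr /=.
  rewrite [X in _ = _ + X]exchange_big /= -big_split big_mkcond /=.
  apply: eq_bigr => z _; case: (ltnP U z) => Uz; last first.
    by rewrite mul0r big1 ?addr0 // => b _; rewrite mul0r mulr0.
  rewrite !big_distrr -big_split /=; apply: eq_bigr => b _.
  case: (leqP (b * b) (2 * Y)) => bY; first by rewrite mul0r addr0.
  rewrite mul0r mulr0 add0r [(b * z)%N]mulnC; case: (leqP (z * z) (2 * Y)) => zY.
    by ring.
  rewrite /G win_eq0 ?mulr0 //; apply: leq_ltn_trans Z2Y _.
  rewrite ltnNge; apply/negP => zb.
  have h1 : ((z * b) * (z * b) <= (2 * Y) * (2 * Y))%N by rewrite leq_mul.
  have h2 : ((2 * Y) * (2 * Y) < (z * z) * (b * b))%N by rewrite ltn_mul.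
  by move: h2; rewrite [((z * z) * (b * b))%N]mulnACA ltnNge h1.
apply: le_trans (ler_normD _ _) _.
rewrite (_ : 2 * L%:R * D = \sum_(i < L) D + \sum_(i < L) D); last first.
  by rewrite sumr_const card_ord -[D *+ L]mulr_natl; ring.
apply: lerD; apply: le_trans (ler_norm_sum _ _ _) _; apply: ler_sum => i _.
  exact: bilinear_low_piece.
exact: bilinear_high_piece.
Qed.

(** The terms [n <= U] lie below the window. The type I sums have moduli up to [V * U = v ^ 6],
    whose square must not exceed [Y], and each inner sum is at most [3 * Q]. *)
Lemma vM_cos_sum_le : (v ^ 12 <= Y)%N ->
  `|\sum_(1 <= n < 2 ^ L) vM R n * G n| <=
    9 * v%:R ^+ 6 * L%:R * qbound k Z c0 + 2 * L%:R * D.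
Proof.
move=> vY; have GW m : (2 ^ L <= m)%N -> G m = 0.
  by move=> h; rewrite /G win_eq0 // (leq_trans _ h) // (leq_ltn_trans Z2Y).
rewrite (vaughan U V GW).
have UV2 : ((V * U) * (V * U) <= Y)%N by rewrite /V /U -!expnD.
have UV : (V * U <= Y)%N by apply: leq_trans UV2; rewrite leq_pmulr // muln_gt0 !expn_gt0 v0.
have UY : (U <= Y)%N by apply: leq_trans UV; rewrite leq_pmull.
rewrite [X in X + _ - _ + _]big1 ?add0r; last first.
  by move=> n nU; rewrite /G win_eq0l ?mulr0 // (leq_trans nU).
set Q := qbound k Z c0.
have Q1 : 1 <= Q.
  by have := @qbound_ge R k Y Z c0 1 k1 YZ c0P; apply; rewrite muln1 muln_gt0 Y0.
have /andP[c00 _] := c0P.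
have q3 : 2 + 2 * (k%:R * sg R k Z) / c0 <= 3 * Q.
  suff : 2 * (k%:R * sg R k Z) / c0 <= Q by move: Q1; lra.
  rewrite /Q /qbound; apply: ler_wpM2r; first by rewrite invr_ge0 ltW.
  rewrite mulrA; apply: ler_pM; rewrite ?mulr_ge0 ?sg_ge0 //; last by rewrite ler_sg ?leq_pmull.
  have : 1 <= k%:R :> R by rewrite ler1n ltnW.
  nra.
have Q0 : 0 <= Q by apply: le_trans Q1.
have n3 (a b d : R) : `|a - b + d| <= `|a| + `|b| + `|d|.
  by apply: le_trans (ler_normD _ _) _; rewrite lerD2r; exact: ler_normB.
apply: le_trans (n3 _ _ _) _; apply: lerD; last exact: bilinear_le.
have V1 : 1 <= v%:R :> R by rewrite ler1n.
have Lr : 0 <= L%:R :> R by [].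
have t2 : `|\sum_(1 <= x < 2 ^ L | (x <= V)%N) mu R x * \sum_(1 <= n < 2 ^ L) ln n%:R * G (x * n)%N|
    <= V%:R * (2 * L%:R * (3 * Q)).
  apply: sum_cut_le; first by do 3 (apply: mulr_ge0 => //).
  move=> x /andP[x0 xV]; rewrite normrM -[leRHS]mul1r; apply: ler_pM => //.
    exact: norm_mu_le1.
  apply: le_trans (type1_ln _ _ _ k1 x0 _ c0P) _.
    by apply: leq_trans UV2; apply: leq_mul; rewrite (leq_trans xV) // leq_pmulr // expn_gt0 v0.
  by apply: ler_wpM2l => //; rewrite mulr_ge0.
have t3 : `|\sum_(1 <= x < 2 ^ L | (x <= V)%N) \sum_(1 <= z < 2 ^ L | (z <= U)%N)
      mu R x * vM R z * (\sum_(1 <= y < 2 ^ L) G (x * z * y)%N)| <= V%:R * (U%:R * (L%:R * (3 * Q))).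
  apply: sum_cut_le; first by do 3 (apply: mulr_ge0 => //).
  move=> x /andP[x0 xV]; apply: sum_cut_le; first by do 3 (apply: mulr_ge0 => //).
  move=> z /andP[z0 zU]; rewrite normrM; apply: ler_pM => //.
    rewrite normrM -[leRHS]mul1r; apply: ler_pM => //; first exact: norm_mu_le1.
    rewrite ger0_norm ?vM_ge0 //; apply: le_trans (vM_le _ z0) _; apply: ln_nat_le => //.
    have := leq_trans zU UY; move: YL; clear; lia.
  apply: le_trans (type1 _ _ _ k1 _ _ c0P) q3; first by rewrite muln_gt0 x0.
  by apply: leq_trans UV2; apply: leq_mul; apply: leq_mul.
apply: le_trans (lerD t2 t3) _; rewrite /V /U !natrX.
have e : v%:R ^+ 2 <= v%:R ^+ 6 :> R by rewrite ler_weXn2l.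
have LQ : 0 <= L%:R * Q by rewrite mulr_ge0.
have := ler_wpM2r LQ e.
have -> : v%:R ^+ 2 * (2 * L%:R * (3 * Q)) = 6 * (v%:R ^+ 2 * (L%:R * Q)) by ring.
have -> : v%:R ^+ 2 * (v%:R ^+ 4 * (L%:R * (3 * Q))) = 3 * (v%:R ^+ 6 * (L%:R * Q)) by ring.
have -> : 9 * v%:R ^+ 6 * L%:R * Q = 9 * (v%:R ^+ 6 * (L%:R * Q)) by ring.
move: (v%:R ^+ 2 * (L%:R * Q)) (v%:R ^+ 6 * (L%:R * Q)) => a b; lra.
Qed.
End Bilinear.

(** * Integer parts of roots of primes modulo q *)

Lemma rt_expn (R : realType) k m : (0 < k)%N -> rt R k (m ^ k) = m%:R.
Proof.
move=> k0; apply/eqP; rewrite -(eqrXn2 k0) ?rt_ge0 // rtX // natrX //.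
Qed.

Lemma sg_le_div (R : realType) k M m : (0 < k)%N -> (0 < M)%N -> (M ^ k <= m)%N ->
  sg R k m <= m%:R / M%:R.
Proof.
move=> k0 M0 Mm; rewrite ler_pdivlMr ?ltr0n // -(@sg_rt R k m k0).
by apply: ler_wpM2l; [exact: sg_ge0|rewrite -(rt_expn R M k0); exact: ler_rt].
Qed.

(** The choice [v = T ^ w] balances the two error terms: [Y / v] is small because [w >= 21], while
    the powers of [v] multiplying [qbound] stay within the saving [T ^ K], as [12 * w <= K]. *)
Lemma window_sum (R : realType) k C N w K T Y Z (c0 ph : R) :
  (1 < k)%N -> (C + (2 + K) <= N)%N -> (21 <= w)%N -> (12 * w <= K)%N -> (64 <= T)%N -> (16 * k ^ 2 <= T)%N ->
  (T ^ (k * N) <= Y)%N -> (Y < Z <= 2 * Y)%N -> (2 * Y < 2 ^ T)%N ->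
  (T ^ C)%:R^-1 <= c0 <= 2 * pi ->
  `|\sum_(1 <= n < 2 ^ T) vM R n * win Y Z (fun m => cos (c0 * rt R k m + ph)) n| <=
    Y%:R / T%:R ^+ 5.
Proof.
move=> k1 NC w21 wK T64 Tk TY /andP[YZ Z2Y] YT /andP[c0l c02].
have T0 : (0 < T)%N by exact: leq_trans T64.
have Y0 : (0 < Y)%N by apply: leq_trans TY; rewrite expn_gt0 T0.
have TR : 0 < T%:R :> R by rewrite ltr0n.
have c00 : 0 < c0 by apply: lt_le_trans c0l; rewrite invr_gt0 ltr0n expn_gt0 T0.
have YZ' : (0 < Y < Z)%N by rewrite Y0.
have c0P : 0 < c0 <= 2 * pi by rewrite c00.
have v0 : (0 < T ^ w)%N by rewrite expn_gt0 T0.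
set Q := qbound k Z c0.
set t : R := T%:R in TR *; set y : R := Y%:R.
have t64 : 64 <= t by rewrite /t ler_nat.
have t1 : 1 <= t by rewrite /t ler1n.
have y0 : 0 < y by rewrite /y ltr0n.
have Q0 : 0 <= Q by apply: le_trans (@qbound_ge R k Y Z c0 0 k1 YZ' c0P _).
(* [T ^ N] is at most the root of [2 * Z], so [sg R k (2 * Z)] saves [T ^ N] over [2 * Z]. The
   factor [1 / c0] takes back [T ^ C], the constant [16 * k ^ 2] at most [T ^ 2], and [T ^ K]
   remains. *)
have Qle : Q * t ^+ K <= y.
  have s1 : sg R k (2 * Z) <= (2 * Z)%:R / (T ^ N)%:R.
    apply: sg_le_div; [exact: ltnW|by rewrite expn_gt0 T0|].
    rewrite -expnM mulnC (leq_trans TY) // (leq_trans (ltnW YZ)) // leq_pmull //.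
  have c1 : c0^-1 <= (T ^ C)%:R.
    by rewrite -[leRHS]invrK lef_pV2 ?posrE // invr_gt0 ltr0n expn_gt0 T0.
  have Z4 : (2 * Z)%:R <= 4 * y by rewrite /y -natrM ler_nat; move: Z2Y; clear; lia.
  have tC0 : 0 < t ^+ C by rewrite exprn_gt0.
  have tN0 : 0 < t ^+ N by rewrite exprn_gt0.
  have h : Q <= 4 * k%:R ^+ 2 * (4 * y / t ^+ N) * t ^+ C.
    rewrite /Q /qbound; apply: ler_pM.
    - by rewrite !mulr_ge0 ?sg_ge0 // exprn_ge0.
    - by rewrite invr_ge0 ltW.
    - apply: ler_wpM2l; first by rewrite mulr_ge0 // exprn_ge0.
      apply: le_trans s1 _; rewrite natrX; apply: ler_wpM2r => //.
      by rewrite invr_ge0 ltW.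
    - by rewrite natrX in c1.
  have k16 : 16 * k%:R ^+ 2 <= t ^+ 2.
    have h1 : 16 * k%:R ^+ 2 <= t by rewrite /t -natrX -natrM ler_nat.
    have h2 : t <= t ^+ 2 by rewrite expr2 ler_peMr //; lra.
    exact: le_trans h2.
  have NC' : (2 + (C + K) <= N)%N by rewrite addnCA.
  have tt : t ^+ 2 * (t ^+ C * t ^+ K) <= t ^+ N by rewrite -!exprD; exact: ler_weXn2l.
  rewrite -(ler_pM2r tN0).
  have tK0 : 0 <= t ^+ K by rewrite exprn_ge0 // ltW.
  apply: (@le_trans _ _ (4 * k%:R ^+ 2 * (4 * y / t ^+ N) * t ^+ C * t ^+ K * t ^+ N)).
    by apply: ler_wpM2r; [exact: ltW|apply: ler_wpM2r].
  rewrite (_ : _ * _ = 16 * k%:R ^+ 2 * (t ^+ C * t ^+ K * y)); last first.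
    by move: (t ^+ K) (t ^+ C) (t ^+ N) tN0 => a1 a2 a3 a30; field; rewrite gt_eqF.
  apply: (@le_trans _ _ (t ^+ 2 * (t ^+ C * t ^+ K * y))).
    by apply: ler_wpM2r => //; apply: mulr_ge0; [apply: mulr_ge0|]; rewrite ?(ltW tC0) ?(ltW y0).
  have := ler_wpM2l (ltW y0) tt.
  by move: (t ^+ 2) (t ^+ C) (t ^+ K) (t ^+ N) => a1 a2 a3 a4; lra.
(* With [v] at least [t ^ 21] the left side of [DE] is at most [4 * 13 * y ^ 2 / t ^ 18], and
   [52 <= t ^ 4]. *)
pose D := y / t ^+ 7.
have D0 : 0 <= D by rewrite divr_ge0 ?exprn_ge0 ?ltW.
have pw i : 0 < t ^+ i by rewrite exprn_gt0.
have Qt i j : (i + j <= K)%N -> Q * t ^+ i <= y / t ^+ j.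
  move=> ij; rewrite ler_pdivlMr // -mulrA -exprD.
  by apply: le_trans Qle; apply: ler_wpM2l => //; rewrite ler_weXn2l.
have DE : 4 * y * t ^+ 3 * (8 * y / (T ^ w)%:R + 5 * (T ^ w)%:R ^+ 2 * Q * t) <= D ^+ 2.
  rewrite natrX -/t.
  have e1 : 5 * (t ^+ w) ^+ 2 * Q * t = 5 * (Q * t ^+ (2 * w).+1).
    by rewrite [t ^+ (2 * w).+1]exprS [(2 * w)%N]mulnC exprM; move: (t ^+ w) => a1; ring.
  have e2 : Q * t ^+ (2 * w).+1 <= y / t ^+ 21.
    by apply: Qt; move: w21 wK; clear; lia.
  have e3 : 8 * y / t ^+ w <= 8 * (y / t ^+ 21).
    rewrite -mulrA; apply: ler_wpM2l => //; apply: ler_wpM2l; first exact: ltW.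
    by rewrite lef_pV2 ?posrE // ler_weXn2l.
  apply: (@le_trans _ _ (4 * y * t ^+ 3 * (13 * (y / t ^+ 21)))).
    apply: ler_wpM2l; first by rewrite !mulr_ge0 ?ltW.
    rewrite e1; move: e2 e3; clear; lra.
  have -> : 4 * y * t ^+ 3 * (13 * (y / t ^+ 21)) = (52 * y ^+ 2 / t ^+ 18).
    by move: TR; clear; move=> ?; field; rewrite gt_eqF.
  have -> : D ^+ 2 = t ^+ 4 * y ^+ 2 / t ^+ 18 by rewrite /D; field; rewrite gt_eqF.
  apply: ler_wpM2r; first by rewrite invr_ge0 ltW.
  apply: ler_wpM2r; first by rewrite exprn_ge0 ?ltW.
  have : t * 1 <= t * t ^+ 3 by apply: ler_wpM2l; [exact: ltW|rewrite exprn_ege1 //; lra].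
  rewrite -exprS; lra.
have := vM_cos_sum_le ph k1 YZ' Z2Y YT v0 c0P D0 DE.
have vY : ((T ^ w) ^ 12 <= Y)%N.
  rewrite -expnM (leq_trans _ TY) // leq_pexp2l // mulnC.
  have : (2 * N <= k * N)%N by rewrite leq_mul2r k1 orbT.
  by apply: leq_trans; move: NC wK; clear; lia.
move=> /(_ vY) /le_trans; apply; rewrite natrX -/t -/Q.
have e3 : 9 * (t ^+ w) ^+ 6 * t * Q = 9 * (Q * t ^+ (6 * w).+1).
  by rewrite [t ^+ (6 * w).+1]exprS [(6 * w)%N]mulnC exprM; move: (t ^+ w) => a1; ring.
have e4 : Q * t ^+ (6 * w).+1 <= y / t ^+ 6.
  by apply: Qt; move: w21 wK; clear; lia.
have e5 : 2 * t * D = 2 * (y / t ^+ 6) by rewrite /D; field; rewrite gt_eqF.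
have e6 : y / t ^+ 5 = t * (y / t ^+ 6) by field; rewrite gt_eqF.
have e7 : 0 <= y / t ^+ 6 by rewrite divr_ge0 ?exprn_ge0 ?ltW.
have := ler_wpM2r e7 t64.
rewrite e3 e5 e6; lra.
Qed.

(** The ratio [Z / Y] is not bounded, so the interval is cut into at most [T] windows with
    [Z' <= 2 * Y'], at the price of one factor [T]. *)
Lemma interval_sum (R : realType) k C N w K T X Y Z (c0 ph : R) :
  (1 < k)%N -> (C + (2 + K) <= N)%N -> (21 <= w)%N -> (12 * w <= K)%N -> (64 <= T)%N -> (16 * k ^ 2 <= T)%N ->
  (T ^ (k * N) <= Y)%N -> (Z <= X)%N -> (2 * X < 2 ^ T)%N ->
  (T ^ C)%:R^-1 <= c0 <= 2 * pi ->
  `|\sum_(Y.+1 <= n < Z.+1) vM R n * cos (c0 * rt R k n + ph)| <= X%:R / T%:R ^+ 4.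
Proof.
move=> k1 NC w21 wK T64 Tk TY ZX XT c0P.
have T0 : (0 < T)%N by exact: leq_trans T64.
have TR : 0 < T%:R :> R by rewrite ltr0n.
set f := fun n => vM R n * cos (c0 * rt R k n + ph).
have piece Y' Z' : (T ^ (k * N) <= Y')%N -> (Z' <= 2 * Y')%N -> (Z' <= X)%N ->
    `|\sum_(Y'.+1 <= n < Z'.+1) f n| <= X%:R / T%:R ^+ 5.
  move=> TY' Z2 Z'X; case: (leqP Z' Y') => YZ'.
    by rewrite big_geq // normr0 divr_ge0 ?exprn_ge0.
  have YX : (2 * Y' < 2 ^ T)%N by rewrite (leq_ltn_trans _ XT) // leq_mul2l (leq_trans (ltnW YZ')).
  have /andP YZ2 : (Y' < Z')%N && (Z' <= 2 * Y')%N by rewrite YZ'.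
  have := window_sum ph k1 NC w21 wK T64 Tk TY' (introT andP YZ2) YX c0P.
  have -> : \sum_(1 <= n < 2 ^ T) vM R n * win Y' Z' (fun m => cos (c0 * rt R k m + ph)) n =
      \sum_(Y'.+1 <= n < Z'.+1) f n.
    rewrite [RHS](big_nat_widenl _ 1) // [RHS](big_nat_widen _ _ (2 ^ T)); last first.
      by apply: leq_trans XT; rewrite ltnS (leq_trans Z'X) // leq_pmull.
    rewrite [RHS]big_mkcond; apply: eq_big_nat => n _.
    by rewrite /win /= ltnS /f; case: ifP; rewrite ?mulr0.
  move/le_trans; apply; apply: ler_wpM2r; first by rewrite invr_ge0 exprn_ge0.
  by rewrite ler_nat (leq_trans (ltnW YZ')).
have chain i : forall Y', (T ^ (k * N) <= Y')%N -> (Z <= 2 ^ i * Y')%N ->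
    `|\sum_(Y'.+1 <= n < Z.+1) f n| <= i%:R * (X%:R / T%:R ^+ 5).
  elim: i => [|i IH] Y' TY' Zle.
    by rewrite big_geq ?normr0 ?mul0r // ltnS -(mul1n Y').
  rewrite -natr1 mulrDl mul1r addrC.
  case: (leqP Z (2 * Y')) => ZY.
    apply: le_trans (piece _ _ TY' ZY ZX) _; rewrite lerDl.
    by rewrite mulr_ge0 // divr_ge0 ?exprn_ge0.
  have Y2 : (Y' <= 2 * Y')%N by rewrite leq_pmull.
  rewrite (@big_cat_nat _ _ _ (2 * Y').+1) //=; last by rewrite ltnS ltnW.
  apply: le_trans (ler_normD _ _) _; apply: lerD.
    by apply: piece => //; rewrite (leq_trans (ltnW ZY)).
  by apply: IH; [exact: leq_trans Y2|rewrite mulnA -expnSr].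
have := chain T Y TY.
have Y0 : (0 < Y)%N by apply: leq_trans TY; rewrite expn_gt0 T0.
have ZT : (Z <= 2 ^ T * Y)%N.
  apply: leq_trans ZX _; apply: (@leq_trans (2 ^ T)); last by rewrite leq_pmulr.
  by apply: ltnW; apply: leq_ltn_trans XT; rewrite leq_pmull.
move/(_ ZT)/le_trans; apply.
by rewrite le_eqVlt; apply/orP; left; apply/eqP; field; rewrite gt_eqF.
Qed.

(* A trigonometric polynomial of mean zero, yet at least 1/2 on half of the circle. *)
Definition bias (R : realType) (x : R) : R := sin (2 * pi * x) + cos (2 * (2 * pi * x)) / 2.

(** With [s] the sine, which lies in [[0, 1]] on this half circle, the value is
    [1 / 2 + s - s ^ 2]. *)
Lemma bias_ge_half (R : realType) (x : R) (m : nat) :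
  m%:R <= x < m%:R + 1 / 2 -> 1 / 2 <= bias x.
Proof.
move=> /andP[mx xm]; rewrite /bias; have pi0 := pi_gt0 R.
have -> : 2 * pi * x = 2 * pi * (x - m%:R) + pi *+ 2 *+ m.
  by rewrite -[_ *+ m]mulr_natr -mulr_natr; ring.
set u := 2 * pi * (x - m%:R).
rewrite (periodicn (@sinD2pi R)).
have -> : cos (2 * (u + pi *+ 2 *+ m)) = cos (u *+ 2).
  have -> : 2 * (u + pi *+ 2 *+ m) = u *+ 2 + pi *+ 2 *+ (2 * m).
    by rewrite -[pi *+ 2 *+ (2 * m)]mulr_natr natrM -[pi *+ 2 *+ m]mulr_natr -[u *+ 2]mulr_natr; ring.
  by rewrite (periodicn (@cosD2pi R)).
rewrite cos_mulr2n.
have s0 : 0 <= sin u by apply: sin_ge0_pi; rewrite /u; apply/andP; split; nra.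
have s1 := sin_le1 u.
have := cos2Dsin2 u; move: (cos u) (sin u) s0 s1 => c s s0 s1 e.
have : s ^+ 2 <= s by rewrite expr2 ler_piMr.
rewrite -[c ^+ 2 *+ 2]mulr_natr; lra.
Qed.

Lemma bias_norm (R : realType) (x : R) : `|bias x| <= 3 / 2.
Proof.
rewrite /bias; have := sin_max (2 * pi * x); have := cos_max (2 * (2 * pi * x)).
rewrite !ler_norml => /andP[h1 h2] /andP[h3 h4]; apply/andP; split; lra.
Qed.

Lemma bias_cos (R : realType) (x : R) (q : R) : q != 0 ->
  bias (x / q) = cos (2 * pi / q * x + - (pi / 2)) + cos (4 * pi / q * x + 0) / 2.
Proof.
move=> q0; rewrite /bias cosBpihalf addr0; congr (sin _ + cos _ / _).
  by rewrite -!mulrA [_^-1 * x]mulrC.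
by ring.
Qed.

Lemma floor_root_rt (R : realType) k x : (0 < k)%N ->
  (floor_root k x)%:R <= rt R k x < (floor_root k x)%:R + 1.
Proof.
move=> k0; have [h1 h2] := floor_rootP x k0; apply/andP; split.
  by rewrite -(rt_expn R _ k0) ler_rt.
rewrite natr1 -(ltr_pXn2r k0) ?nnegrE ?rt_ge0 //.
by rewrite rtX // -natrX ltr_nat.
Qed.

(** What remains are powers [p ^ i] with [i >= 2], so [p] is at most the square root of [X], [i] is
    below [T], and each weight is at most [T]. *)
Lemma sum_vM_nonprime (R : realType) T X Y : (X < 2 ^ T)%N ->
  \sum_(Y.+1 <= n < X.+1 | ~~ prime n) vM R n <= T%:R * (floor_root 2 X * T)%:R.
Proof.
move=> XT; set s := floor_root 2 X.
rewrite (bigID (fun n => vM R n == 0)) /= big1 ?add0r; last by move=> n /andP[_ /eqP].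
rewrite -big_filter.
set l := [seq i <- _ | _].
have ln n : n \in l -> [/\ ~~ prime n, vM R n != 0, (0 < n)%N & (n <= X)%N].
  by rewrite mem_filter mem_index_iota ltnS => /andP[/andP[-> ->] /andP[Yn ->]]; rewrite (leq_ltn_trans _ Yn).
apply: (@le_trans _ _ (\sum_(n <- l) T%:R)).
  rewrite big_seq [leRHS]big_seq; apply: ler_sum => n /ln[_ _ n0 nX].
  by apply: le_trans (vM_le _ n0) _; apply: ln_nat_le => //; rewrite (leq_trans nX) // ltnW.
rewrite big_const_seq count_predT iter_addr_0 -[leLHS]mulr_natr.
apply: ler_wpM2l => //; rewrite ler_nat.
have -> : (s * T)%N = size [seq (p ^ i)%N | p <- iota 1 s, i <- iota 0 T].
  by rewrite size_allpairs !size_iota.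
apply: uniq_leq_size; first by rewrite filter_uniq // iota_uniq.
move=> n /ln[np /vM_neq0P[p [i [pp en _]]] n0 nX].
apply/allpairsP; exists (p, i.+1); rewrite /= !mem_iota add0n; split=> //.
  rewrite prime_gt0 //= add1n ltnS leq_floor_root //.
  apply: leq_trans nX; rewrite en leq_exp2l; last exact: prime_gt1.
  by case: i en => [|i] en //; move: np; rewrite en expn1 pp.
rewrite /= -(ltn_exp2l _ _ (ltnSn 1)); apply: leq_ltn_trans XT.
by apply: leq_trans nX; rewrite en leq_exp2r // prime_gt1.
Qed.

(** The sum of [bias (rt R k p / q)] over the primes of the block, weighted by [ln p], would be
    about [n1 / 4] or more, whereas [interval_sum] allows only [3 / 2 * X / T ^ 4] with [X = n * T],
    apart from prime powers. *)
Lemma many_nondivisible (R : realType) k C N w K e T n n1 q :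
  (1 < k)%N -> (C + (2 + K) <= N)%N -> (21 <= w)%N -> (12 * w <= K)%N ->
  (64 <= T)%N -> (16 * k ^ 2 <= T)%N -> (80 * e <= T)%N ->
  (T ^ (k * N) <= n)%N -> (n <= 4 * e * n1)%N ->
  (nth_prime (n + n1) <= n * T)%N -> (2 * (n * T) < 2 ^ T)%N ->
  (1 < q)%N -> (q <= T ^ C)%N ->
  (T ^ C <= count (fun j => ~~ (q %| floor_root k (nth_prime j)))%N (iota n.+1 n1))%N.
Proof.
move=> k1 NC w21 wK T64 Tk Te Tn ne pX XT q1 qC; rewrite leqNgt; apply/negP => cnt.
have k0 : (0 < k)%N by exact: ltnW.
have T0 : (0 < T)%N by exact: leq_trans T64.
set t : R := T%:R; have t64 : 64 <= t by rewrite /t ler_nat.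
have tR : 0 < t by rewrite /t ltr0n.
have qR : 0 < q%:R :> R by rewrite ltr0n ltnW.
have q2 : 2 <= q%:R :> R by rewrite ler_nat.
have qn0 : q%:R != 0 :> R by rewrite gt_eqF.
have pi0 := pi_gt0 R; have pi2 := pi_ge2 R.
set X := (n * T)%N in pX XT.
set Y := nth_prime n; set Z := nth_prime (n + n1) in pX.
have YZ : (Y <= Z)%N by apply: leq_nth_prime; rewrite leq_addr.
have TY : (T ^ (k * N) <= Y)%N by apply: leq_trans Tn (nth_prime_ge n).
have qinv : (T ^ C)%:R^-1 <= q%:R^-1 :> R.
  have TC0 : (0 < T ^ C)%N by rewrite expn_gt0 T0.
  by rewrite lef_pV2 ?posrE ?ltr0n ?(ltnW q1) ?TC0 ?ler_nat.
have qi0 : 0 < q%:R^-1 :> R by rewrite invr_gt0.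
have qi2 : q%:R^-1 <= 1 / 2 :> R by rewrite div1r lef_pV2 ?posrE.
have r1 : q%:R^-1 <= pi * q%:R^-1 :> R by apply: ler_peMl; [exact: ltW|exact: le_trans (ler1n R 2) pi2].
have r2 : pi * q%:R^-1 <= pi * (1 / 2) :> R by apply: ler_wpM2l; [exact: ltW|exact: qi2].
(* The two frequencies of [bias (x / q)] are admissible because [2 <= q <= T ^ C]. *)
have c1P : (T ^ C)%:R^-1 <= (2 * pi / q%:R : R) <= 2 * pi.
  move: qinv r1 r2 pi0 qi0; rewrite -!mulrA; move: (pi * q%:R^-1 : R) (q%:R^-1 : R) ((T ^ C)%:R^-1 : R) (pi : R) => a1 a2 a3 a4; clear.
  by move=> *; apply/andP; split; lra.
have c2P : (T ^ C)%:R^-1 <= (4 * pi / q%:R : R) <= 2 * pi.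
  move: qinv r1 r2 pi0 qi0; rewrite -!mulrA; move: (pi * q%:R^-1 : R) (q%:R^-1 : R) ((T ^ C)%:R^-1 : R) (pi : R) => a1 a2 a3 a4; clear.
  by move=> *; apply/andP; split; lra.
have S1 := interval_sum (- (pi / 2)) k1 NC w21 wK T64 Tk TY pX XT c1P.
have S2 := interval_sum 0 k1 NC w21 wK T64 Tk TY pX XT c2P.
pose F m := vM R m * bias (rt R k m / q%:R).
have SF : \sum_(Y.+1 <= m < Z.+1) F m <= 3 / 2 * (X%:R / t ^+ 4).
  rewrite (eq_bigr (fun m => vM R m * cos (2 * pi / q%:R * rt R k m + - (pi / 2)) +
     vM R m * cos (4 * pi / q%:R * rt R k m + 0) * 2^-1)); last first.
    by move=> m _; rewrite /F bias_cos // mulrDr mulrA.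
  rewrite big_split /= -big_distrl /=.
  have := le_trans (ler_norm _) S1; have := le_trans (ler_norm _) S2; rewrite -/t; lra.
rewrite (bigID prime) /= in SF.
have NP : - (3 / 2 * (t * (floor_root 2 X * T)%:R)) <= \sum_(Y.+1 <= m < Z.+1 | ~~ prime m) F m.
  have XT' : (Z < 2 ^ T)%N.
    by apply: leq_ltn_trans XT; apply: leq_trans pX _; rewrite leq_pmull.
  have h := @sum_vM_nonprime R T Z Y XT'.
  have h2 : T%:R * (floor_root 2 Z * T)%:R <= t * (floor_root 2 X * T)%:R.
    apply: ler_wpM2l => //; rewrite ler_nat leq_mul2r leq_floor_root //.
    by apply/orP; right; apply: leq_trans pX; have [] := floor_rootP Z (ltn0Sn 1).
  rewrite -(opprK (\sum_(_ <= _ < _ | _) _)) lerN2 -sumrN.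
  apply: (@le_trans _ _ (\sum_(Y.+1 <= m < Z.+1 | ~~ prime m) 3 / 2 * vM R m)); last first.
    by rewrite -big_distrr /=; lra.
  apply: ler_sum => m _; rewrite /F -mulrN mulrC; apply: ler_wpM2r; first exact: vM_ge0.
  by have := bias_norm (rt R k m / q%:R); rewrite ler_norml => /andP[? ?]; lra.
(* A divisible value contributes at least [ln p / 2 >= 1 / 4], any other at least
   [- 3 / 2 * t >= 1 / 4 - 2 * t]. *)
have PR : n1%:R / 4 - 2 * t * (count (fun j => ~~ (q %| floor_root k (nth_prime j)))%N (iota n.+1 n1))%:R
    <= \sum_(Y.+1 <= m < Z.+1 | prime m) F m.
  rewrite -big_filter /index_iota subSS (perm_big _ (primes_between n n1)) /= big_map.
  rewrite -sum1_count natr_sum big_distrr /= big_mkcond /=.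
  have -> : n1%:R / 4 = \sum_(j <- iota n.+1 n1) (1 / 4 : R).
    by rewrite big_const_seq count_predT size_iota iter_addr_0 -[RHS]mulr_natl div1r.
  rewrite -sumrB big_seq [leRHS]big_seq; apply: ler_sum => j; rewrite mem_iota => /andP[nj jn].
  have j0 : (0 < j)%N by exact: leq_ltn_trans nj.
  have pj := prime_nth_prime j0.
  rewrite /F vM_prime //; set p := nth_prime j in pj *.
  have lnp : 1 / 2 <= ln p%:R :> R.
    have h : ln 2%:R <= ln p%:R :> R by rewrite ler_ln ?posrE ?ltr0n ?prime_gt0 // ler_nat prime_gt1.
    apply: le_trans h.
    have := @le_ln1Dx R (- (1 / 2)) _; rewrite (_ : 1 - 1 / 2 = 2%:R^-1); last by field.
    rewrite lnV ?posrE // => h; have := h _; lra.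
  have lnT : ln p%:R <= t.
    apply: ln_nat_le; first exact: prime_gt0.
    apply: ltnW; apply: leq_ltn_trans XT; apply: (@leq_trans X); last by rewrite leq_pmull.
    by apply: leq_trans pX; apply: leq_nth_prime; rewrite -ltnS -addSn.
  case: (boolP (q %| _)%N) => [qa|qa] /=; last first.
    have := bias_norm (rt R k p / q%:R); rewrite ler_norml => /andP[h1 h2]; nra.
  have /andP[a1 a2] := floor_root_rt R p k0.
  have [m em] := dvdnP qa.
  have hb : 1 / 2 <= bias (rt R k p / q%:R).
    apply: (@bias_ge_half _ _ m); rewrite em natrM in a1 a2.
    rewrite ler_pdivlMr // a1 /= ltr_pdivrMr // mulrDl; lra.
  rewrite subr0; nra.
set s := floor_root 2 X in NP.
set cn := count _ _ in cnt PR.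
have nR : n%:R <= 4 * e%:R * n1%:R :> R by rewrite -!natrM ler_nat.
have kN9 : (C + 4 <= k * N)%N.
  have : (N <= k * N)%N by rewrite leq_pmull.
  by apply: leq_trans; move: NC wK w21; clear; lia.
have kN92 : (9 <= k * N)%N by move: NC wK w21 (leq_pmull N k0); clear; lia.
have b1 : cn%:R * t ^+ 4 <= n%:R.
  rewrite -natrX -natrM ler_nat; apply: leq_trans Tn; apply: (@leq_trans (T ^ (C + 4))).
    by rewrite expnD leq_mul2r ltnW ?orbT.
  by rewrite leq_pexp2l.
have b2 : s%:R * t ^+ 4 <= n%:R.
  rewrite -natrX -natrM ler_nat -(leq_exp2r _ _ (ltn0Sn 1)) expnMn -expnM.
  have [s2 _] := floor_rootP X (ltn0Sn 1).
  apply: (@leq_trans (X * T ^ 8)); first by rewrite leq_mul2r s2 orbT.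
  rewrite /X -mulnA -expnS -[(n ^ 2)%N]/(n * n)%N leq_mul2l; apply/orP; right.
  by apply: leq_trans Tn; rewrite leq_pexp2l.
have b3 : X%:R / t ^+ 4 * t ^+ 3 <= n%:R.
  by rewrite /X natrM -/t le_eqVlt; apply/orP; left; apply/eqP; field; rewrite gt_eqF.
have teR : 80 * e%:R <= t by rewrite /t -natrM ler_nat.
have n0 : (0 < n)%N by apply: leq_trans Tn; rewrite expn_gt0 T0.
have n1R : 0 < n1%:R :> R by rewrite ltr0n lt0n; apply/eqP => n10; move: ne n0; rewrite n10 muln0; clear; lia.
have n0R : 0 < n%:R :> R by rewrite ltr0n.
have key : n1%:R / 4 <= 2 * t * cn%:R + 3 / 2 * (t * (s * T)%:R) + 3 / 2 * (X%:R / t ^+ 4) by lra.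
have t2 : 0 < t ^+ 2 by rewrite exprn_gt0.
have := ler_wpM2r (ltW t2) key.
set xx := X%:R / t ^+ 4 in b3 *; have xx0 : 0 <= xx by apply: divr_ge0 => //; exact: exprn_ge0 (ltW tR).
rewrite natrM -/t.
have -> : (2 * t * cn%:R + 3 / 2 * (t * (s%:R * t)) + 3 / 2 * xx) * t ^+ 2 =
  2 * (cn%:R * t ^+ 3) + 3 / 2 * (s%:R * t ^+ 4) + 3 / 2 * (xx * t ^+ 2) by ring.
have b1' : cn%:R * t ^+ 3 <= cn%:R * t ^+ 4 by apply: ler_wpM2l => //; rewrite ler_weXn2l //; lra.
have b3' : xx * t ^+ 2 <= xx * t ^+ 3 by apply: ler_wpM2l => //; rewrite ler_weXn2l //; lra.
move=> fin.
(* The three errors amount to [2 + 3 / 2 + 3 / 2 = 5] times [n], and [n <= 4 * e * n1]; the quarter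
   on the left makes this 80. *)
have fin2 : n1%:R * t ^+ 2 <= 80 * e%:R * n1%:R by move: fin b1 b1' b2 b3 b3' nR; clear; lra.
have : n1%:R * t < n1%:R * t ^+ 2.
  rewrite ltr_pM2l // expr2 -[ltLHS]mulr1 ltr_pM2l //; move: t64; clear; lra.
have := ler_wpM2r (ltW n1R) teR; move: fin2; clear; lra.
Qed.

Local Close Scope ring_scope.

(** * Representation of large integers *)

Lemma leq_sum_range m n (f g : nat -> nat) :
  (forall i, m <= i < n -> f i <= g i) ->
  \sum_(m <= i < n) f i <= \sum_(m <= i < n) g i.
Proof.
move=> fg; rewrite big_nat_cond [X in _ <= X]big_nat_cond.
by apply: leq_sum => i /andP[/fg].
Qed.

(** [T] is at most a constant times [2 ^ w], so the power [T ^ d] uses no more than half of the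
    exponent [u]; the other half pays for the constant [c]. *)
Lemma expn_le_pow2 d : exists T0, forall T, T0 <= T -> T ^ d <= 2 ^ (T %/ 4).
Proof.
set c := (8 * d.+1) ^ d; exists (8 * c + 8) => T hT.
set u := T %/ 4; set w := u %/ (2 * d).+1.
have Tu : T <= 4 * u.+1 by have := ltn_ceil T (isT : 0 < 4); rewrite -/u; lia.
have uc : 2 * c <= u by rewrite /u leq_divRL //; lia.
have uw : u < w.+1 * (2 * d).+1 by exact: ltn_ceil.
have wu : w * (2 * d).+1 <= u by exact: leq_divM.
have w2 : w.+1 <= 2 ^ w by rewrite ltn_expl.
have T1 : T <= 8 * d.+1 * 2 ^ w.
  apply: leq_trans Tu _; apply: (@leq_trans (8 * d.+1 * w.+1)).
    by rewrite -[8]/(4 * 2) -!mulnA leq_mul2l /=; move: uw; clear; nia.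
  by rewrite leq_mul2l w2 orbT.
apply: (@leq_trans ((8 * d.+1 * 2 ^ w) ^ d)); first by case: (d) T1 => // d' T1; rewrite leq_exp2r.
rewrite expnMn -expnM -/c.
have e : u = (w * d + (u - w * d)) by move: wu; clear; nia.
rewrite e expnD mulnC leq_mul2l; apply/orP; right.
apply: (@leq_trans (2 ^ c)); first exact: ltnW (ltn_expl _ _).
by rewrite leq_exp2l //; move: wu uc; clear; nia.
Qed.

Lemma expSn_le v k : v.+1 ^ k <= v ^ k + k * v.+1 ^ k.-1.
Proof.
elim: k => [|[|k] IH]; rewrite ?expn0 ?expn1 ?mul1n ?addn1 //.
rewrite /= in IH *; rewrite [X in X <= _]expnS [v ^ k.+2]expnS.
have : v * v.+1 ^ k.+1 <= v * (v ^ k.+1 + k.+1 * v.+1 ^ k) by rewrite leq_mul2l IH orbT.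
have : v * v.+1 ^ k <= v.+1 ^ k.+1 by rewrite expnS leq_mul2r leqnSn orbT.
move: (v.+1 ^ k.+1) (v.+1 ^ k) (v ^ k.+1) => a b c; clear; nia.
Qed.

(** Indices sharing the value [v] have their primes in [[v ^ k, v.+1 ^ k)], which holds at most
    [k * M ^ k.-1] integers. *)
Lemma distinct_values k n1 m M : 0 < k -> 0 < m ->
  (forall j, j \in iota m n1 -> floor_root k (nth_prime j) < M) ->
  n1 <= size (undup [seq floor_root k (nth_prime j) | j <- iota m n1]) * (k * M ^ k.-1).
Proof.
move=> k0 m0 aM; rewrite leqNgt; apply/negP; set vs := undup _ => lt.
pose a j := floor_root k (nth_prime j).
pose f j := index (a j) vs.
have [] := @pigeonhole f (iota m n1) (size vs) (k * M ^ k.-1).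
- by move=> j js; rewrite /f index_mem mem_undup; apply: map_f.
- by rewrite size_iota.
move=> c cl; apply/negP; rewrite -leqNgt -size_filter.
set v := nth 0 vs c.
have fv j : j \in iota m n1 -> f j == c -> a j = v.
  by move=> js /eqP fc; rewrite /v -fc nth_index // mem_undup; apply: map_f.
set s := [seq j <- _ | _].
have sj j : j \in s -> [/\ j \in iota m n1, v ^ k <= nth_prime j & nth_prime j < v.+1 ^ k].
  rewrite mem_filter => /andP[fj js]; have := floor_rootP (nth_prime j) k0.
  by rewrite -/(a j) (fv j js fj) => -[].
case: (posnP (size s)) => [->//|s0].
have vM : v < M.
  have := mem_nth 0 s0; rewrite mem_filter => /andP[fj js].
  by rewrite -(fv _ js fj); exact: aM.
apply: (@leq_trans (v.+1 ^ k - v ^ k)); last first.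
  rewrite leq_subLR; apply: leq_trans (expSn_le v k) _.
  by rewrite leq_add2l leq_mul2l; apply/orP; right; case: (k) => [|[|k']] //=; rewrite leq_exp2r.
rewrite -(size_map nth_prime) -[X in _ <= X](size_iota (v ^ k)).
apply: uniq_leq_size.
  by rewrite map_inj_uniq; [rewrite filter_uniq // iota_uniq|exact: nth_prime_inj].
move=> p /mapP[j /sj[_ h1 h2] ->]; rewrite mem_iota h1 subnKC //.
by apply: ltnW; apply: leq_ltn_trans h1 h2.
Qed.

Lemma sum_filter_notin (a : nat -> nat) (s B : seq nat) M : uniq s ->
  (forall j, j \in s -> a j <= M) ->
  \sum_(j <- s) a j <= \sum_(j <- [seq j <- s | j \notin B]) a j + size B * M.
Proof.
move=> us aM; rewrite (bigID (mem B)) /= addnC big_filter leq_add2l -big_filter.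
apply: (@leq_trans (size [seq j <- s | j \in B] * M)).
  rewrite -sum1_size big_distrl /= big_seq [X in _ <= X]big_seq.
  by apply: leq_sum => j; rewrite mem_filter mul1n => /andP[_ /aM].
rewrite leq_mul2r; apply/orP; right; apply: uniq_leq_size; first exact: filter_uniq.
by move=> j; rewrite mem_filter => /andP[].
Qed.

(** The hypotheses put the remainder [h - S n] near [S n / (2 * e)], about half of what the window
    is sure to offer: its values are at least [a n.+1], and [S n <= n * a n.+1]. *)
Lemma prime_sum_represent (R : realType) k e : 0 < k -> 0 < e ->
  exists n0, forall n, n0 <= n -> forall h,
    let a j := floor_root k (nth_prime j) in
    let S m := \sum_(1 <= i < m.+1) a i in
    (2 * e).+1 * S n <= 2 * e * h -> 2 * e * h < (2 * e).+1 * S n.+1 ->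
    exists2 J, uniq J /\ {subset J <= iota n.+1 (n %/ e)} & h = S n + \sum_(j <- J) a j.
Proof.
move=> k0 e0.
(* [T ^ g] is the loss in density: values lie below [T ^ (N + 3)], and a block of [n1] indices has
   at least [T ^ (N + 3 - g)] distinct ones. Far pairs need [H > 5 * g + 2]; the surplus makes room
   for the exponents 21 and 252 of the trigonometric estimate. *)
have [g eg] : exists g, g = 3 * k + 1 by eexists.
have [H eH] : exists H, H = 5 * g + 200 by eexists.
have [N eN] : exists N, N = 2 * H by eexists.
have N0 : 0 < N by move: eN eH; clear; lia.
have [T0 HT0] := expn_le_pow2 (k * N + 2).
pose T1 := T0 + 2 ^ (k * N) + 100 * e + 16 * k ^ 2 + 4 * e * k + 100.
exists (T1 ^ (k * N)) => n nT1 h a S hlo hhi.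
have kN0 : 0 < k * N by rewrite muln_gt0 k0 N0.
have exT : exists T, T ^ (k * N) <= n by exists T1.
have bT T : T ^ (k * N) <= n -> T <= n.
  by apply: leq_trans; case: T => // T; rewrite -[X in X <= _]expn1 leq_pexp2l.
(* Maximality yields [n < T ^ (k * N + 1)], since going from [T] to [T.+1] at most doubles the base
   and [2 ^ (k * N) <= T]. *)
have [T TN Tmax] := ex_maxnP exT bT.
have T1T : T1 <= T by exact: Tmax.
have T64 : 64 <= T by move: T1T; rewrite /T1; clear; lia.
have T0T : 0 < T by exact: leq_trans T64.
have Tk2 : 16 * k ^ 2 <= T by move: T1T; rewrite /T1; clear; lia.
have Tek : 4 * e * k <= T by move: T1T; rewrite /T1; clear; lia.
have Te : 100 * e <= T by move: T1T; rewrite /T1; clear; lia.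
have Te80 : 80 * e <= T by move: Te; clear; lia.
have T2 : 2 ^ (k * N) <= T by move: T1T; rewrite /T1; clear; lia.
have Tpow : T ^ (k * N + 2) <= 2 ^ (T %/ 4) by apply: HT0; move: T1T; rewrite /T1; clear; lia.
have pw i j : i <= j -> T ^ i <= T ^ j by move=> ij; rewrite leq_pexp2l.
have pw1 c i j : c <= T -> i < j -> c * T ^ i <= T ^ j.
  by move=> cT ij; apply: leq_trans (pw i.+1 j ij); rewrite expnS leq_mul2r cT orbT.
have nT : n < T ^ (k * N + 1).
  have : n < T.+1 ^ (k * N) by rewrite ltnNge; apply/negP => /Tmax; rewrite ltnn.
  move/leq_trans; apply; apply: (@leq_trans ((2 * T) ^ (k * N))).
    by rewrite leq_exp2r //; move: T0T; clear; lia.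
  by rewrite expnMn addn1 expnS leq_mul2r T2 orbT.
have nTT : n * T <= T ^ (k * N + 2) by rewrite addn2 expnSr leq_mul2r -addn1 ltnW ?orbT.
have n0 : 0 < n by apply: leq_trans TN; rewrite expn_gt0 T0T.
(* Chebyshev with [T %/ 4] as logarithm; [Tpow] supplies its hypothesis. *)
have p2n : nth_prime (2 * n) <= n * T.
  have L0 : 0 < T %/ 4 by rewrite divn_gt0 //; move: T64; clear; lia.
  have LT : (2 * n * (T %/ 4)).*2 <= n * T.
    have : n * (T %/ 4 * 4) <= n * T by rewrite leq_mul2l leq_divM orbT.
    by move: (T %/ 4); clear; lia.
  apply: leq_trans (LT); apply: nth_prime_le => //; first by rewrite muln_gt0.
  apply: leq_ltn_trans LT _.
  have : n * T < T ^ (k * N + 2) by rewrite addn2 expnSr ltn_pmul2r // -[(k * N).+1]addn1.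
  by move/leq_trans; apply.
pose M := T ^ (N + 3).
have aM j : j <= 2 * n -> a j < M.
  move=> jn; rewrite /a; have [h1 _] := floor_rootP (nth_prime j) k0.
  rewrite -(ltn_exp2r _ _ k0); apply: leq_ltn_trans h1 _.
  apply: leq_ltn_trans (leq_nth_prime jn) _; apply: leq_ltn_trans p2n _.
  apply: leq_ltn_trans nTT _; rewrite /M -expnM ltn_exp2l; last by move: T64; clear; lia.
  by rewrite mulnDl mulnC; move: k0; clear; lia.
have aT j : n < j -> T ^ N <= a j.
  move=> nj; rewrite leq_floor_root // -expnM mulnC (leq_trans TN) //.
  exact: leq_trans (ltnW nj) (nth_prime_ge j).
pose n1 := n %/ (3 * e).
have nbig : 12 * e <= n.
  by apply: leq_trans (bT T TN); move: Te; clear; lia.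
have n13 : 3 * n1 <= n %/ e by rewrite leq_divRL //; have := leq_divM n (3 * e); rewrite -/n1; move: (n1); clear; lia.
have n1e : n <= 4 * e * n1.
  have : n < n1.+1 * (3 * e) by apply: ltn_ceil; rewrite muln_gt0.
  have : 3 <= n1 by rewrite leq_divRL ?muln_gt0 //; move: nbig; clear; lia.
  by clear; nia.
have nen : n %/ e <= n by exact: leq_div.
pose s1 := iota n.+1 n1; pose s2 := iota (n.+1 + n1) n1; pose s3 := iota (n.+1 + n1 + n1) n1.
have s123 : s1 ++ s2 ++ s3 = iota n.+1 (n1 + (n1 + n1)).
  by rewrite /s1 /s2 /s3 iotaD [iota _ (n1 + n1)]iotaD.
pose win := iota n.+1 (n %/ e).
have swin j : j \in win -> n < j <= 2 * n.
  by rewrite mem_iota => /andP[nj jn]; rewrite nj /=; move: jn nen; clear; lia.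
have s123w j : j \in s1 ++ s2 ++ s3 -> j \in win.
  rewrite s123 !mem_iota => /andP[-> jn] /=; move: jn n13; clear; lia.
(* [l] exceeds the average gap [T ^ g] by a factor [T], [l * Rr] stays below the number of distinct
   values, and [P * P = T ^ (N + 2 * g + 2)] exceeds [l * M = T ^ (N + g + 4)]. *)
pose l := T ^ (g + 1); pose P := T ^ (H + g + 1); pose Rr := T ^ (N - 2 * g).
have Nl : 2 * g <= N by move: eN eH; clear; lia.
have g4 : 4 <= g by move: eg k0; clear; lia.
have dist s m : 0 < m -> s = iota m n1 -> {subset s <= win} ->
    T ^ (N + 3 - g) <= size (undup (map a s)).
  move=> m0 -> sw.
  have := @distinct_values k n1 m M k0 m0 (fun j js => aM j (proj2 (andP (swin j (sw j js))))).
  rewrite -/a; set vs := undup _ => hd.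
  have h1 : T ^ (k * N) <= T ^ (3 * k - 2 + (k.-1 * N)) * size vs.
    apply: leq_trans TN _; apply: leq_trans n1e _.
    apply: (@leq_trans (4 * e * (size vs * (k * M ^ k.-1)))); first by rewrite leq_mul2l hd orbT.
    rewrite [X in X <= _](_ : _ = 4 * e * k * M ^ k.-1 * size vs); last first.
      by move: (M ^ _) (size vs); clear; lia.
    rewrite leq_mul2r; apply/orP; right.
    apply: (@leq_trans (T * M ^ k.-1)); first by rewrite leq_mul2r Tek orbT.
    rewrite /M -expnM -expnS; apply: pw.
    by move: k0; case: (k) => // k' _; rewrite /= ; clear; lia.
  have T00 : 0 < T ^ (3 * k - 2 + k.-1 * N) by rewrite expn_gt0 T0T.
  rewrite -(leq_pmul2l T00) -expnD; apply: leq_trans h1; apply: pw.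
  have : g <= N by move: Nl; clear; lia.
  rewrite eg; move: k0; case: (k) => // k' _; rewrite /=; clear; lia.
have u123 : uniq (s1 ++ s2 ++ s3) by rewrite s123 iota_uniq.
have in1 : {subset s1 <= win} by move=> j js; apply: s123w; rewrite mem_cat js.
have in2 : {subset s2 <= win} by move=> j js; apply: s123w; rewrite !mem_cat js orbT.
have in3 : {subset s3 <= win} by move=> j js; apply: s123w; rewrite !mem_cat js !orbT.
have d2 := dist s2 _ (ltn0Sn _) erefl in2.
have d3 := dist s3 _ (ltn0Sn _) erefl in3.
have cond2 : M %/ l + l * Rr < (size (undup (map a s2)))./2.
  have e1 : M %/ l = T ^ (N + 2 - g).
    have -> : M = T ^ (N + 2 - g) * l.
      by rewrite /M /l -expnD; congr (_ ^ _); move: Nl; clear; lia.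
    by rewrite mulnK // expn_gt0 T0T.
  have e2 : l * Rr <= T ^ (N + 2 - g).
    by rewrite /l /Rr -expnD; apply: pw; move: Nl; clear; lia.
  have e3 : 64 * T ^ (N + 2 - g) <= T ^ (N + 3 - g).
    by apply: pw1 => //; move: Nl; clear; lia.
  have e4 : 0 < T ^ (N + 2 - g) by rewrite expn_gt0 T0T.
  by rewrite e1; move: e2 e3 e4 d2; move: (l * Rr) (T ^ _) (T ^ _) (size _); clear; lia.
have cond3 : (M %/ Rr).+1 * l * P.*2 < size (undup (map a s3)).
  have -> : M %/ Rr = T ^ (2 * g + 3).
    have -> : M = T ^ (2 * g + 3) * Rr.
      by rewrite /M /Rr -expnD; congr (_ ^ _); move: Nl; clear; lia.
    by rewrite mulnK // expn_gt0 T0T.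
  apply: leq_trans d3.
  have e1 : 5 * T ^ (2 * g + 3 + (g + 1) + (H + g + 1)) <= T ^ (N + 3 - g).
    apply: pw1; first by move: T64; clear; lia.
    by move: eN eH; clear; lia.
  apply: leq_trans e1.
  have : 0 < T ^ (2 * g + 3) by rewrite expn_gt0 T0T.
  have : 0 < l by rewrite expn_gt0 T0T.
  have : 0 < P by rewrite expn_gt0 T0T.
  rewrite (expnD T (2 * g + 3 + (g + 1))) (expnD T (2 * g + 3)) -/l -/P.
  move: (T ^ (2 * g + 3)) (l) (P) => x y z z0 y0 x0.
  have hx : x.+1 * (y * z) <= 2 * x * (y * z) by rewrite leq_mul2r; move: x0; clear; lia.
  have : 0 < x * (y * z) by rewrite !muln_gt0 x0 y0 z0.
  by rewrite -mul2n -!mulnA; move: hx; rewrite -!mulnA [y * (2 * z)]mulnCA; move: (y * z); clear; nia.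
have PM : l.+1 * M <= P * P.
  have l0 : 0 < l by rewrite expn_gt0 T0T.
  apply: (@leq_trans (T * l * M)).
    rewrite leq_mul2r; apply/orP; right; move: T64 l0; clear; nia.
  by rewrite /l /M /P -expnS -!expnD; apply: pw; move: eN g4; clear; lia.
have nondiv q : prime q -> q <= l -> l <= count (fun j => ~~ (q %| a j)) s1.
  move=> pq ql; have n1l : l <= n1.
    rewrite leq_divRL ?muln_gt0 // mulnC; apply: leq_trans TN.
    apply: (@leq_trans (T * l)).
      by rewrite leq_mul2r; apply/orP; right; move: Te; clear; lia.
    rewrite /l -expnS; apply: pw; apply: (@leq_trans N); last by rewrite leq_pmull.
    by move: eN eH; clear; lia.
  have [k1|k1] := leqP k 1.
    have ek : k = 1 by move: k0 k1; clear; lia.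
    suff -> : count (fun j => ~~ (q %| a j)) s1 = size s1 by rewrite size_iota.
    apply/eqP; rewrite -all_count; apply/allP => j /in1 /swin /andP[nj _].
    rewrite /a ek floor_root1 dvdn_prime2 //; last by apply: prime_nth_prime; exact: leq_ltn_trans nj.
    apply/eqP => eq; have jn : nth_prime j <= n.
      rewrite -eq (leq_trans ql) // (leq_trans n1l) // /n1; exact: leq_div.
    by have := leq_trans nj (leq_trans (nth_prime_ge j) jn); rewrite ltnn.
  apply: (@many_nondivisible R k (g + 1) N 21 252 e T n n1 q) => //.
  - by move: eN eH; clear; lia.
  - apply: leq_trans p2n; apply: leq_nth_prime; rewrite mul2n -addnn leq_add2l.
    exact: leq_div.
  - apply: leq_ltn_trans (leq_mul (leqnn 2) nTT) _.
    apply: leq_ltn_trans (leq_mul (leqnn 2) Tpow) _.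
    rewrite -expnS ltn_exp2l //; have := leq_divM T 4; move: T64; clear; lia.
  - exact: prime_gt1.
have l0 : 0 < l by rewrite expn_gt0 T0T.
have R0 : 0 < Rr by rewrite expn_gt0 T0T.
have aM' j : j \in s1 ++ s2 ++ s3 -> a j <= M.
  by move=> /s123w/swin/andP[_ jn]; apply: ltnW; exact: aM.
have [B [lo [uB sB szB lole HB]]] := interval_core u123 aM' l0 R0 PM cond2 cond3 nondiv.
have PR : P <= Rr by apply: pw; move: eN eH; clear; lia.
have lR : l <= Rr by apply: pw; move: eN eH; clear; lia.
pose F := [seq j <- win | j \notin B].
have uwin : uniq win by exact: iota_uniq.
have uFB : uniq (F ++ B).
  rewrite cat_uniq filter_uniq //= uB andbT; apply/hasPn => j jB.
  by rewrite mem_filter jB.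
have Fwin j : j \in F -> j \in win by rewrite mem_filter => /andP[].
have aMw j : j \in win -> a j <= M by move=> /swin/andP[_ jn]; apply: ltnW; exact: aM.
have fill := interval_fill HB (leqnn _) uFB (fun j jF => aMw j (Fwin j jF)).
(* The indices of [B] cost up to [5 * (Rr * M)], which the comparisons below multiply by [2 * e].
   The result is negligible against [S n >= T ^ (2 * N - 2)]. *)
have RM : 10 * e * (Rr * M) <= T ^ (2 * N - 3).
  have -> : Rr * M = T ^ (2 * N + 3 - 2 * g).
    by rewrite /Rr /M -expnD; congr (_ ^ _); move: Nl; clear; lia.
  by apply: pw1; [move: Te; clear; lia|move: g4 Nl; clear; lia].
have Sn : S n.+1 = S n + a n.+1 by rewrite /S big_nat_recr.
have an0 : T ^ N <= a n.+1 by exact: aT.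
have mono i j : 0 < i -> i <= j -> a i <= a j.
  move=> i0 ij; rewrite leq_floor_root // (leq_trans (proj1 (floor_rootP _ k0))) //.
  exact: leq_nth_prime.
have Sle : S n <= n * a n.+1.
  rewrite /S -[n in n * _](subn1 n.+1) -sum_nat_const_nat.
  apply: leq_sum_range => i /andP[i0 iN]; apply: mono => //; exact: ltnW.
have kNN : N <= k * N by rewrite leq_pmull.
have Sge : T ^ (2 * N - 2) <= S n.
  have half i : n %/ 2 < i -> T ^ (N - 1) <= a i.
    move=> ni; rewrite leq_floor_root // (leq_trans _ (nth_prime_ge i)) //.
    apply: leq_trans ni; apply: leqW.
    rewrite leq_divRL // -expnM; apply: leq_trans TN.
    rewrite mulnC; apply: pw1; first by move: T64; clear; lia.
    by rewrite mulnC mulnBr muln1 ltn_subrL k0 kN0.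
  apply: (@leq_trans ((n - n %/ 2) * T ^ (N - 1))).
    have h1 : T ^ N <= T * (n - n %/ 2).
      apply: (@leq_trans n); first by apply: leq_trans TN; exact: pw.
      have := leq_divM n 2; move: T64; clear; nia.
    have -> : 2 * N - 2 = (N - 1) + (N - 1) by move: N0; clear; lia.
    rewrite expnD leq_mul2r; apply/orP; right.
    by rewrite -(leq_pmul2l T0T) -expnS subn1 prednK.
  rewrite /S (@big_cat_nat _ _ _ (n %/ 2).+1) //=; last by rewrite ltnS leq_div.
  apply: leq_trans (leq_addl _ _); rewrite -subSS -sum_nat_const_nat.
  by apply: leq_sum_range => i /andP[i0 _]; exact: half.
have wsum : (n %/ e) * a n.+1 <= \sum_(j <- F) a j + size B * M.
  apply: leq_trans (sum_filter_notin _ uwin aMw).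
  rewrite -[X in X * _](size_iota n.+1) -/win -sum1_size big_distrl /= big_seq [X in _ <= X]big_seq.
  apply: leq_sum => j /swin/andP[nj _]; rewrite mul1n; exact: mono.
have szBM : size B * M <= 5 * (Rr * M).
  rewrite mulnA leq_mul2r; apply/orP; right; move: szB PR lR; clear; lia.
have loM : lo <= 3 * (Rr * M).
  apply: leq_trans lole _; rewrite mulnA leq_mul2r; apply/orP; right; move: PR lR; clear; lia.
have S0 : S n <= h.
  rewrite -(leq_pmul2l (_ : 0 < 2 * e)) ?muln_gt0 //; apply: leq_trans hlo.
  by rewrite leq_mul2r leqnSn orbT.
have tlo : lo <= h - S n.
  have e1 : 2 * e * lo <= S n.
    apply: leq_trans Sge; apply: (@leq_trans (10 * e * (Rr * M))).
      by move: loM; move: (Rr * M); clear; nia.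
    by apply: leq_trans RM _; apply: pw; move: N0; clear; lia.
  rewrite -(leq_pmul2l (_ : 0 < 2 * e)) ?muln_gt0 // mulnBr leq_subRL.
    by move: hlo e1; rewrite mulSn; move: (2 * e * S n) (2 * e * lo) (2 * e * h); clear; lia.
  by rewrite leq_mul2l S0 orbT.
have thi : h - S n <= lo + M + \sum_(j <- F) a j.
  apply: leq_trans (leq_addl _ _).
  have q1 : n < (n %/ e).+1 * e by exact: ltn_ceil.
  have q2 : 10 * e * (Rr * M) + (4 * e).+1 * a n.+1 <= n * a n.+1.
    have h1 : 2 * (4 * e).+1 <= n.
      by apply: leq_trans nbig; move: e0; clear; lia.
    have h2 : 2 * T ^ (2 * N - 3) <= T ^ N * T ^ N.
      rewrite -expnD; apply: pw1; first by move: T64; clear; lia.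
      by move: N0; clear; lia.
    have h3 : T ^ N * T ^ N <= n * a n.+1.
      by apply: leq_mul => //; apply: leq_trans TN; exact: pw.
    have h4 : 2 * (4 * e).+1 * a n.+1 <= n * a n.+1 by rewrite leq_mul2r h1 orbT.
    by move: RM h2 h3 h4; move: (10 * e * (Rr * M)) (n * a n.+1) (T ^ (2 * N - 3)) (T ^ N * T ^ N); rewrite -mulnA; move: ((4 * e).+1 * a n.+1); clear; lia.
  rewrite -(leq_pmul2l (_ : 0 < 2 * e)) ?muln_gt0 // mulnBr leq_subLR.
  apply: ltnW; apply: leq_trans hhi _; rewrite Sn.
  have q3 : 2 * n * a n.+1 <= 2 * e * ((n %/ e) * a n.+1) + 2 * e * a n.+1.
    have : n * a n.+1 <= (n %/ e).+1 * e * a n.+1 by rewrite leq_mul2r ltnW ?orbT.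
    by move: (n %/ e) (a n.+1) => x y; clear; nia.
  have q4 : 2 * e * ((n %/ e) * a n.+1) <= 2 * e * \sum_(j <- F) a j + 10 * e * (Rr * M).
    apply: (@leq_trans (2 * e * (\sum_(j <- F) a j + size B * M))); first by rewrite leq_mul2l wsum orbT.
    rewrite mulnDr leq_add2l; move: szBM; move: (Rr * M) (size B * M) => x y; clear; nia.
  move: q2 q3 q4 Sle; move: (\sum_(j <- F) a j) (n %/ e) (Rr * M) (a n.+1) (S n) => x y z u v; clear; nia.
have [J [uJ JFB eJ]] := fill _ (introT andP (conj tlo thi)).
exists J; last by rewrite -eJ subnKC.
split=> // j /JFB; rewrite mem_cat => /orP[/Fwin //|/sB /s123w //].
Qed.

Local Open Scope ring_scope.

(* eps : a real number (R : realType); j <= floor((1+eps) n)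
   is written as (j%:R <= (1+eps) * n%:R), equivalent for integers j. *)
Theorem theorem4p3 (R : realType) (k : nat) (eps : R) :
  (0 < k)%N -> 0 < eps ->
  exists h0 : nat, forall h : nat, (h0 <= h)%N ->
    exists (n : nat) (J : seq nat),
      uniq J /\
      (forall j, j \in J -> (n < j)%N /\ j%:R <= (1 + eps) * n%:R) /\
      h = (\sum_(1 <= i < n.+1) floor_root k (nth_prime i)
           + \sum_(j <- J) floor_root k (nth_prime j))%N.
Proof.
move=> k0 eps0; pose e := Num.bound eps^-1.
have epsV : 0 < eps^-1 by rewrite invr_gt0.
have ee : eps^-1 < e%:R by apply: archi_boundP; exact: ltW.
have e0 : (0 < e)%N by rewrite -(ltr0n R); apply: lt_trans ee.
have [n0 Hn0] := @prime_sum_represent R k e k0 e0.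
pose S m := (\sum_(1 <= i < m.+1) floor_root k (nth_prime i))%N.
(* This threshold forces the maximal [n] below to be at least [n0]; the maximum exists because
   [m <= S m]. *)
exists ((2 * e).+1 * S n0)%N => h h0h.
have geS m : (m <= S m)%N.
  elim: m => [|m IH]; first exact: leq0n.
  rewrite /S big_nat_recr //= -[X in (X <= _)%N]addn1; apply: leq_add; first exact: IH.
  by rewrite leq_floor_root // exp1n; exact: prime_gt0 (prime_nth_prime (ltn0Sn m)).
have ex : exists n, ((2 * e).+1 * S n <= 2 * e * h)%N.
  by exists n0; apply: leq_trans h0h _; rewrite leq_pmull // muln_gt0.
have bnd n : ((2 * e).+1 * S n <= 2 * e * h)%N -> (n <= 2 * e * h)%N.
  by apply: leq_trans; apply: leq_trans (geS n) _; rewrite leq_pmull.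
have [n hn nmax] := ex_maxnP ex bnd.
have n0n : (n0 <= n)%N by apply: nmax; apply: leq_trans h0h _; rewrite leq_pmull // muln_gt0.
have hn1 : (2 * e * h < (2 * e).+1 * S n.+1)%N.
  by rewrite ltnNge; apply/negP => /nmax; rewrite ltnn.
have [J [uJ JW] eh] := Hn0 n n0n h hn hn1.
exists n, J; split=> //; split=> // j /JW; rewrite mem_iota => /andP[nj jn]; split=> //.
rewrite addSn ltnS in jn; apply: (@le_trans _ _ (n + n %/ e)%:R); first by rewrite ler_nat.
rewrite natrD mulrDl mul1r lerD2l.
have eR : 0 < e%:R :> R by rewrite ltr0n.
apply: (@le_trans _ _ (n%:R / e%:R)).
  by rewrite ler_pdivlMr // -natrM ler_nat leq_divM.
rewrite mulrC; apply: ler_wpM2r => //.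
by rewrite -[leRHS]invrK lef_pV2 ?posrE // ltW.
Qed.
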